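(* Let $f$ be a transcendental meromorphic function in the complex plane such that its inverse function $f^{-1}$ has a logarithmic singularity over $\infty$. Then for each neighbourhood $U$ of the singularity there exist infinitely many pairwise disjoint trajectories of the flow $\dot z = f(z)$ on each of which $z(t)$ tends to infinity in finite increasing time from within $U$; that is, writing $(\alpha,\beta)$ for the maximal interval of definition of the trajectory, $\beta \in \mathbb{R}$, $\lim_{t\to\beta-} z(t) = \infty$, and $z(t) \in U$ for all $t<\beta$ sufficiently close to $\beta$.
   Context: A trajectory of $\dot z = \frac{dz}{dt} = f(z)$ ($t$ real) is a path $z(t)$ in $\mathbb{C}$ with $z'(t) = f(z(t)) \in \mathbb{C}$ for $t$ in some maximal interval $(\alpha,\beta)\subseteq\mathbb{R}$. Trajectories are disjoint if the corresponding subsets of $\mathbb{C}$ are disjoint. Logarithmic singularity over $\infty$: let $f$ be transcendental meromorphic in the plane, let $M>0$ be real, and let $U$ be a component of the set $\{z\in\mathbb{C}: |f(z)|>M\}$ (poles of $f$ are counted as points where $|f|=\infty$) with the following property: for some $z_0\in U$ with $w_0=f(z_0)\in\mathbb{C}$, a branch of the inverse function $z=f^{-1}(w)$ is defined near $w_0$, mapping $w_0$ to $z_0$, and admits unrestricted analytic continuation in the annulus $M<|w|<\infty$. Choosing $v_0$ with $e^{v_0}=w_0$, the function $\phi(v)=f^{-1}(e^v)$ is defined near $v_0$ and extends by the monodromy theorem to an analytic function on the half-plane $H=\{v: \mathrm{Re}\, v>\log M\}$. If $\phi$ is univalent on $H$, then the inverse function of $f$ is said to have a logarithmic singularity over $\infty$,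 and $U$ is called a neighbourhood of the singularity. (In this case $U$ contains no poles of $f$, $U$ contains a path tending to infinity on which $f(z)$ tends to infinity, and the inverse function $\log f$ of $\phi$ maps $U$ univalently onto $H$.) *)

(* Defs.v *)
From Stdlib Require Import Reals.
From Coquelicot Require Import Coquelicot.

Open Scope R_scope.

(* [Chat] is the Riemann sphere, with [None] the point at infinity: a
   meromorphic function takes the value [None] exactly at its poles. *)
Definition Chat : Type := option C.

(* The value 0 at poles is junk. *)
Definition finite_part (f : C -> Chat) (z : C) : C :=
  match f z with Some w => w | None => RtoC 0 end.

Definition disc (c : C) (r : R) (z : C) : Prop := Cmod (z - c)%C < r.

Definition analytic_on (D : C -> Prop) (g : C -> C) : Prop :=
  forall z : C, D z -> ex_derive (K := C_AbsRing) (V := C_NormedModule) g z.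

(* Complex differentiability at every non-pole, each of which has a pole-free
   neighbourhood, is holomorphy on the open complement of the poles; a pole is
   an isolated singularity at which the modulus tends to infinity. *)
Definition meromorphic (f : C -> Chat) : Prop :=
  forall z0 : C,
    match f z0 with
    | Some _ =>
        locally z0 (fun z => f z <> None) /\
        ex_derive (K := C_AbsRing) (V := C_NormedModule) (finite_part f) z0
    | None =>
        locally' z0 (fun z => f z <> None) /\
        filterlim (fun z => Cmod (finite_part f z))
          (locally' z0) (Rbar_locally p_infty)
    end.

Definition Cpoly (n : nat) (a : nat -> C) (z : C) : C :=
  sum_n (G := C_AbelianMonoid) (fun k => (a k * z ^ k)%C) n.

(* For meromorphic [f], values at the zeros of the denominator are determined
   by continuity into the sphere. *)
Definition rational (f : C -> Chat) : Prop :=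
  exists (n m : nat) (a b : nat -> C),
    (exists k : nat, (k <= m)%nat /\ b k <> RtoC 0) /\
    (forall z : C, Cpoly m b z <> RtoC 0 ->
       f z = Some (Cpoly n a z / Cpoly m b z)%C).

Definition transcendental_meromorphic (f : C -> Chat) : Prop :=
  meromorphic f /\ ~ rational f.

Definition connected (A : C -> Prop) : Prop :=
  forall V W : C -> Prop, open V -> open W ->
    (forall z, A z -> V z \/ W z) ->
    (forall z, A z -> ~ (V z /\ W z)) ->
    (forall z, A z -> V z) \/ (forall z, A z -> W z).

Definition component (U S : C -> Prop) : Prop :=
  (exists z, U z) /\
  (forall z, U z -> S z) /\
  connected U /\
  (forall V : C -> Prop, connected V ->
     (forall z, U z -> V z) -> (forall z, V z -> S z) ->
     forall z, V z -> U z).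

Definition modulus_gt (f : C -> Chat) (M : R) (z : C) : Prop :=
  match f z with Some w => M < Cmod w | None => True end.

Definition unit_interval (t : R) : Prop := 0 <= t <= 1.

(* Continuation along a path by function elements [(G t, disc (gam t) (rho t))]
   such that nearby elements have equal germs at the nearby path point. *)
Definition continues_along (g : C -> C) (gam : R -> C) : Prop :=
  exists (G : R -> C -> C) (rho : R -> R),
    locally (gam 0) (fun w => G 0 w = g w) /\
    forall t, unit_interval t ->
      0 < rho t /\
      analytic_on (disc (gam t) (rho t)) (G t) /\
      exists delta : R, 0 < delta /\
        forall s, unit_interval s -> Rabs (s - t) < delta ->
          disc (gam t) (rho t) (gam s) /\
          locally (gam s) (fun w => G s w = G t w).

Definition unrestricted_continuation (g : C -> C) (w0 : C) (A : C -> Prop)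
  : Prop :=
  forall gam : R -> C,
    continuous_on (U := C_UniformSpace) unit_interval gam ->
    gam 0 = w0 ->
    (forall t, unit_interval t -> A (gam t)) ->
    continues_along g gam.

Definition inverse_branch (f : C -> Chat) (w0 z0 : C) (g : C -> C) : Prop :=
  g w0 = z0 /\
  exists r : R, 0 < r /\
    analytic_on (disc w0 r) g /\
    (forall w, disc w0 r w -> f (g w) = Some w).

Definition Cexp (v : C) : C :=
  (exp (Re v) * cos (Im v), exp (Re v) * sin (Im v)).

Definition univalent_on (D : C -> Prop) (phi : C -> C) : Prop :=
  analytic_on D phi /\
  (forall u v, D u -> D v -> phi u = phi v -> u = v).

(* [phi] is the extension of [g o exp] to the half-plane, whose existence the
   monodromy theorem guarantees; it is unique, and changing the logarithm [v0]
   of [w0] only precomposes it with a translation by a multiple of 2 pi i. *)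
Definition log_singularity_neighbourhood (f : C -> Chat) (U : C -> Prop)
  : Prop :=
  exists M : R, 0 < M /\
    component U (modulus_gt f M) /\
    exists (z0 w0 : C) (g : C -> C),
      U z0 /\
      f z0 = Some w0 /\
      inverse_branch f w0 z0 g /\
      unrestricted_continuation g w0 (fun w => M < Cmod w) /\
      exists (v0 : C) (phi : C -> C),
        Cexp v0 = w0 /\
        locally v0 (fun v => phi v = g (Cexp v)) /\
        univalent_on (fun v => ln M < Re v) phi.

Definition in_interval (alpha beta : Rbar) (t : R) : Prop :=
  Rbar_lt alpha t /\ Rbar_lt t beta.

Definition solves_flow (f : C -> Chat) (alpha beta : Rbar) (z : R -> C)
  : Prop :=
  forall t : R, in_interval alpha beta t ->
    exists w : C, f (z t) = Some w /\
      is_derive (K := R_AbsRing) (V := C_R_NormedModule) z t w.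

(* The values of [z] outside the interval are irrelevant. *)
Definition trajectory (f : C -> Chat) (alpha beta : Rbar) (z : R -> C)
  : Prop :=
  Rbar_lt alpha beta /\
  solves_flow f alpha beta z /\
  (forall (alpha' beta' : Rbar) (y : R -> C),
     Rbar_le alpha' alpha -> Rbar_le beta beta' ->
     solves_flow f alpha' beta' y ->
     (forall t, in_interval alpha beta t -> y t = z t) ->
     alpha' = alpha /\ beta' = beta).

Definition orbit (alpha beta : Rbar) (z : R -> C) (p : C) : Prop :=
  exists t : R, in_interval alpha beta t /\ z t = p.

Definition disjoint (A B : C -> Prop) : Prop := forall p : C, ~ (A p /\ B p).

(* Main.v *)
(* On the half-plane [Re v > log M] the univalent map [phi] satisfies [f (phi v) = e^v], so in the
   coordinate [v] the flow is [v' = e^v / phi' v], and a primitive [F] of [phi' e^-v] is a complex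
   time.  A Koebe-type bound [|phi'' v| <= K |phi' v| / (Re v - log M)] makes [phi' e^-v]
   asymptotically a multiple of [e^-v]: normalised to vanish at infinity, [F] is close to
   [- phi' e^-v], hence [L = - log (- F)] has derivative close to 1 and is invertible far to the
   right.  The curves [Im L = 2 pi n] are trajectories on which [F] increases to 0, that is,
   [v] reaches infinity in finite time; [phi v] tends to infinity there because a finite cluster
   value would be a pole, where [1 / f] would have a zero of infinite order.  Different [n] give
   different trajectories, and uniqueness of solutions makes their orbits disjoint.

   The Koebe-type bound, with a non-sharp constant, comes from Cauchy estimates applied to
   [1 / (1 + psi)], where [psi] is a square root of a normalisation of [a - g] for a value [a]
   omitted by the univalent function [g]. *)
Require Import Defs.
From Stdlib Require Import Reals Lra Lia Classical ClassicalEpsilon.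
From Coquelicot Require Import Coquelicot.

(** * Complex derivatives and paths *)

(** Any constant [K] serves in the Koebe-type bound: the distance [Re v - log M] grows without
    limit, so far to the right the quotient is as small as desired. The same bound for
    [1 / (phi - p)] controls the approach of [phi] to a point [p] that it omits, and this excludes
    poles as cluster values: [|phi - p|] decays more slowly than any exponential, while [1 / f] at
    [phi v] is [e^-v]. The Cauchy estimates behind these bounds are derived from primitives on a
    half-plane, because the map [s -> a + e^-s] turns circles about [a] into vertical segments.
    Normalising [F] to vanish at infinity gives all the curves the same escape time 0. This is what
    separates the orbits: solutions of an autonomous flow may pass through one point at different
    times and are then time shifts of each other, but the common escape time leaves only the shift
    0, so intersecting orbits would agree at equal times, where the imaginary parts of [L]
    differ. *)

Definition cder (u : C -> C) (z l : C) : Prop :=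
  forall eps, 0 < eps -> exists d, 0 < d /\
    forall w, Cmod (w - z) < d ->
      Cmod (u w - u z - l * (w - z)) <= eps * Cmod (w - z).

Definition rder (g : R -> C) (t : R) (l : C) : Prop :=
  forall eps, 0 < eps -> exists d, 0 < d /\
    forall s, Rabs (s - t) < d ->
      Cmod (g s - g t - l * (s - t)%R) <= eps * Rabs (s - t).

Lemma im_le_Cmod (c : C) : Rabs (Im c) <= Cmod c.
Proof.
  apply Rle_trans with (2 := Rmax_Cmod c). apply Rmax_r.
Qed.

Lemma Cmod_le_re_im (c : C) : Cmod c <= Rabs (Re c) + Rabs (Im c).
Proof.
  replace c with (RtoC (Re c) + Ci * RtoC (Im c))%C at 1.
  2: { apply injective_projections; simpl; unfold Re, Im; ring. }
  eapply Rle_trans; [apply Cmod_triangle|].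
  rewrite Cmod_mult, Cmod_Ci, !Cmod_R; lra.
Qed.

Lemma Cmod_sub_comm (a b : C) : Cmod (a - b) = Cmod (b - a).
Proof. rewrite <- Cmod_opp; f_equal; ring. Qed.

Lemma Cmod_triangle3 (a b c : C) : Cmod (a - c) <= Cmod (a - b) + Cmod (b - c).
Proof.
  replace (a - c)%C with ((a - b) + (b - c))%C by ring. apply Cmod_triangle.
Qed.

Lemma Cmod_sub_ge (a b : C) : Cmod a - Cmod b <= Cmod (a - b).
Proof.
  pose proof (Cmod_triangle (a - b) b) as H.
  replace (a - b + b)%C with a in H by ring. lra.
Qed.

Lemma Cmod_sub_0 (a b : C) : Cmod (a - b) <= 0 -> a = b.
Proof.
  intros H. assert (H0 : Cmod (a - b) = 0) by (pose proof (Cmod_ge_0 (a - b)); lra).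
  apply Cmod_eq_0 in H0. replace a with (a - b + b)%C by ring. rewrite H0; ring.
Qed.

Lemma le_small (x c : R) : 0 <= c -> (forall eps, 0 < eps -> x <= eps * c) -> x <= 0.
Proof.
  intros Hc H. destruct (Rle_or_lt x 0) as [Hx|Hx]; auto. exfalso.
  assert (He : 0 < x / (2 * (c + 1))) by (apply Rdiv_lt_0_compat; lra).
  specialize (H _ He).
  assert (x / (2 * (c + 1)) * c <= x / 2).
  { replace (x / 2) with (x / (2 * (c + 1)) * (c + 1)) by (field; lra).
    apply Rmult_le_compat_l; lra. }
  lra.
Qed.

Ltac le_min :=
  first [ apply Rmin_l | apply Rmin_r
        | eapply Rle_trans; [apply Rmin_l | solve [le_min]]
        | eapply Rle_trans; [apply Rmin_r | solve [le_min]] ].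

Lemma lt_min_l (a b c : R) : a < Rmin b c -> a < b.
Proof. intros H. eapply Rlt_le_trans; [apply H|apply Rmin_l]. Qed.

Lemma lt_min_r (a b c : R) : a < Rmin b c -> a < c.
Proof. intros H. eapply Rlt_le_trans; [apply H|apply Rmin_r]. Qed.

Lemma lt_div_succ (x c d : R) : 0 <= x -> 0 <= c -> x < d / (c + 1) -> x * (c + 1) < d.
Proof. intros Hx Hc H. apply Rlt_div_r in H; lra. Qed.

Lemma cder_is_derive (u : C -> C) (z l : C) :
  cder u z l <-> is_derive (K := C_AbsRing) (V := C_NormedModule) u z l.
Proof.
  split.
  - intros H. split.
    { apply is_linear_scal_l. }
    intros x Hx. apply (is_filter_lim_locally_unique (K := C_AbsRing) (V := AbsRing_NormedModule C_AbsRing) z x) in Hx. subst x.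
    intros eps. destruct (H eps (cond_pos eps)) as [d [Hd H1]].
    exists (mkposreal d Hd). intros w Hw.
    change (Cmod (u w - u z - (w - z) * l) <= eps * Cmod (w - z)).
    replace ((w - z) * l)%C with (l * (w - z))%C by ring.
    apply H1. exact Hw.
  - intros [_ H] eps He.
    specialize (H z (fun P HP => HP) (mkposreal eps He)).
    destruct H as [d H]. exists (pos d); split; [apply cond_pos|].
    intros w Hw. replace (l * (w - z))%C with ((w - z) * l)%C by ring.
    exact (H w Hw).
Qed.

(** The definitions of the theorem use [C_NormedModule], whereas the product and chain rules are
    stated over [AbsRing_NormedModule C_AbsRing]; the epsilon-delta form mediates between the two
    structures. *)
Lemma cder_is_derive_ring (u : C -> C) (z l : C) :
  cder u z l <-> is_derive (K := C_AbsRing) (V := AbsRing_NormedModule C_AbsRing) u z l.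
Proof.
  split.
  - intros H. split.
    { apply is_linear_scal_l. }
    intros x Hx. apply (is_filter_lim_locally_unique (K := C_AbsRing) (V := AbsRing_NormedModule C_AbsRing) z x) in Hx. subst x.
    intros eps. destruct (H eps (cond_pos eps)) as [d [Hd H1]].
    exists (mkposreal d Hd). intros w Hw.
    change (Cmod (u w - u z - (w - z) * l) <= eps * Cmod (w - z)).
    replace ((w - z) * l)%C with (l * (w - z))%C by ring.
    apply H1. exact Hw.
  - intros [_ H] eps He.
    specialize (H z (fun P HP => HP) (mkposreal eps He)).
    destruct H as [d H]. exists (pos d); split; [apply cond_pos|].
    intros w Hw. replace (l * (w - z))%C with ((w - z) * l)%C by ring.
    exact (H w Hw).
Qed.

Lemma rder_is_derive (g : R -> C) (t : R) (l : C) :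
  rder g t l <-> is_derive (K := R_AbsRing) (V := C_R_NormedModule) g t l.
Proof.
  assert (E : forall (a b : C) s,
    @norm R_AbsRing C_R_NormedModule
      (minus (minus a b) (@scal R_AbsRing C_R_NormedModule s l))
    = Cmod (a - b - l * RtoC s)).
  { intros a b s. rewrite <- Cmod_norm. f_equal.
    apply injective_projections; simpl; unfold plus, opp, scal; simpl;
      unfold mult; simpl; ring. }
  split.
  - intros H. split.
    { apply is_linear_scal_l. }
    intros x Hx. apply (is_filter_lim_locally_unique (K := R_AbsRing) (V := AbsRing_NormedModule R_AbsRing) t x) in Hx. subst x.
    intros eps. destruct (H eps (cond_pos eps)) as [d [Hd H1]].
    exists (mkposreal d Hd). intros w Hw.
    refine (Rle_trans _ _ _ (Req_le _ _ (E (g w) (g t) (w - t))) _). exact (H1 w Hw).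
  - intros [_ H] eps He.
    specialize (H t (fun P HP => HP) (mkposreal eps He)).
    destruct H as [d H]. exists (pos d); split; [apply cond_pos|].
    intros w Hw. specialize (H w Hw). refine (Rle_trans _ _ _ (Req_le _ _ (eq_sym (E (g w) (g t) (w - t)))) _). exact H.
Qed.

Lemma cder_ext (u v : C -> C) (z l : C) (d : R) : 0 < d ->
  (forall w, Cmod (w - z) < d -> u w = v w) -> cder u z l -> cder v z l.
Proof.
  intros Hd E H eps He. destruct (H eps He) as [d1 [Hd1 H1]].
  exists (Rmin d d1); split; [apply Rmin_pos; auto|].
  intros w Hw. rewrite <- (E w), <- (E z).
  - apply H1. eapply lt_min_r, Hw.
  - replace (z - z)%C with (RtoC 0) by ring. rewrite Cmod_0; auto.
  - eapply lt_min_l, Hw.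
Qed.

Lemma cder_eq (u : C -> C) (z l m : C) : cder u z l -> l = m -> cder u z m.
Proof. intros H <-; exact H. Qed.

Lemma cder_const (c z : C) : cder (fun _ => c) z 0.
Proof.
  intros eps He. exists 1; split; [lra|]. intros w _.
  replace (c - c - 0 * (w - z))%C with (RtoC 0) by ring. rewrite Cmod_0.
  apply Rmult_le_pos; [lra|apply Cmod_ge_0].
Qed.

Lemma cder_id (z : C) : cder (fun w => w) z 1.
Proof.
  intros eps He. exists 1; split; [lra|]. intros w _.
  replace (w - z - 1 * (w - z))%C with (RtoC 0) by ring. rewrite Cmod_0.
  apply Rmult_le_pos; [lra|apply Cmod_ge_0].
Qed.

Lemma cder_plus (u v : C -> C) (z l m : C) :
  cder u z l -> cder v z m -> cder (fun w => u w + v w)%C z (l + m)%C.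
Proof.
  rewrite !cder_is_derive. intros H1 H2. exact (is_derive_plus u v z l m H1 H2).
Qed.

Lemma cder_mult (u v : C -> C) (z l m : C) :
  cder u z l -> cder v z m ->
  cder (fun w => u w * v w)%C z (l * v z + u z * m)%C.
Proof.
  rewrite !cder_is_derive_ring. intros H1 H2.
  exact (is_derive_mult (K := C_AbsRing) u v z l m H1 H2 Cmult_comm).
Qed.

Lemma cder_comp (u v : C -> C) (z l m : C) :
  cder u (v z) l -> cder v z m -> cder (fun w => u (v w)) z (m * l)%C.
Proof.
  rewrite !cder_is_derive_ring. intros H1 H2.
  exact (is_derive_comp (K := C_AbsRing) (V := AbsRing_NormedModule C_AbsRing) u v z l m H1 H2).
Qed.

Lemma cder_opp (u : C -> C) (z l : C) : cder u z l -> cder (fun w => - u w)%C z (- l)%C.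
Proof.
  rewrite !cder_is_derive. intros H1. exact (is_derive_opp u z l H1).
Qed.

Lemma cder_minus (u v : C -> C) (z l m : C) :
  cder u z l -> cder v z m -> cder (fun w => u w - v w)%C z (l - m)%C.
Proof. intros H1 H2. apply cder_plus; auto. apply cder_opp; auto. Qed.

Lemma cder_add_const (c z : C) : cder (fun w => w + c)%C z (1 + 0)%C.
Proof. apply cder_plus; [apply cder_id|apply cder_const]. Qed.

Lemma cder_sub_const (c z : C) : cder (fun w => w - c)%C z (1 - 0)%C.
Proof. apply cder_minus; [apply cder_id|apply cder_const]. Qed.

Lemma cder_scal (c : C) (u : C -> C) (z l : C) :
  cder u z l -> cder (fun w => c * u w)%C z (c * l)%C.
Proof.
  intros H. eapply cder_eq. apply cder_mult; [apply cder_const|apply H]. cbv beta; ring.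
Qed.

Definition ccont (u : C -> C) (z : C) : Prop :=
  forall eps, 0 < eps -> exists d, 0 < d /\
    forall w, Cmod (w - z) < d -> Cmod (u w - u z) < eps.

Lemma cder_ccont (u : C -> C) (z l : C) : cder u z l -> ccont u z.
Proof.
  intros H eps He. destruct (H 1 Rlt_0_1) as [d [Hd H1]].
  pose proof (Cmod_ge_0 l) as Hl.
  exists (Rmin d (eps / (Cmod l + 1))); split.
  { apply Rmin_pos; auto. apply Rdiv_lt_0_compat; lra. }
  intros w Hw. assert (Hw1 : Cmod (w - z) < d) by (eapply lt_min_l, Hw).
  assert (Hw2 : Cmod (w - z) < eps / (Cmod l + 1)) by (eapply lt_min_r, Hw).
  replace (u w - u z)%C with ((u w - u z - l * (w - z)) + l * (w - z))%C by ring.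
  eapply Rle_lt_trans; [apply Cmod_triangle|]. rewrite Cmod_mult.
  specialize (H1 w Hw1).
  apply Rle_lt_trans with ((Cmod l + 1) * Cmod (w - z)); [lra|].
  pose proof (Cmod_ge_0 (w - z)). apply lt_div_succ in Hw2; lra.
Qed.

Lemma ccont_nonzero (u : C -> C) (z : C) : ccont u z -> u z <> 0%C ->
  exists d, 0 < d /\ forall w, Cmod (w - z) < d -> Cmod (u z) / 2 < Cmod (u w).
Proof.
  intros H Hz. apply Cmod_gt_0 in Hz. destruct (H (Cmod (u z) / 2)) as [d [Hd H1]]; [lra|].
  exists d; split; auto. intros w Hw. specialize (H1 w Hw).
  rewrite Cmod_sub_comm in H1. pose proof (Cmod_sub_ge (u z) (u w)). lra.
Qed.

Lemma cder_inv (u : C -> C) (z l : C) :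
  cder u z l -> u z <> 0%C -> cder (fun w => / u w)%C z (- l / (u z * u z))%C.
Proof.
  intros H Hz.
  assert (Hinv : cder (fun w => / w)%C (u z) (- / (u z * u z))%C).
  { set (a := u z) in *. clearbody a. pose proof Hz as Ha. apply Cmod_gt_0 in Ha.
    intros eps He.
    assert (He' : 0 < eps * (Cmod a * Cmod a * Cmod a) / 2).
    { apply Rdiv_lt_0_compat; [|lra]. repeat apply Rmult_lt_0_compat; auto. }
    exists (Rmin (Cmod a / 2) (eps * (Cmod a * Cmod a * Cmod a) / 2)); split.
    { apply Rmin_pos; lra. }
    intros w Hw.
    assert (Hw1 : Cmod (w - a) < Cmod a / 2) by (eapply lt_min_l, Hw).
    assert (Hw2 := lt_min_r _ _ _ Hw).
    assert (Hw3 : Cmod a / 2 < Cmod w).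
    { rewrite Cmod_sub_comm in Hw1. pose proof (Cmod_sub_ge a w). lra. }
    assert (Hw0 : w <> 0%C) by (apply Cmod_gt_0; lra).
    replace (/ w - / a - - / (a * a) * (w - a))%C
      with ((w - a) * (w - a) / (w * (a * a)))%C by (field; auto).
    rewrite Cmod_div, !Cmod_mult.
    2: { repeat apply Cmult_neq_0; auto. }
    set (x := Cmod (w - a)) in *. assert (0 <= x) by apply Cmod_ge_0.
    set (A := Cmod a) in *. set (W := Cmod w) in *.
    assert (0 < W * (A * A)) by (repeat apply Rmult_lt_0_compat; lra).
    apply Rle_div_l; [lra|].
    assert (x <= eps * (W * (A * A))).
    { apply Rle_trans with (eps * (A / 2 * (A * A))); [lra|].
      apply Rmult_le_compat_l; [lra|]. apply Rmult_le_compat_r; [|lra].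
      apply Rmult_le_pos; lra. }
    replace (eps * x * (W * (A * A))) with (eps * (W * (A * A)) * x) by ring.
    apply Rmult_le_compat_r; auto. }
  eapply cder_eq. apply (cder_comp (fun w => / w)%C u z _ l Hinv H). field. auto.
Qed.

Lemma cder_unique (u : C -> C) (z l m : C) : cder u z l -> cder u z m -> l = m.
Proof.
  intros H1 H2. apply Cmod_sub_0.
  apply (le_small _ 2); [lra|].
  intros eps He. destruct (H1 eps He) as [d1 [Hd1 K1]], (H2 eps He) as [d2 [Hd2 K2]].
  set (d := Rmin d1 d2). assert (Hd : 0 < d) by (apply Rmin_pos; auto).
  set (w := (z + RtoC (d / 2))%C).
  assert (Ew : (w - z = RtoC (d / 2))%C) by (unfold w; ring).
  assert (Em : Cmod (w - z) = d / 2).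
  { rewrite Ew, Cmod_R, Rabs_right; lra. }
  assert (d <= d1) by le_min. assert (d <= d2) by le_min.
  specialize (K1 w ltac:(lra)). specialize (K2 w ltac:(lra)).
  assert (Cmod ((l - m) * (w - z)) <= 2 * eps * Cmod (w - z)).
  { replace ((l - m) * (w - z))%C with
     ((u w - u z - m * (w - z)) - (u w - u z - l * (w - z)))%C by ring.
    unfold Cminus at 1. eapply Rle_trans; [apply Cmod_triangle|]. rewrite Cmod_opp. lra. }
  rewrite Cmod_mult in H3. rewrite Em in H3. nra.
Qed.

Lemma cder_rder_comp (u : C -> C) (g : R -> C) (t : R) (l m : C) :
  cder u (g t) l -> rder g t m -> rder (fun s => u (g s)) t (l * m)%C.
Proof.
  intros H1 H2 eps He.
  pose proof (Cmod_ge_0 l) as Hl. pose proof (Cmod_ge_0 m) as Hm.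
  assert (He1 : 0 < eps / (2 * (Cmod m + 1))) by (apply Rdiv_lt_0_compat; lra).
  destruct (H1 _ He1) as [d1 [Hd1 K1]].
  assert (He2 : 0 < Rmin 1 (eps / (2 * (Cmod l + 1)))).
  { apply Rmin_pos; [lra|]. apply Rdiv_lt_0_compat; lra. }
  destruct (H2 _ He2) as [d2 [Hd2 K2]].
  assert (B : forall s, Rabs (s - t) < d2 -> Cmod (g s - g t) <= (Cmod m + 1) * Rabs (s - t)).
  { intros s Hs. specialize (K2 s Hs).
    replace (g s - g t)%C with ((g s - g t - m * (s - t)%R) + m * (s - t)%R)%C by ring.
    eapply Rle_trans; [apply Cmod_triangle|]. rewrite Cmod_mult, Cmod_R.
    pose proof (Rmin_l 1 (eps / (2 * (Cmod l + 1)))).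
    pose proof (Rabs_pos (s - t)). nra. }
  exists (Rmin d2 (d1 / (Cmod m + 1))); split.
  { apply Rmin_pos; auto. apply Rdiv_lt_0_compat; lra. }
  intros s Hs.
  assert (Hs2 : Rabs (s - t) < d2) by (eapply lt_min_l, Hs).
  assert (Hs1 : Rabs (s - t) < d1 / (Cmod m + 1)) by (eapply lt_min_r, Hs).
  specialize (B s Hs2). specialize (K2 s Hs2).
  assert (Hg : Cmod (g s - g t) < d1).
  { eapply Rle_lt_trans; [apply B|]. pose proof (Rabs_pos (s - t)).
    apply lt_div_succ in Hs1; lra. }
  specialize (K1 _ Hg).
  replace (u (g s) - u (g t) - l * m * (s - t)%R)%C with
    ((u (g s) - u (g t) - l * (g s - g t)) + l * (g s - g t - m * (s - t)%R))%C by ring.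
  eapply Rle_trans; [apply Cmod_triangle|]. rewrite Cmod_mult.
  set (x := Rabs (s - t)) in *. assert (Hx : 0 <= x) by apply Rabs_pos.
  assert (E1 : eps / (2 * (Cmod m + 1)) * Cmod (g s - g t) <= eps / 2 * x).
  { replace (eps / 2 * x) with (eps / (2 * (Cmod m + 1)) * ((Cmod m + 1) * x)) by (field; lra).
    apply Rmult_le_compat_l; lra. }
  assert (E2 : Cmod l * Cmod (g s - g t - m * (s - t)%R) <= eps / 2 * x).
  { apply Rle_trans with (Cmod l * (eps / (2 * (Cmod l + 1)) * x)).
    - apply Rmult_le_compat_l; auto. eapply Rle_trans; [apply K2|].
      apply Rmult_le_compat_r; auto. apply Rmin_r.
    - replace (eps / 2 * x) with ((Cmod l + 1) * (eps / (2 * (Cmod l + 1)) * x)) by (field; lra).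
      apply Rmult_le_compat_r; [|lra]. apply Rmult_le_pos; auto.
      left; apply Rdiv_lt_0_compat; lra. }
  lra.
Qed.

(** The factor [w] makes this cover every real linear functional: [w = 1] and [w = - Ci] select the
    real and the imaginary part, a unimodular [w] projects on a direction. *)
Lemma rder_re (g : R -> C) (t : R) (l w : C) :
  rder g t l -> is_derive (fun s => Re (w * g s)) t (Re (w * l)).
Proof.
  intros H. apply is_derive_Reals. intros eps He.
  pose proof (Cmod_ge_0 w) as Hw.
  assert (He' : 0 < eps / (2 * (Cmod w + 1))) by (apply Rdiv_lt_0_compat; lra).
  destruct (H _ He') as [d [Hd K]].
  exists (mkposreal d Hd). intros h Hh0 Hh. simpl in Hh.
  specialize (K (t + h)). replace (t + h - t) with h in K by ring. specialize (K Hh).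
  replace ((Re (w * g (t + h)%R) - Re (w * g t)) / h - Re (w * l))
    with (Re (w * (g (t + h)%R - g t - l * h)) / h).
  2: { unfold Re, Im; simpl; field; auto. }
  unfold Rdiv at 1. rewrite Rabs_mult, Rabs_inv.
  assert (Hx : 0 < Rabs h) by (apply Rabs_pos_lt; auto).
  apply Rmult_lt_reg_r with (Rabs h); auto. rewrite Rmult_assoc, Rinv_l, Rmult_1_r by lra.
  eapply Rle_lt_trans; [apply re_le_Cmod|]. rewrite Cmod_mult.
  apply Rle_lt_trans with (Cmod w * (eps / (2 * (Cmod w + 1)) * Rabs h)).
  - apply Rmult_le_compat_l; auto.
  - replace (eps * Rabs h) with (2 * (Cmod w + 1) * (eps / (2 * (Cmod w + 1)) * Rabs h)) by (field; lra).
    apply Rmult_lt_compat_r; [|lra]. apply Rmult_lt_0_compat; auto.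
Qed.

Lemma rder_segment (a b : C) (t : R) : rder (fun s => a + s * (b - a))%C t (b - a)%C.
Proof.
  intros eps He. exists 1; split; [lra|]. intros s _.
  replace (a + s * (b - a) - (a + t * (b - a)) - (b - a) * (s - t)%R)%C with (RtoC 0).
  - rewrite Cmod_0. apply Rmult_le_pos; [lra|apply Rabs_pos].
  - rewrite RtoC_minus. ring.
Qed.

Lemma is_derive_continuity_pt (h : R -> R) (t l : R) : is_derive h t l -> continuity_pt h t.
Proof.
  intros H. apply continuity_pt_filterlim. apply (ex_derive_continuous h). exists l; exact H.
Qed.

Lemma is_derive_nonneg_le (h dh : R -> R) (a b : R) : a <= b ->
  (forall t, a <= t <= b -> is_derive h t (dh t)) ->
  (forall t, a <= t <= b -> 0 <= dh t) -> h a <= h b.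
Proof.
  intros Hab Hd Hp. destruct (MVT_gen h a b dh) as [c [Hc E]].
  - rewrite Rmin_left, Rmax_right by auto. intros x Hx. apply Hd; lra.
  - rewrite Rmin_left, Rmax_right by auto. intros x Hx.
    eapply is_derive_continuity_pt, Hd; lra.
  - rewrite Rmin_left, Rmax_right in Hc by auto.
    specialize (Hp c Hc). nra.
Qed.

(* Projecting on the direction of [g b - g a] reduces to a real function. *)
Lemma rder_bound (g dg : R -> C) (h dh : R -> R) (a b : R) : a <= b ->
  (forall t, a <= t <= b -> rder g t (dg t)) ->
  (forall t, a <= t <= b -> is_derive h t (dh t)) ->
  (forall t, a <= t <= b -> Cmod (dg t) <= dh t) ->
  Cmod (g b - g a) <= h b - h a.
Proof.
  intros Hab Hg Hh Hle.
  assert (Hpos : 0 <= h b - h a).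
  { assert (h a <= h b); [|lra]. apply (is_derive_nonneg_le h dh); auto.
    intros t Ht. eapply Rle_trans; [apply Cmod_ge_0|apply Hle; auto]. }
  set (w := (g b - g a)%C). destruct (Req_dec (Cmod w) 0) as [E|Hw]; [rewrite E; auto|].
  assert (Hw0 : 0 < Cmod w) by (pose proof (Cmod_ge_0 w); lra).
  set (o := (Cconj w / RtoC (Cmod w))%C).
  assert (HC : RtoC (Cmod w) <> 0%C) by (intros F; apply RtoC_inj in F; lra).
  assert (Ho : Cmod o = 1).
  { unfold o. rewrite Cmod_div, Cmod_conj, Cmod_R, Rabs_right by (auto; lra). field; auto. }
  assert (Hre : Re (o * w) = Cmod w).
  { assert (E : (o * w = RtoC (Cmod w))%C).
    { unfold o. replace (Cconj w / RtoC (Cmod w) * w)%C with (w * Cconj w / RtoC (Cmod w))%C by (field; auto).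
      rewrite <- Cmod2_conj. simpl. rewrite Rmult_1_r, RtoC_mult. field; auto. }
    rewrite E. reflexivity. }
  assert (K : h a - Re (o * g a) <= h b - Re (o * g b)).
  { apply (is_derive_nonneg_le (fun t => h t - Re (o * g t)) (fun t => dh t - Re (o * dg t))); auto.
    - intros t Ht. apply (is_derive_minus (V := R_NormedModule) h (fun t => Re (o * g t))); auto.
      apply rder_re; auto.
    - intros t Ht. pose proof (re_le_Cmod (o * dg t)) as HR. rewrite Cmod_mult, Ho in HR.
      pose proof (Rle_abs (Re (o * dg t))). specialize (Hle t Ht). lra. }
  rewrite <- Hre. unfold w. replace (Re (o * (g b - g a))) with (Re (o * g b) - Re (o * g a)).
  - lra.
  - unfold Re; simpl; ring.
Qed.

(** Mean value inequality for [u z - l * z]. With [l = 0] it bounds increments; with [l] close to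
    the derivative it measures the deviation from an affine map. *)
Lemma cder_segment_bound (u du : C -> C) (a b l : C) (B : R) :
  (forall t, 0 <= t <= 1 -> cder u (a + t * (b - a))%C (du (a + t * (b - a))%C)) ->
  (forall t, 0 <= t <= 1 -> Cmod (du (a + t * (b - a))%C - l) <= B) ->
  Cmod (u b - u a - l * (b - a)) <= B * Cmod (b - a).
Proof.
  intros Hu HB.
  pose (v := fun z => (u z - l * z)%C).
  assert (Hv : forall t, 0 <= t <= 1 -> rder (fun s => v (a + s * (b - a))%C) t
    ((du (a + t * (b - a))%C - l) * (b - a))%C).
  { intros t Ht. apply (cder_rder_comp v (fun s => a + s * (b - a))%C); [|apply rder_segment].
    apply cder_minus; [auto|]. eapply cder_eq; [apply cder_scal, cder_id|ring]. }
  pose proof (rder_bound _ _ (fun s => s * (B * Cmod (b - a))) (fun s => B * Cmod (b - a)) 0 1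
    Rle_0_1 Hv) as K.
  cbv beta in K.
  replace (a + 0%R * (b - a))%C with a in K by ring.
  replace (a + 1%R * (b - a))%C with b in K by ring.
  replace (v b - v a)%C with (u b - u a - l * (b - a))%C in K by (unfold v; ring).
  rewrite Rmult_1_l, Rmult_0_l, Rminus_0_r in K. apply K.
  - intros t _. auto_derive; auto. ring.
  - intros t Ht. rewrite Cmod_mult. apply Rmult_le_compat_r; [apply Cmod_ge_0|auto].
Qed.

(** The intervals of centre [y n] and radius [2 * c * (1/2)^n] are nested, and the supremum of their
    left ends lies in all of them. *)
Lemma real_geometric_limit (y : nat -> R) (c : R) :
  (forall n, Rabs (y (S n) - y n) <= c * (1 / 2) ^ n) ->
  exists l, forall n, Rabs (y n - l) <= 2 * c * (1 / 2) ^ n.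
Proof.
  intros H.
  assert (Hstep : forall n k, y (n + k)%nat - 2 * c * (1/2) ^ (n + k) <= y n + 2 * c * (1/2)^n /\
    y (n + k)%nat + 2 * c * (1/2) ^ (n + k) <= y n + 2 * c * (1/2)^n /\
    y n - 2 * c * (1/2)^n <= y (n + k)%nat - 2 * c * (1/2) ^ (n + k)).
  { intros n. induction k as [|k IH].
    - rewrite Nat.add_0_r. pose proof (H n) as Hn. pose proof (Rabs_pos (y (S n) - y n)). lra.
    - rewrite <- plus_n_Sm. simpl pow. specialize (H (n + k)%nat).
      apply Rabs_le_between in H. pose proof (Rabs_pos (y (S (n+k)) - y (n+k)%nat)). lra. }
  assert (Hcross : forall n m, y n - 2 * c * (1/2)^n <= y m + 2 * c * (1/2)^m).
  { assert (Hp : forall n, 0 <= 2 * c * (1/2)^n).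
    { intros n. specialize (H n). pose proof (Rabs_pos (y (S n) - y n)). lra. }
    intros n m. destruct (Nat.le_ge_cases n m) as [Hnm|Hnm].
    - destruct (Hstep n (m - n)%nat) as [_ [_ K]].
      replace (n + (m - n))%nat with m in K by lia. specialize (Hp m). lra.
    - destruct (Hstep m (n - m)%nat) as [K _].
      replace (m + (n - m))%nat with n in K by lia. lra. }
  destruct (completeness (fun x => exists n, x = y n - 2 * c * (1/2)^n)) as [l [Hub Hlub]].
  - exists (y 0%nat + 2 * c * (1/2)^0). intros x [n ->]. apply Hcross.
  - exists (y 0%nat - 2 * c * (1/2)^0). exists 0%nat; auto.
  - exists l. intros n. apply Rabs_le. split.
    + assert (l <= y n + 2 * c * (1/2)^n); [|lra]. apply Hlub. intros x [m ->]. apply Hcross.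
    + assert (y n - 2 * c * (1/2)^n <= l); [|lra]. apply Hub. exists n; auto.
Qed.

Lemma geometric_limit (x : nat -> C) (c : R) :
  (forall n, Cmod (x (S n) - x n) <= c * (1 / 2) ^ n) ->
  exists l, forall n, Cmod (x n - l) <= 4 * c * (1 / 2) ^ n.
Proof.
  intros H.
  destruct (real_geometric_limit (fun n => Re (x n)) c) as [l1 H1].
  { intros n. replace (Re (x (S n)) - Re (x n)) with (Re (x (S n) - x n)) by reflexivity.
    eapply Rle_trans; [apply re_le_Cmod|auto]. }
  destruct (real_geometric_limit (fun n => Im (x n)) c) as [l2 H2].
  { intros n. replace (Im (x (S n)) - Im (x n)) with (Im (x (S n) - x n)) by reflexivity.
    eapply Rle_trans; [apply im_le_Cmod|auto]. }
  exists (l1, l2). intros n. eapply Rle_trans; [apply Cmod_le_re_im|].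
  specialize (H1 n). specialize (H2 n).
  change (Rabs (Re (x n) - l1) + Rabs (Im (x n) - l2) <= 4 * c * (1/2)^n). lra.
Qed.

Lemma half_pow_small (c eps : R) : 0 < eps -> exists n, c * (1 / 2) ^ n < eps.
Proof.
  intros He. destruct (Rle_or_lt c 0) as [Hc|Hc].
  - exists 0%nat. simpl; lra.
  - destruct (pow_lt_1_zero (1/2)) with (y := eps / c) as [n Hn].
    + rewrite Rabs_right; lra.
    + apply Rdiv_lt_0_compat; auto.
    + exists n. specialize (Hn n (le_n n)).
      rewrite Rabs_right in Hn by (apply Rle_ge, pow_le; lra).
      apply Rmult_lt_compat_l with (r := c) in Hn; auto.
      replace (c * (eps / c)) with eps in Hn by (field; lra). exact Hn.
Qed.

(* A locally constant property of the points of [0, 1] is constant. *)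
Lemma unit_interval_constant (P : R -> Prop) :
  (forall t, 0 <= t <= 1 -> exists d, 0 < d /\
     forall s s', 0 <= s <= 1 -> 0 <= s' <= 1 ->
       Rabs (s - t) < d -> Rabs (s' - t) < d -> P s -> P s') ->
  P 0 -> forall t, 0 <= t <= 1 -> P t.
Proof.
  intros H P0.
  set (E := fun x => 0 <= x <= 1 /\ forall s, 0 <= s <= x -> P s).
  destruct (completeness E) as [m [Hub Hlub]].
  { exists 1. intros x [Hx _]; lra. }
  { exists 0. split; [lra|]. intros s Hs. replace s with 0 by lra. auto. }
  assert (H0 : 0 <= m).
  { apply Hub. split; [lra|]. intros s Hs. replace s with 0 by lra. auto. }
  assert (H1 : m <= 1) by (apply Hlub; intros x [Hx _]; lra).
  destruct (H m (conj H0 H1)) as [d [Hd K]].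
  destruct (classic (exists x, E x /\ m - d < x)) as [[x [[Hx1 Hx2] Hx3]]|N].
  - assert (x <= m) by (apply Hub; split; auto).
    assert (Hall : forall s, 0 <= s <= 1 -> s < m + d -> P s).
    { intros s Hs Hsm. destruct (Rle_or_lt s x); [apply Hx2; lra|].
      apply (K x s); auto; try lra.
      - rewrite Rabs_left1; lra.
      - apply Rabs_def1; lra.
      - apply Hx2; lra. }
    destruct (Rle_or_lt 1 m) as [Hm|Hm].
    { intros t Ht. apply Hall; lra. }
    exfalso. set (y := Rmin 1 (m + d / 2)).
    assert (y <= 1) by le_min. assert (y <= m + d/2) by le_min.
    assert (m < y) by (apply Rmin_glb_lt; lra).
    assert (E y). { split; [lra|]. intros s Hs. apply Hall; lra. }
    specialize (Hub y H6). lra.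
  - exfalso. assert (m <= m - d); [|lra]. apply Hlub. intros x Hx.
    destruct (Rle_or_lt x (m - d)); auto. exfalso. apply N. exists x; auto.
Qed.

(** * Goursat's lemma and primitives *)

Definition seg (a b : C) (t : R) : C := (a + t * (b - a))%C.

(** Real part of the line integral of [u] from [a] to [b]. The imaginary part is the [jint] of
    [- Ci * u], so real integrals suffice. *)
Definition jint (u : C -> C) (a b : C) : R :=
  RInt (fun t => Re (u (seg a b t) * (b - a))) 0 1.

Definition cont_seg (u : C -> C) (a b : C) : Prop :=
  forall t, 0 <= t <= 1 -> ccont u (seg a b t).

Lemma seg_0 (a b : C) : seg a b 0 = a.
Proof. unfold seg; ring. Qed.

Lemma seg_1 (a b : C) : seg a b 1 = b.
Proof. unfold seg; ring. Qed.

Lemma seg_sub (a b : C) (s t : R) : (seg a b s - seg a b t)%C = ((s - t)%R * (b - a))%C.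
Proof. unfold seg; rewrite RtoC_minus; ring. Qed.

Lemma cont_seg_integrand (u : C -> C) (a b : C) (t : R) :
  ccont u (seg a b t) -> continuous (fun t => Re (u (seg a b t) * (b - a))) t.
Proof.
  intros H. apply continuity_pt_filterlim. intros eps He.
  pose proof (Cmod_ge_0 (b - a)) as Hb.
  destruct (H (eps / (Cmod (b - a) + 1))) as [d [Hd K]]; [apply Rdiv_lt_0_compat; lra|].
  exists (d / (Cmod (b - a) + 1)); split; [apply Rdiv_lt_0_compat; lra|].
  intros s [_ Hs]. change (Rabs (s - t) < d / (Cmod (b - a) + 1)) in Hs.
  change (Rabs (Re (u (seg a b s) * (b - a)) - Re (u (seg a b t) * (b - a))) < eps).
  assert (Hd1 : Cmod (seg a b s - seg a b t) < d).
  { rewrite seg_sub, Cmod_mult, Cmod_R. pose proof (Rabs_pos (s - t)).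
    apply lt_div_succ in Hs; lra. }
  specialize (K _ Hd1).
  replace (Re (u (seg a b s) * (b - a)) - Re (u (seg a b t) * (b - a)))
    with (Re ((u (seg a b s) - u (seg a b t)) * (b - a))) by (unfold Re; simpl; ring).
  eapply Rle_lt_trans; [apply re_le_Cmod|]. rewrite Cmod_mult.
  pose proof (Cmod_ge_0 (u (seg a b s) - u (seg a b t))). apply lt_div_succ in K; lra.
Qed.

Lemma cont_seg_ex_RInt (u : C -> C) (a b : C) (x y : R) : cont_seg u a b ->
  0 <= x <= 1 -> 0 <= y <= 1 ->
  ex_RInt (fun t => Re (u (seg a b t) * (b - a))) x y.
Proof.
  intros H Hx Hy. apply (ex_RInt_continuous (V := R_CompleteNormedModule)). intros z Hz.
  apply cont_seg_integrand, H.
  unfold Rmin, Rmax in Hz; destruct (Rle_dec x y); lra.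
Qed.

Lemma jint_ext (u v : C -> C) (a b : C) :
  (forall t, 0 <= t <= 1 -> u (seg a b t) = v (seg a b t)) -> jint u a b = jint v a b.
Proof.
  intros H. apply RInt_ext. rewrite Rmin_left, Rmax_right by lra.
  intros x Hx. rewrite H by lra. reflexivity.
Qed.

Lemma jint_split (u : C -> C) (a b : C) : cont_seg u a b ->
  jint u a b = jint u a ((a + b) / 2)%C + jint u ((a + b) / 2)%C b.
Proof.
  intros H. set (m := ((a + b) / 2)%C). unfold jint at 1.
  set (F := fun t => Re (u (seg a b t) * (b - a))).
  rewrite <- (RInt_Chasles (V := R_CompleteNormedModule) F 0 (1/2) 1)
    by (apply cont_seg_ex_RInt; auto; lra).
  assert (E2 : RtoC 2 <> RtoC 0) by (intros E; apply RtoC_inj in E; lra).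
  assert (Hhalf : RtoC (1 / 2) = (1 / 2)%C) by (rewrite RtoC_div; auto; lra).
  change (RInt F 0 (1/2) + RInt F (1/2) 1 = jint u a m + jint u m b). f_equal.
  - pose proof (RInt_comp_lin (V := R_CompleteNormedModule) F (1/2) 0 0 1) as K.
    replace (1/2 * 0 + 0) with 0 in K by ring. replace (1/2 * 1 + 0) with (1/2) in K by ring.
    rewrite <- K by (apply cont_seg_ex_RInt; auto; lra).
    apply RInt_ext. intros t _. unfold F, scal; simpl; unfold mult; simpl.
    replace (seg a b (1/2 * t + 0)) with (seg a m t).
    2: { unfold seg, m. rewrite Rplus_0_r, RtoC_mult, Hhalf. field; auto. }
    replace (m - a)%C with (RtoC (1/2) * (b - a))%C by (unfold m; rewrite Hhalf; field; auto).
    unfold Re; simpl. field.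
  - pose proof (RInt_comp_lin (V := R_CompleteNormedModule) F (1/2) (1/2) 0 1) as K.
    replace (1/2 * 0 + 1/2) with (1/2) in K by ring. replace (1/2 * 1 + 1/2) with 1 in K by field.
    rewrite <- K by (apply cont_seg_ex_RInt; auto; lra).
    apply RInt_ext. intros t _. unfold F, scal; simpl; unfold mult; simpl.
    replace (seg a b (1/2 * t + 1/2)) with (seg m b t).
    2: { unfold seg, m. rewrite RtoC_plus, RtoC_mult, Hhalf. field; auto. }
    replace (b - m)%C with (RtoC (1/2) * (b - a))%C by (unfold m; rewrite Hhalf; field; auto).
    unfold Re; simpl. field.
Qed.

Lemma jint_swap (u : C -> C) (a b : C) : cont_seg u a b -> jint u b a = - jint u a b.
Proof.
  intros H. unfold jint at 2. set (F := fun t => Re (u (seg a b t) * (b - a))).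
  pose proof (RInt_comp_lin (V := R_CompleteNormedModule) F (-1) 1 0 1) as K.
  replace (-1 * 0 + 1) with 1 in K by ring. replace (-1 * 1 + 1) with 0 in K by ring.
  rewrite <- (opp_RInt_swap (V := R_CompleteNormedModule) F 1 0)
    by (apply cont_seg_ex_RInt; auto; lra).
  rewrite <- K by (apply cont_seg_ex_RInt; auto; lra).
  change (jint u b a = - - RInt (fun y => scal (-1) (F (-1 * y + 1))) 0 1).
  rewrite Ropp_involutive. apply RInt_ext. intros t _. unfold F, scal; simpl; unfold mult; simpl.
  replace (seg a b (-1 * t + 1)) with (seg b a t).
  - unfold Re; simpl; ring.
  - unfold seg. replace (-1 * t + 1) with (1 - t) by ring. rewrite RtoC_minus. ring.
Qed.

Lemma jint_plus (u v : C -> C) (a b : C) : cont_seg u a b -> cont_seg v a b ->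
  jint (fun z => u z + v z)%C a b = jint u a b + jint v a b.
Proof.
  intros Hu Hv. unfold jint.
  rewrite <- (RInt_plus (V := R_CompleteNormedModule)) by (apply cont_seg_ex_RInt; auto; lra).
  apply RInt_ext. intros t _. unfold plus, Re; simpl. ring.
Qed.

Lemma jint_bound (u : C -> C) (a b : C) (B : R) : cont_seg u a b ->
  (forall t, 0 <= t <= 1 -> Cmod (u (seg a b t)) <= B) ->
  Rabs (jint u a b) <= B * Cmod (b - a).
Proof.
  intros H HB. unfold jint.
  replace (B * Cmod (b - a)) with ((1 - 0) * (B * Cmod (b - a))) by ring.
  apply (abs_RInt_le_const); [lra|apply cont_seg_ex_RInt; auto; lra|].
  intros t Ht. eapply Rle_trans; [apply re_le_Cmod|]. rewrite Cmod_mult.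
  apply Rmult_le_compat_r; [apply Cmod_ge_0|auto].
Qed.

Lemma jint_primitive (u v : C -> C) (a b : C) : cont_seg u a b ->
  (forall t, 0 <= t <= 1 -> cder v (seg a b t) (u (seg a b t))) ->
  jint u a b = Re (v b) - Re (v a).
Proof.
  intros Hc Hd. unfold jint. apply is_RInt_unique.
  replace (Re (v b) - Re (v a)) with
    (minus ((fun t => Re (1 * v (seg a b t))) 1) ((fun t => Re (1 * v (seg a b t))) 0)).
  2: { rewrite seg_1, seg_0, !Cmult_1_l. reflexivity. }
  apply (is_RInt_derive (V := R_CompleteNormedModule) (fun t => Re (1 * v (seg a b t)))).
  - rewrite Rmin_left, Rmax_right by lra. intros t Ht.
    replace (u (seg a b t) * (b - a))%C with (1 * (u (seg a b t) * (b - a)))%C by ring.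
    apply rder_re. apply (cder_rder_comp v (seg a b)); auto. apply rder_segment.
  - rewrite Rmin_left, Rmax_right by lra. intros t Ht. apply cont_seg_integrand; auto.
Qed.

Definition convex (K : C -> Prop) : Prop :=
  forall a b t, K a -> K b -> 0 <= t <= 1 -> K (seg a b t).

Definition closed_set (K : C -> Prop) : Prop :=
  forall z, (forall eps, 0 < eps -> exists w, K w /\ Cmod (w - z) < eps) -> K z.

Record tri := Tri { ta : C; tb : C; tc : C }.

Definition perim (T : tri) : R :=
  Cmod (ta T - tb T) + Cmod (tb T - tc T) + Cmod (tc T - ta T).
Definition tint (u : C -> C) (T : tri) : R :=
  jint u (ta T) (tb T) + jint u (tb T) (tc T) + jint u (tc T) (ta T).
Definition in_tri (K : C -> Prop) (T : tri) : Prop := K (ta T) /\ K (tb T) /\ K (tc T).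
Definition mid (a b : C) : C := ((a + b) / 2)%C.

Lemma two_neq_0 : RtoC 2 <> RtoC 0.
Proof. intros E; apply RtoC_inj in E; lra. Qed.

Lemma mid_seg (a b : C) : mid a b = seg a b (1/2).
Proof.
  unfold mid, seg. rewrite RtoC_div by lra. field; apply two_neq_0.
Qed.

Lemma Cmod_half (z : C) : Cmod (z / 2) = Cmod z / 2.
Proof. rewrite Cmod_div by apply two_neq_0. rewrite Cmod_R, Rabs_right by lra. auto. Qed.

Ltac half_side := rewrite <- Cmod_half; f_equal; unfold mid; field; apply two_neq_0.

(** The midpoints of the sides cut the triangle into four, whose integrals add up to the given one
    because the inner sides are traversed twice in opposite directions. The displacement of the
    first vertex is recorded so that iteration gives a geometrically convergent sequence. *)
Lemma tri_bisect (u : C -> C) (K : C -> Prop) (T : tri) :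
  convex K -> (forall z, K z -> ccont u z) -> in_tri K T ->
  exists T', in_tri K T' /\ perim T' = perim T / 2 /\
    Rabs (tint u T) / 4 <= Rabs (tint u T') /\
    Cmod (ta T' - ta T) <= perim T.
Proof.
  intros HK Hc [Ha [Hb Hcc]]. destruct T as [a b c]. unfold perim, tint. simpl in *.
  assert (HS : forall x y, K x -> K y -> cont_seg u x y).
  { intros x y Hx Hy t Ht. apply Hc, HK; auto. }
  assert (HM : forall x y, K x -> K y -> K (mid x y)).
  { intros x y Hx Hy. rewrite mid_seg. apply HK; auto; lra. }
  assert (S1 := jint_split u a b (HS a b Ha Hb)).
  assert (S2 := jint_split u b c (HS b c Hb Hcc)).
  assert (S3 := jint_split u c a (HS c a Hcc Ha)).
  fold (mid a b) in S1. fold (mid b c) in S2. fold (mid c a) in S3.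
  pose proof (HM a b Ha Hb) as Mab. pose proof (HM b c Hb Hcc) as Mbc. pose proof (HM c a Hcc Ha) as Mca.
  assert (W1 := jint_swap u _ _ (HS _ _ Mab Mbc)).
  assert (W2 := jint_swap u _ _ (HS _ _ Mbc Mca)).
  assert (W3 := jint_swap u _ _ (HS _ _ Mca Mab)).
  assert (P1 : Cmod (mid a b - a) = Cmod (a - b) / 2) by (rewrite <- Cmod_opp; half_side).
  assert (P1' : Cmod (a - mid a b) = Cmod (a - b) / 2) by (rewrite Cmod_sub_comm; auto).
  assert (P2' : Cmod (mid a b - b) = Cmod (a - b) / 2) by half_side.
  assert (P3' : Cmod (b - mid b c) = Cmod (b - c) / 2) by half_side.
  assert (P4 : Cmod (mid b c - c) = Cmod (b - c) / 2) by half_side.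
  assert (P5 : Cmod (c - mid c a) = Cmod (c - a) / 2) by half_side.
  assert (P6 : Cmod (mid c a - a) = Cmod (c - a) / 2) by half_side.
  assert (P7 : Cmod (mid a b - mid b c) = Cmod (c - a) / 2) by (rewrite <- Cmod_opp; half_side).
  assert (P8 : Cmod (mid b c - mid c a) = Cmod (a - b) / 2) by (rewrite <- Cmod_opp; half_side).
  assert (P9 : Cmod (mid c a - mid a b) = Cmod (b - c) / 2) by (rewrite <- Cmod_opp; half_side).
  pose proof (Cmod_ge_0 (a - b)). pose proof (Cmod_ge_0 (b - c)). pose proof (Cmod_ge_0 (c - a)).
  set (T1 := Tri a (mid a b) (mid c a)). set (T2 := Tri (mid a b) b (mid b c)).
  set (T3 := Tri (mid c a) (mid b c) c). set (T4 := Tri (mid a b) (mid b c) (mid c a)).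
  assert (Hsum : jint u a b + jint u b c + jint u c a = tint u T1 + tint u T2 + tint u T3 + tint u T4).
  { unfold tint; simpl. lra. }
  assert (Habs : Rabs (jint u a b + jint u b c + jint u c a) <=
    Rabs (tint u T1) + Rabs (tint u T2) + Rabs (tint u T3) + Rabs (tint u T4)).
  { rewrite Hsum. eapply Rle_trans; [apply Rabs_triang|]. apply Rplus_le_compat_r.
    eapply Rle_trans; [apply Rabs_triang|]. apply Rplus_le_compat_r. apply Rabs_triang. }
  set (J := Rabs (jint u a b + jint u b c + jint u c a)) in *.
  assert (Hex : J / 4 <= Rabs (tint u T1) \/ J / 4 <= Rabs (tint u T2) \/
    J / 4 <= Rabs (tint u T3) \/ J / 4 <= Rabs (tint u T4)).
  { destruct (Rle_or_lt (J / 4) (Rabs (tint u T1))); auto.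
    destruct (Rle_or_lt (J / 4) (Rabs (tint u T2))); auto.
    destruct (Rle_or_lt (J / 4) (Rabs (tint u T3))); auto.
    right; right; right; lra. }
  assert (Paa : Cmod (a - a) = 0) by (replace (a - a)%C with (RtoC 0) by ring; apply Cmod_0).
  assert (Pn : Cmod (mid a b - mid c a) = Cmod (b - c) / 2) by (rewrite Cmod_sub_comm; auto).
  assert (Pm : Cmod (mid b c - mid a b) = Cmod (c - a) / 2) by (rewrite Cmod_sub_comm; auto).
  assert (Pk : Cmod (mid c a - mid b c) = Cmod (a - b) / 2) by (rewrite Cmod_sub_comm; auto).
  assert (Pl : Cmod (mid b c - b) = Cmod (b - c) / 2) by (rewrite Cmod_sub_comm; auto).
  assert (Pq : Cmod (c - mid b c) = Cmod (b - c) / 2) by (rewrite Cmod_sub_comm; auto).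
  assert (Pr : Cmod (b - mid a b) = Cmod (a - b) / 2) by (rewrite Cmod_sub_comm; auto).
  destruct Hex as [Hx|[Hx|[Hx|Hx]]];
    [exists T1|exists T2|exists T3|exists T4];
    (split; [unfold in_tri; simpl; auto|]); simpl;
    (split; [lra|]); (split; [exact Hx|]); lra.
Qed.

(** The nested triangles shrink to a point [p] of the closed set [K]. The tangent map [lin] at [p]
    has a primitive and integrates to 0 over each triangle; the remainder [v] contributes at most
    [eps] times a multiple of the squared perimeter, and the squared perimeter shrinks by exactly
    the factor 4 that a bisection may cost. *)
Lemma goursat_triangle (u : C -> C) (K : C -> Prop) (T : tri) :
  convex K -> closed_set K -> (forall z, K z -> exists l, cder u z l) ->
  in_tri K T -> tint u T = 0.
Proof.
  intros HK Hcl Hd HT.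
  assert (Hc : forall z, K z -> ccont u z).
  { intros z Hz. destruct (Hd z Hz) as [l Hl]. eapply cder_ccont; eauto. }
  set (Q := fun T T' => in_tri K T' /\ perim T' = perim T / 2 /\
    Rabs (tint u T) / 4 <= Rabs (tint u T') /\ Cmod (ta T' - ta T) <= perim T).
  set (next := fun T => epsilon (inhabits T) (Q T)).
  assert (Hn : forall T, in_tri K T -> Q T (next T)).
  { intros T0 HT0. apply epsilon_spec. apply tri_bisect; auto. }
  set (s := fix s n := match n with O => T | S n => next (s n) end).
  assert (Hin : forall n, in_tri K (s n)).
  { induction n; simpl; auto. apply Hn; auto. }
  assert (Hp : forall n, perim (s n) = perim T * (1/2)^n).
  { induction n; simpl; [ring|]. destruct (Hn (s n) (Hin n)) as [_ [E _]]. rewrite E, IHn. field. }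
  assert (Ht : forall n, Rabs (tint u T) * (1/4)^n <= Rabs (tint u (s n))).
  { induction n; simpl; [lra|]. destruct (Hn (s n) (Hin n)) as [_ [_ [E _]]]. lra. }
  destruct (geometric_limit (fun n => ta (s n)) (perim T)) as [p Hlim].
  { intros n. rewrite <- Hp. destruct (Hn (s n) (Hin n)) as [_ [_ [_ E]]]. exact E. }
  assert (Hpp : 0 <= perim T).
  { unfold perim. pose proof (Cmod_ge_0 (ta T - tb T)). pose proof (Cmod_ge_0 (tb T - tc T)).
    pose proof (Cmod_ge_0 (tc T - ta T)). lra. }
  assert (Kp : K p).
  { apply Hcl. intros eps He. destruct (half_pow_small (4 * perim T) eps He) as [n Hn1].
    exists (ta (s n)). split; [apply Hin|]. specialize (Hlim n). cbv beta in Hlim. lra. }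
  destruct (Hd p Kp) as [l Hl].
  destruct (Req_dec (tint u T) 0) as [E|N]; auto. exfalso.
  apply Rabs_pos_lt in N.
  assert (Rabs (tint u T) <= 0); [|lra].
  apply (le_small _ (5 * perim T * perim T)).
  { apply Rmult_le_pos; lra. }
  intros eps He. destruct (Hl eps He) as [d [Hdp Hdl]].
  destruct (half_pow_small (5 * perim T) d Hdp) as [n Hn2].
  specialize (Hlim n). cbv beta in Hlim.
  destruct (Hin n) as [Ia [Ib Ic]]. specialize (Ht n). specialize (Hp n).
  destruct (s n) as [a b c] eqn:Es. unfold perim, tint in *. simpl in *.
  set (P0 := Cmod (ta T - tb T) + Cmod (tb T - tc T) + Cmod (tc T - ta T)) in *.
  set (r := (1/2)^n) in *. assert (Hr : 0 < r) by (apply pow_lt; lra).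
  set (lin := fun z => (u p + l * (z - p))%C).
  set (v := fun z => (u z - lin z)%C).
  assert (Hlinc : forall z, cder lin z l).
  { intros z. unfold lin. eapply cder_eq.
    - apply cder_plus; [apply cder_const|]. apply cder_scal, cder_sub_const.
    - cbv beta; ring. }
  assert (Hlc : forall x y, cont_seg lin x y).
  { intros x y t _. eapply cder_ccont, Hlinc. }
  assert (Hvc : forall x y, K x -> K y -> cont_seg v x y).
  { intros x y Hx Hy t Ht'. destruct (Hd (seg x y t)) as [m Hm]; [apply HK; auto|].
    eapply cder_ccont. unfold v. apply cder_minus; [apply Hm|apply Hlinc]. }
  assert (Hsplit : forall x y, K x -> K y -> jint u x y = jint lin x y + jint v x y).
  { intros x y Hx Hy. rewrite <- jint_plus; auto. apply jint_ext. intros t _. unfold v. ring. }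
  set (prim := fun z => (u p * z + l / 2 * ((z - p) * (z - p)))%C).
  assert (Hprim : forall x y, jint lin x y = Re (prim y) - Re (prim x)).
  { intros x y. apply jint_primitive; auto. intros t _. unfold prim, lin. eapply cder_eq.
    - apply cder_plus; [apply cder_scal, cder_id|]. apply cder_scal.
      apply cder_mult; apply cder_minus; (apply cder_id || apply cder_const).
    - cbv beta; field; apply two_neq_0. }
  rewrite (Hsplit a b), (Hsplit b c), (Hsplit c a), !Hprim in Ht by auto.
  assert (Hdist : forall x, x = a \/ x = b \/ x = c -> Cmod (x - a) <= P0 * r).
  { assert (Paa : Cmod (a - a) = 0) by (replace (a - a)%C with (RtoC 0) by ring; apply Cmod_0).
    pose proof (Cmod_ge_0 (a - b)). pose proof (Cmod_ge_0 (b - c)). pose proof (Cmod_ge_0 (c - a)).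
    intros x [-> | [-> | -> ] ]; [lra|rewrite Cmod_sub_comm; lra|lra]. }
  (* [4 * P0 * r] bounds the distance of the first vertex from the limit point, and [P0 * r] that of
     the other vertices from the first. *)
  assert (Hnear : forall x, x = a \/ x = b \/ x = c -> Cmod (x - p) <= 5 * P0 * r).
  { intros x Hx. pose proof (Cmod_triangle3 x a p). specialize (Hdist x Hx). lra. }
  assert (Hb : forall x y, (x = a \/ x = b \/ x = c) -> (y = a \/ y = b \/ y = c) -> K x -> K y ->
    Rabs (jint v x y) <= eps * (5 * P0 * r) * Cmod (x - y)).
  { intros x y Hx Hy Kx Ky. rewrite (Cmod_sub_comm x y). apply jint_bound; auto. intros t Ht'.
    unfold v, lin.
    assert (Cmod (seg x y t - p) <= 5 * P0 * r).
    { replace (seg x y t - p)%C with ((1 - t)%R * (x - p) + t * (y - p))%C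
        by (unfold seg; rewrite RtoC_minus; ring).
      eapply Rle_trans; [apply Cmod_triangle|]. rewrite !Cmod_mult, !Cmod_R, !Rabs_right by lra.
      pose proof (Hnear x Hx). pose proof (Hnear y Hy). nra. }
    replace (u (seg x y t) - (u p + l * (seg x y t - p)))%C
      with (u (seg x y t) - u p - l * (seg x y t - p))%C by ring.
    eapply Rle_trans; [apply Hdl; lra|]. apply Rmult_le_compat_l; lra. }
  pose proof (Hb a b ltac:(auto) ltac:(auto) Ia Ib) as B1.
  pose proof (Hb b c ltac:(auto) ltac:(auto) Ib Ic) as B2.
  pose proof (Hb c a ltac:(auto) ltac:(auto) Ic Ia) as B3.
  replace (Re (prim b) - Re (prim a) + jint v a b +
      (Re (prim c) - Re (prim b) + jint v b c) +
      (Re (prim a) - Re (prim c) + jint v c a))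
    with (jint v a b + jint v b c + jint v c a) in Ht by ring.
  assert (Rabs (jint v a b + jint v b c + jint v c a) <=
    Rabs (jint v a b) + Rabs (jint v b c) + Rabs (jint v c a)).
  { eapply Rle_trans; [apply Rabs_triang|]. apply Rplus_le_compat_r. apply Rabs_triang. }
  assert (Hfin : Rabs (jint u (ta T) (tb T) + jint u (tb T) (tc T) + jint u (tc T) (ta T)) * (1/4)^n
    <= eps * (5 * P0 * r) * (P0 * r)) by (rewrite <- Hp; nra).
  replace ((1/4)^n) with (r * r) in Hfin.
  2: { unfold r. rewrite <- Rpow_mult_distr. f_equal. field. }
  apply Rmult_le_reg_r with (r * r); [apply Rmult_lt_0_compat; auto|].
  eapply Rle_trans; [apply Hfin|]. right; ring.
Qed.

Definition open_domain (D : C -> Prop) : Prop :=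
  forall z, D z -> exists r, 0 < r /\ forall w, Cmod (w - z) < r -> D w.

(* Open sets on which the primitive argument applies; three points are enough
   because one triangle is considered at a time. *)
Definition good_domain (D : C -> Prop) : Prop :=
  open_domain D /\
  (forall a b c, D a -> D b -> D c ->
     exists K, convex K /\ closed_set K /\ (forall z, K z -> D z) /\ K a /\ K b /\ K c).

Definition hol (D : C -> Prop) (u : C -> C) : Prop := forall z, D z -> exists l, cder u z l.

Lemma good_domain_convex (D : C -> Prop) : good_domain D -> convex D.
Proof.
  intros [_ H] a b t Ha Hb Ht. destruct (H a b b Ha Hb Hb) as [K [K1 [_ [K3 [Ka [Kb _]]]]]].
  apply K3, K1; auto.
Qed.

(** Integration along segments from a base point [c]: Goursat's lemma on the triangle [c], [x], [y]
    turns increments into integrals over short segments. [Hlow] treats a real part; applied to [u]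
    and to [iu] it gives both coordinates of the primitive. *)
Lemma good_domain_primitive (D : C -> Prop) (u : C -> C) (c : C) : good_domain D -> D c -> hol D u ->
  exists v, forall z, D z -> cder v z (u z).
Proof.
  intros HD Hc Hu. pose proof (good_domain_convex D HD) as Hconv. destruct HD as [Hopen HK].
  assert (Hcs : forall w x y, hol D w -> D x -> D y -> cont_seg w x y).
  { intros w x y Hw Hx Hy t Ht. destruct (Hw (seg x y t)) as [l Hl]; [apply Hconv; auto|].
    eapply cder_ccont; eauto. }
  assert (Hch : forall w x y, hol D w -> D x -> D y -> jint w c y - jint w c x = jint w x y).
  { intros w x y Hw Hx Hy. destruct (HK c x y Hc Hx Hy) as [K [K1 [K2 [K3 [Kc [Kx Ky]]]]]].
    assert (G : tint w (Tri c x y) = 0).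
    { apply (goursat_triangle w K); auto. repeat split; auto. }
    unfold tint in G; simpl in G. rewrite (jint_swap w c y) in G by auto. lra. }
  assert (Hlow : forall w z, hol D w -> D z -> forall eps, 0 < eps -> exists d, 0 < d /\
    forall y, Cmod (y - z) < d -> Rabs (jint w c y - jint w c z - Re (w z * (y - z))) <= eps * Cmod (y - z)).
  { intros w z Hw Hz eps He. destruct (Hw z Hz) as [l Hl].
    destruct (cder_ccont _ _ _ Hl eps He) as [d [Hd Hdc]].
    destruct (Hopen z Hz) as [r [Hr Hro]].
    exists (Rmin d r); split; [apply Rmin_pos; auto|]. intros y Hy.
    assert (Hy1 := lt_min_l _ _ _ Hy).
    assert (Hy2 := lt_min_r _ _ _ Hy).
    rewrite Hch by (auto; apply Hro; auto).
    assert (E : jint w z y = jint (fun _ => w z) z y + jint (fun x => w x + (- w z))%C z y).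
    { rewrite <- jint_plus.
      - apply jint_ext. intros t _. ring.
      - intros t _. eapply cder_ccont, cder_const.
      - intros t Ht. destruct (Hw (seg z y t)) as [m Hm]; [apply Hconv; auto; apply Hro; auto|].
        eapply cder_ccont, cder_plus; [apply Hm|apply cder_const]. }
    assert (E1 : jint (fun _ => w z) z y = Re (w z * (y - z))).
    { rewrite (jint_primitive _ (fun x => w z * x)%C).
      - unfold Re; simpl; ring.
      - intros t _. eapply cder_ccont, cder_const.
      - intros t _. eapply cder_eq; [apply cder_scal, cder_id|ring]. }
    rewrite E, E1.
    replace (Re (w z * (y - z)) + jint (fun x => w x + (- w z))%C z y - Re (w z * (y - z)))
      with (jint (fun x => w x + (- w z))%C z y) by ring.
    apply jint_bound.
    - intros t Ht. destruct (Hw (seg z y t)) as [m Hm]; [apply Hconv; auto; apply Hro; auto|].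
      eapply cder_ccont, cder_plus; [apply Hm|apply cder_const].
    - intros t Ht. left. apply Hdc. unfold seg.
      replace (z + t * (y - z) - z)%C with (t * (y - z))%C by ring.
      rewrite Cmod_mult, Cmod_R, Rabs_right by lra. pose proof (Cmod_ge_0 (y - z)). nra. }
  pose (iu := fun z => (- Ci * u z)%C).
  assert (Hiu : hol D iu).
  { intros z Hz. destruct (Hu z Hz) as [l Hl]. eexists. apply cder_scal, Hl. }
  exists (fun z => (jint u c z, jint iu c z)).
  intros z Hz eps He.
  destruct (Hlow u z Hu Hz (eps / 2)) as [d1 [Hd1 K1]]; [lra|].
  destruct (Hlow iu z Hiu Hz (eps / 2)) as [d2 [Hd2 K2]]; [lra|].
  exists (Rmin d1 d2); split; [apply Rmin_pos; auto|]. intros y Hy.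
  specialize (K1 y (lt_min_l _ _ _ Hy)).
  specialize (K2 y (lt_min_r _ _ _ Hy)).
  eapply Rle_trans; [apply Cmod_le_re_im|].
  replace (Re ((jint u c y, jint iu c y) - (jint u c z, jint iu c z) - u z * (y - z)))
    with (jint u c y - jint u c z - Re (u z * (y - z))) by (unfold Re; simpl; ring).
  replace (Im ((jint u c y, jint iu c y) - (jint u c z, jint iu c z) - u z * (y - z)))
    with (jint iu c y - jint iu c z - Re (iu z * (y - z))) by (unfold Re, Im, iu; simpl; ring).
  lra.
Qed.

(** * The exponential, Cauchy estimates and logarithms *)

Definition cdisc (c : C) (r : R) (z : C) : Prop := Cmod (z - c) < r.
Definition rhalf (m : R) (z : C) : Prop := m < Re z.

Lemma cdisc_center (c : C) (r : R) : 0 < r -> cdisc c r c.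
Proof.
  intros H. unfold cdisc. replace (c - c)%C with (RtoC 0) by ring. rewrite Cmod_0; auto.
Qed.

Lemma cdisc_sub (c c' : C) (r r' : R) (z : C) :
  Cmod (c' - c) + r' <= r -> cdisc c' r' z -> cdisc c r z.
Proof.
  unfold cdisc. intros H Hz. pose proof (Cmod_triangle3 z c' c). lra.
Qed.

Lemma rhalf_disc (m : R) (c z : C) : cdisc c (Re c - m) z -> rhalf m z.
Proof.
  unfold cdisc, rhalf. intros H. pose proof (re_le_Cmod (z - c)) as K.
  apply Rabs_le_between in K. change (Re (z - c)) with (Re z - Re c) in K. lra.
Qed.

Lemma good_disc (c : C) (r : R) : good_domain (cdisc c r).
Proof.
  split.
  - intros z Hz. exists (r - Cmod (z - c)). unfold cdisc in *. split; [lra|].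
    intros w Hw. pose proof (Cmod_triangle3 w z c). lra.
  - intros x y z Hx Hy Hz. unfold cdisc in *.
    set (s := Rmax (Cmod (x - c)) (Rmax (Cmod (y - c)) (Cmod (z - c)))).
    assert (Cmod (x - c) <= s) by apply Rmax_l.
    assert (Cmod (y - c) <= s) by (eapply Rle_trans; [apply Rmax_l|apply Rmax_r]).
    assert (Cmod (z - c) <= s) by (eapply Rle_trans; [apply Rmax_r|apply Rmax_r]).
    assert (s < r) by (unfold s; repeat apply Rmax_lub_lt; auto).
    exists (fun w => Cmod (w - c) <= s). repeat split; auto.
    + intros a b t Ha Hb Ht.
      replace (seg a b t - c)%C with ((1 - t)%R * (a - c) + t * (b - c))%C
        by (unfold seg; rewrite RtoC_minus; ring).
      eapply Rle_trans; [apply Cmod_triangle|]. rewrite !Cmod_mult, !Cmod_R, !Rabs_right by lra. nra.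
    + intros w Hw. apply Rnot_lt_le. intros F.
      destruct (Hw (Cmod (w - c) - s)) as [v [Hv1 Hv2]]; [lra|].
      pose proof (Cmod_triangle3 w v c) as T. rewrite (Cmod_sub_comm w v) in T. lra.
    + intros w Hw. lra.
Qed.

Lemma good_rhalf (m : R) : good_domain (rhalf m).
Proof.
  split.
  - intros z Hz. exists (Re z - m). unfold rhalf in *. split; [lra|].
    intros w Hw. apply (rhalf_disc m z); auto.
  - intros x y z Hx Hy Hz. unfold rhalf in *.
    set (s := Rmin (Re x) (Rmin (Re y) (Re z))).
    assert (s <= Re x) by le_min.
    assert (s <= Re y) by le_min.
    assert (s <= Re z) by le_min.
    assert (m < s) by (unfold s; repeat apply Rmin_glb_lt; auto).
    exists (fun w => s <= Re w). repeat split; auto.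
    + intros a b t Ha Hb Ht.
      replace (Re (seg a b t)) with ((1 - t) * Re a + t * Re b) by (unfold seg, Re; simpl; ring).
      nra.
    + intros w Hw. apply Rnot_lt_le. intros F.
      destruct (Hw (s - Re w)) as [v [Hv1 Hv2]]; [lra|].
      pose proof (re_le_Cmod (v - w)) as T. apply Rabs_le_between in T.
      change (Re (v - w)) with (Re v - Re w) in T. lra.
    + intros w Hw. lra.
Qed.

Lemma convex_disc (c : C) (r : R) : convex (cdisc c r).
Proof. apply good_domain_convex, good_disc. Qed.

Lemma convex_rhalf (m : R) : convex (rhalf m).
Proof. apply good_domain_convex, good_rhalf. Qed.

Lemma Cexp_plus (a b : C) : Cexp (a + b) = (Cexp a * Cexp b)%C.
Proof.
  unfold Cexp. destruct a as [x y], b as [x' y']. unfold Re, Im; simpl.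
  rewrite exp_plus, cos_plus, sin_plus. apply injective_projections; simpl; ring.
Qed.

Lemma Cexp_0 : Cexp 0 = 1%C.
Proof.
  unfold Cexp, Re, Im; simpl. rewrite exp_0, cos_0, sin_0.
  apply injective_projections; simpl; ring.
Qed.

Lemma Cmod_Cexp (z : C) : Cmod (Cexp z) = exp (Re z).
Proof.
  unfold Cexp, Cmod; simpl. replace (_ + _) with (exp (Re z) * exp (Re z)).
  - apply sqrt_square. left; apply exp_pos.
  - pose proof (sin2_cos2 (Im z)) as H. unfold Rsqr in H.
    transitivity (exp (Re z) * exp (Re z) * (sin (Im z) * sin (Im z) + cos (Im z) * cos (Im z))).
    + rewrite H; ring.
    + ring.
Qed.

Lemma Cexp_neq_0 (z : C) : Cexp z <> 0%C.
Proof. apply Cmod_gt_0. rewrite Cmod_Cexp. apply exp_pos. Qed.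

Lemma Cexp_opp (z : C) : Cexp (- z) = (/ Cexp z)%C.
Proof.
  pose proof (Cexp_neq_0 z) as H.
  assert (E : (Cexp z * Cexp (- z) = 1)%C).
  { rewrite <- Cexp_plus, <- Cexp_0. f_equal. ring. }
  replace (Cexp (- z)) with (/ Cexp z * (Cexp z * Cexp (- z)))%C by (field; auto).
  rewrite E. ring.
Qed.

Definition tpi : C := (0, 2 * PI).

Lemma Cexp_period (z : C) : Cexp (z + tpi) = Cexp z.
Proof.
  unfold Cexp, tpi. destruct z as [x y]; unfold Re, Im; simpl.
  rewrite Rplus_0_r, cos_plus, sin_plus, cos_2PI, sin_2PI.
  apply injective_projections; simpl; ring.
Qed.

Lemma Cexp_surj (w : C) : w <> 0%C -> exists z, Cexp z = w.
Proof.
  intros H. apply Cmod_gt_0 in H. destruct w as [x y].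
  set (r := Cmod (x, y)) in *.
  assert (Hr : r * r = x * x + y * y).
  { unfold r, Cmod; simpl. rewrite sqrt_sqrt; [ring|nra]. }
  assert (Hc : -1 <= x / r <= 1).
  { pose proof (re_le_Cmod (x, y)) as K. change (Rabs x <= r) in K. apply Rabs_le_between in K.
    split.
    - apply Rmult_le_reg_r with r; auto. unfold Rdiv. rewrite Rmult_assoc, Rinv_l; lra.
    - apply Rmult_le_reg_r with r; auto. unfold Rdiv. rewrite Rmult_assoc, Rinv_l; lra. }
  assert (Hs : sqrt (1 - (x / r)²) = Rabs y / r).
  { replace (1 - (x / r)²) with (Rsqr (Rabs y / r)).
    - apply sqrt_Rsqr. apply Rmult_le_pos; [apply Rabs_pos|]. left; apply Rinv_0_lt_compat; auto.
    - unfold Rsqr. assert (Rabs y * Rabs y = y * y) by (rewrite <- Rabs_mult; apply Rabs_right; nra).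
      replace (Rabs y / r * (Rabs y / r)) with ((Rabs y * Rabs y) / (r * r)) by (field; lra).
      replace (1 - x / r * (x / r)) with ((r * r - x * x) / (r * r)) by (field; lra).
      rewrite H0, Hr. f_equal. ring. }
  destruct (Rle_or_lt 0 y) as [Hy|Hy].
  - exists (ln r, acos (x / r)). unfold Cexp, Re, Im; simpl.
    rewrite exp_ln, cos_acos, sin_acos, Hs, Rabs_right by (auto; lra).
    apply injective_projections; simpl; field; lra.
  - exists (ln r, - acos (x / r)). unfold Cexp, Re, Im; simpl.
    rewrite cos_neg, sin_neg, exp_ln, cos_acos, sin_acos, Hs, Rabs_left by (auto; lra).
    apply injective_projections; simpl; field; lra.
Qed.

Lemma derivable_at_0 (f : R -> R) (l : R) : derivable_pt_lim f 0 l ->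
  forall eps, 0 < eps -> exists d, 0 < d /\ forall x, Rabs x < d ->
    Rabs (f x - f 0 - l * x) <= eps * Rabs x.
Proof.
  intros H eps He. destruct (H eps He) as [d K]. exists d; split; [apply cond_pos|].
  intros x Hx. destruct (Req_dec x 0) as [->|Hx0].
  - replace (f 0 - f 0 - l * 0) with 0 by ring. rewrite Rabs_R0. lra.
  - specialize (K x Hx0 Hx). rewrite Rplus_0_l in K.
    replace (f x - f 0 - l * x) with (((f x - f 0) / x - l) * x) by (field; auto).
    rewrite Rabs_mult. apply Rmult_le_compat_r; [apply Rabs_pos|lra].
Qed.

(** The addition formula reduces the claim to the derivative at 0, which is assembled from those of
    [exp], [cos] and [sin]; the errors add up to [6 * e * m], whence [eps / 8]. *)
Lemma cder_Cexp (z : C) : cder Cexp z (Cexp z).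
Proof.
  assert (H0 : cder Cexp 0 1).
  { intros eps He.
    set (e := Rmin (eps / 8) (1 / 2)).
    assert (He' : 0 < e) by (apply Rmin_pos; lra).
    assert (Hee : e <= eps / 8) by le_min. assert (He2 : e <= 1 / 2) by le_min.
    destruct (derivable_at_0 exp 1) with (eps := e) as [d1 [Hd1 K1]]; auto.
    { pose proof (derivable_pt_lim_exp 0) as K. rewrite exp_0 in K. exact K. }
    destruct (derivable_at_0 cos 0) with (eps := e) as [d2 [Hd2 K2]]; auto.
    { pose proof (derivable_pt_lim_cos 0) as K. rewrite sin_0, Ropp_0 in K. exact K. }
    destruct (derivable_at_0 sin 1) with (eps := e) as [d3 [Hd3 K3]]; auto.
    { pose proof (derivable_pt_lim_sin 0) as K. rewrite cos_0 in K. exact K. }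
    exists (Rmin (Rmin d1 d2) (Rmin d3 (e / 2))). split.
    { repeat apply Rmin_pos; lra. }
    intros w Hw. replace (w - 0)%C with w in * by ring.
    assert (L1 : Cmod w < d1) by (eapply Rlt_le_trans; [apply Hw|le_min]).
    assert (L2 : Cmod w < d2) by (eapply Rlt_le_trans; [apply Hw|le_min]).
    assert (L3 : Cmod w < d3) by (eapply Rlt_le_trans; [apply Hw|le_min]).
    assert (L4 : Cmod w < e / 2) by (eapply Rlt_le_trans; [apply Hw|le_min]).
    pose proof (re_le_Cmod w) as Rx. pose proof (im_le_Cmod w) as Ry.
    destruct w as [x y]. change (Re (x, y)) with x in *. change (Im (x, y)) with y in *.
    specialize (K1 x ltac:(lra)). specialize (K2 y ltac:(lra)). specialize (K3 y ltac:(lra)).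
    rewrite exp_0 in K1. rewrite cos_0 in K2. rewrite sin_0 in K3.
    rewrite Cexp_0. set (m := Cmod (x, y)) in *.
    eapply Rle_trans; [apply Cmod_le_re_im|].
    assert (E1 : Rabs (exp x - 1) <= 2 * Rabs x).
    { replace (exp x - 1) with ((exp x - 1 - 1 * x) + x) by ring.
      eapply Rle_trans; [apply Rabs_triang|]. pose proof (Rabs_pos x). nra. }
    pose proof (Rabs_pos x) as Px. pose proof (Rabs_pos y) as Py.
    assert (E2 : Rabs (exp x) <= 2).
    { replace (exp x) with ((exp x - 1) + 1) by ring.
      eapply Rle_trans; [apply Rabs_triang|]. rewrite Rabs_R1. lra. }
    assert (E3 : Rabs (sin y) <= 2 * Rabs y).
    { replace (sin y) with ((sin y - 0 - 1 * y) + y) by ring.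
      eapply Rle_trans; [apply Rabs_triang|]. nra. }
    replace (Re (Cexp (x, y) - 1 - 1 * (x, y))) with
      ((exp x - 1 - 1 * x) + exp x * (cos y - 1 - 0 * y)) by (unfold Cexp, Re, Im; simpl; ring).
    replace (Im (Cexp (x, y) - 1 - 1 * (x, y))) with
      ((exp x - 1) * sin y + (sin y - 0 - 1 * y)) by (unfold Cexp, Re, Im; simpl; ring).
    pose proof (Rabs_triang (exp x - 1 - 1 * x) (exp x * (cos y - 1 - 0 * y))) as T1.
    pose proof (Rabs_triang ((exp x - 1) * sin y) (sin y - 0 - 1 * y)) as T2.
    rewrite Rabs_mult in T1, T2.
    assert (M1 : Rabs (exp x) * Rabs (cos y - 1 - 0 * y) <= 2 * (e * m)).
    { apply Rmult_le_compat; try apply Rabs_pos; auto. eapply Rle_trans; [apply K2|].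
      apply Rmult_le_compat_l; lra. }
    assert (M2 : Rabs (exp x - 1) * Rabs (sin y) <= e * (2 * m)).
    { apply Rmult_le_compat; try apply Rabs_pos; lra. }
    assert (e * Rabs x <= e * m) by (apply Rmult_le_compat_l; lra).
    assert (e * Rabs y <= e * m) by (apply Rmult_le_compat_l; lra).
    assert (0 <= m) by apply Cmod_ge_0.
    assert (6 * (e * m) <= eps * m) by nra.
    lra. }
  assert (H1 : cder (fun w => Cexp (w - z)) z 1).
  { eapply cder_eq.
    - apply (cder_comp Cexp (fun w => w - z)%C z 1 1).
      + replace (z - z)%C with (RtoC 0) by ring. exact H0.
      + eapply cder_eq; [apply cder_sub_const|ring].
    - ring. }
  apply (cder_scal (Cexp z)) in H1.
  eapply cder_eq; [|apply Cmult_1_r].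
  eapply cder_ext; [exact Rlt_0_1| |apply H1].
  intros w _. cbv beta. rewrite <- Cexp_plus. f_equal. ring.
Qed.

Lemma cder_Cexp_comp (u : C -> C) (z l : C) :
  cder u z l -> cder (fun w => Cexp (u w)) z (l * Cexp (u z))%C.
Proof. intros H. apply (cder_comp Cexp); auto. apply cder_Cexp. Qed.

Lemma zero_derivative_constant (D : C -> Prop) (u : C -> C) (a b : C) : convex D ->
  (forall z, D z -> cder u z 0) -> D a -> D b -> u a = u b.
Proof.
  intros HD Hu Ha Hb. symmetry. apply Cmod_sub_0.
  pose proof (cder_segment_bound u (fun _ => 0%C) a b 0 0) as K.
  replace (u b - u a)%C with (u b - u a - 0 * (b - a))%C by ring.
  eapply Rle_trans; [apply K|right; ring].
  - intros t Ht. apply Hu. apply (HD a b t); auto.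
  - intros t Ht. replace (0 - 0)%C with (RtoC 0) by ring. rewrite Cmod_0; lra.
Qed.

Lemma Cmod_tpi : Cmod tpi = 2 * PI.
Proof.
  replace tpi with (Ci * RtoC (2 * PI))%C.
  - rewrite Cmod_mult, Cmod_Ci, Cmod_R, Rabs_right; [ring|]. pose proof PI_RGT_0; lra.
  - unfold tpi. apply injective_projections; simpl; ring.
Qed.

(* In the coordinate [s] with [z = a + Cexp (- s)], circles about [a] become vertical
   segments of length [2 PI]; the increment over a period of a primitive of
   [(u z - q) * Cexp s] does not depend on the radius and tends to [2 PI i u'(a)]. *)
Lemma cauchy_estimate (u : C -> C) (a q l : C) (R0 r B : R) : 0 < r < R0 ->
  hol (cdisc a R0) u -> cder u a l ->
  (forall w, Cmod (w - a) = r -> Cmod (u w - q) <= B) -> Cmod l <= B / r.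
Proof.
  intros Hr Hu Hl HB.
  set (pt := fun s => (a + Cexp (- s))%C).
  assert (Hpt : forall s, Cmod (pt s - a) = exp (- Re s)).
  { intros s. unfold pt. replace (a + Cexp (- s) - a)%C with (Cexp (- s)) by ring.
    rewrite Cmod_Cexp. reflexivity. }
  set (U := fun s => ((u (pt s) - q) * Cexp s)%C).
  assert (Hptper : forall s, pt (s + tpi)%C = pt s).
  { intros s. unfold pt. f_equal. rewrite <- (Cexp_period (- (s + tpi))). f_equal. ring. }
  assert (HUper : forall s, U (s + tpi)%C = U s).
  { intros s. unfold U. rewrite Hptper, Cexp_period. auto. }
  assert (Hin : forall s, rhalf (- ln R0) s -> cdisc a R0 (pt s)).
  { intros s Hs. unfold cdisc, rhalf in *. rewrite Hpt.
    apply Rlt_le_trans with (exp (ln R0)); [apply exp_increasing; lra|]. rewrite exp_ln; lra. }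
  assert (HUhol : hol (rhalf (- ln R0)) U).
  { intros s Hs. destruct (Hu (pt s) (Hin s Hs)) as [m Hm]. eexists. unfold U.
    apply cder_mult; [|apply cder_Cexp]. apply cder_minus; [|apply cder_const].
    apply (cder_comp u pt); [exact Hm|]. unfold pt. apply cder_plus; [apply cder_const|].
    apply cder_Cexp_comp. apply cder_opp, cder_id. }
  set (x0 := RtoC (- ln r)).
  assert (Hx0 : rhalf (- ln R0) x0).
  { unfold rhalf, x0; simpl. apply Ropp_lt_contravar. apply ln_increasing; lra. }
  destruct (good_domain_primitive _ U x0 (good_rhalf _) Hx0 HUhol) as [V HV].
  assert (Hper : forall s, rhalf (- ln R0) s -> rhalf (- ln R0) (s + tpi)%C).
  { intros s. unfold rhalf, tpi; simpl. rewrite Rplus_0_r; auto. }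
  assert (Hconst : forall s, rhalf (- ln R0) s ->
    (V (s + tpi) - V s = V (x0 + tpi) - V x0)%C).
  { intros s Hs. apply (zero_derivative_constant (rhalf (- ln R0)) (fun s => V (s + tpi) - V s)%C); auto.
    { apply convex_rhalf. }
    intros z Hz. eapply cder_eq.
    - apply cder_minus; [|apply HV; auto].
      apply (cder_comp V (fun s => s + tpi)%C); [apply HV; auto|].
      apply cder_add_const.
    - cbv beta. rewrite HUper. ring. }
  pose proof PI_RGT_0 as HPI.
  assert (Hval : (V (x0 + tpi) - V x0 = l * tpi)%C).
  { apply Cmod_sub_0. apply (le_small _ (2 * PI)); [lra|]. intros eps He.
    destruct (Hl eps He) as [d [Hd K]].
    (* The circle over [s] has radius [exp (- Re s)], which is below [d], so the derivative estimate
       [K] at [a] applies on it. *)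
    set (s := RtoC (Rmax (- ln r) (1 - ln d))).
    assert (Hs : rhalf (- ln R0) s).
    { unfold rhalf, s, x0 in *; simpl in *. eapply Rlt_le_trans; [apply Hx0|apply Rmax_l]. }
    rewrite <- (Hconst s Hs).
    (* The constant term [u a - q] leads to a periodic primitive, which contributes nothing over a
       period; what remains of the integrand is close to [l]. *)
    set (W := fun z => (V z - (u a - q) * Cexp z)%C).
    replace (V (s + tpi) - V s - l * tpi)%C with (W (s + tpi) - W s - l * ((s + tpi) - s))%C.
    2: { unfold W. rewrite Cexp_period. ring. }
    replace (2 * PI) with (Cmod ((s + tpi) - s)).
    2: { rewrite <- Cmod_tpi. f_equal. ring. }
    apply (cder_segment_bound W (fun z => U z - (u a - q) * Cexp z)%C).
    - intros t Ht. unfold W. apply cder_minus; [|apply cder_scal, cder_Cexp].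
      apply HV. apply (convex_rhalf (- ln R0) s (s + tpi)%C t); auto.
    - intros t Ht. set (z := (s + t * (s + tpi - s))%C).
      assert (Hz : Re z = Re s) by (unfold z, tpi, Re; simpl; ring).
      assert (Hzd : Cmod (pt z - a) < d).
      { rewrite Hpt, Hz. unfold s; simpl. pose proof (Rmax_r (- ln r) (1 - ln d)).
        apply Rlt_le_trans with (exp (ln d)); [apply exp_increasing; lra|]. rewrite exp_ln; lra. }
      specialize (K _ Hzd).
      replace (U z - (u a - q) * Cexp z - l)%C with ((u (pt z) - u a - l * (pt z - a)) * Cexp z)%C.
      2: { unfold U. replace (pt z - a)%C with (Cexp (- z)) by (unfold pt; ring).
           rewrite Cexp_opp. pose proof (Cexp_neq_0 z). field; auto. }
      rewrite Cmod_mult. rewrite Hpt in K. rewrite Cmod_Cexp.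
      apply Rle_trans with (eps * exp (- Re z) * exp (Re z)).
      + apply Rmult_le_compat_r; [left; apply exp_pos|auto].
      + rewrite Rmult_assoc, <- exp_plus. replace (- Re z + Re z) with 0 by ring. rewrite exp_0; lra. }
  assert (Hbnd : Cmod (l * tpi) <= B / r * (2 * PI)).
  { rewrite <- Hval. replace (2 * PI) with (Cmod ((x0 + tpi) - x0)).
    2: { rewrite <- Cmod_tpi. f_equal. ring. }
    replace (V (x0 + tpi) - V x0)%C with (V (x0 + tpi) - V x0 - 0 * (x0 + tpi - x0))%C by ring.
    apply (cder_segment_bound V U).
    - intros t Ht. apply HV. apply (convex_rhalf (- ln R0) x0 (x0 + tpi)%C t); auto.
    - intros t Ht. set (z := (x0 + t * (x0 + tpi - x0))%C).
      assert (Hz : Re z = - ln r) by (unfold z, x0, tpi, Re; simpl; ring).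
      replace (U z - 0)%C with (U z) by ring. unfold U. rewrite Cmod_mult, Cmod_Cexp, Hz.
      rewrite exp_Ropp, exp_ln by lra. apply Rmult_le_compat_r; [left; apply Rinv_0_lt_compat; lra|].
      apply HB. rewrite Hpt, Hz, Ropp_involutive, exp_ln; lra. }
  rewrite Cmod_mult, Cmod_tpi in Hbnd.
  apply Rmult_le_reg_r with (2 * PI); lra.
Qed.

(** [u a] is the derivative at [a] of [(w - a) * u w], and the Cauchy estimate for this product
    loses nothing. *)
Lemma mean_value_bound (u : C -> C) (a : C) (R0 r B : R) : 0 < r < R0 ->
  hol (cdisc a R0) u -> (forall w, Cmod (w - a) = r -> Cmod (u w) <= B) -> Cmod (u a) <= B.
Proof.
  intros Hr Hu HB. destruct (Hu a) as [l Hl]; [apply cdisc_center; lra|].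
  replace B with (r * B / r) by (field; lra).
  apply (cauchy_estimate (fun w => (w - a) * u w)%C a 0 (u a) R0 r); auto.
  - intros z Hz. destruct (Hu z Hz) as [m Hm]. eexists. apply cder_mult; [|apply Hm].
    apply cder_sub_const.
  - eapply cder_eq.
    + apply cder_mult; [|apply Hl]. apply cder_sub_const.
    + cbv beta. ring.
  - intros w Hw. replace ((w - a) * u w - 0)%C with ((w - a) * u w)%C by ring.
    rewrite Cmod_mult, Hw. apply Rmult_le_compat_l; [lra|auto].
Qed.

Lemma hol_C_derive (D : C -> Prop) (u : C -> C) (z : C) : hol D u -> D z -> cder u z (C_derive u z).
Proof.
  intros H Hz. destruct (H z Hz) as [l Hl].
  rewrite (is_C_derive_unique u z l); [exact Hl|]. apply cder_is_derive; auto.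
Qed.

Lemma C_derive_eq (u : C -> C) (z l : C) : cder u z l -> C_derive u z = l.
Proof. intros H. apply is_C_derive_unique. apply cder_is_derive; auto. Qed.

Lemma hol_sub (D D' : C -> Prop) (u : C -> C) : (forall z, D' z -> D z) -> hol D u -> hol D' u.
Proof. intros H Hu z Hz. apply Hu; auto. Qed.

(** The circle has to lie strictly inside the disc; the one of half the radius costs the factor
    2. *)
Lemma cauchy_estimate_sup (u : C -> C) (a q l : C) (r B : R) : 0 < r ->
  hol (cdisc a r) u -> cder u a l ->
  (forall w, cdisc a r w -> Cmod (u w - q) <= B) -> Cmod l <= 2 * B / r.
Proof.
  intros Hr Hu Hl HB.
  replace (2 * B / r) with (B / (r / 2)) by (field; lra).
  apply (cauchy_estimate u a q l r (r / 2) B); auto; [lra|].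
  intros w Hw. apply HB. unfold cdisc; lra.
Qed.

(** Cauchy estimates are iterated on shrinking discs. They bound the derivative [du] ([H1]); applied
    to [u (x + h) - u x] they make [du] Lipschitz ([H2]); hence the difference quotients of [u]
    approximate [du] uniformly, up to a multiple of the increment ([H3]); and a last estimate, for
    the difference of two such quotients, shows that the difference quotients [Q] of [du] at [a] are
    Cauchy ([H4]). *)
Lemma hol_derive (D : C -> Prop) (u : C -> C) :
  open_domain D ->
  hol D u -> hol D (C_derive u).
Proof.
  intros Hopen Hu a Ha. destruct (Hopen a Ha) as [r0 [Hr0 HD]].
  destruct (Hu a Ha) as [l0 Hl0].
  destruct (cder_ccont _ _ _ Hl0 1 Rlt_0_1) as [d [Hd Hd1]].
  set (R := Rmin r0 d). assert (HR : 0 < R) by (apply Rmin_pos; auto).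
  assert (HD' : forall z, cdisc a R z -> D z).
  { intros z Hz. apply HD. eapply lt_min_l, Hz. }
  assert (Hb : forall z, cdisc a R z -> Cmod (u z - u a) <= 1).
  { intros z Hz. left. apply Hd1. eapply lt_min_r, Hz. }
  assert (HuR : hol (cdisc a R) u) by (intros z Hz; apply Hu; auto).
  clear Hd1 HD Hopen Hu.
  set (du := C_derive u).
  assert (Hdu : forall z, cdisc a R z -> cder u z (du z)) by (intros; eapply hol_C_derive; eauto).
  assert (H1 : forall z, cdisc a (R / 2) z -> Cmod (du z) <= 4 / R).
  { intros z Hz. replace (4 / R) with (2 * 1 / (R / 2)) by (field; lra).
    assert (Hs : forall w, cdisc z (R / 2) w -> cdisc a R w).
    { intros w. apply cdisc_sub. unfold cdisc in Hz; lra. }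
    apply (cauchy_estimate_sup u z (u a)); [lra| | |].
    - eapply hol_sub; [|apply HuR]. auto.
    - apply Hdu. unfold cdisc in *; lra.
    - intros w Hw. auto. }
  assert (Hlip : forall z w, cdisc a (R / 2) z -> cdisc a (R / 2) w ->
    Cmod (u w - u z) <= 4 / R * Cmod (w - z)).
  { intros z w Hz Hw. replace (u w - u z)%C with (u w - u z - 0 * (w - z))%C by ring.
    apply (cder_segment_bound u du).
    - intros t Ht. apply Hdu.
      pose proof (convex_disc a (R / 2) z w t Hz Hw Ht) as K.
      change (cdisc a R (seg z w t)). unfold cdisc in *; lra.
    - intros t Ht. replace (du (z + t * (w - z)) - 0)%C with (du (seg z w t)) by (unfold seg; ring).
      apply H1. apply (convex_disc a (R / 2) z w t Hz Hw Ht). }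
  assert (H2 : forall z w, cdisc a (R / 8) z -> cdisc a (R / 4) w ->
    Cmod (du w - du z) <= 64 / (R * R) * Cmod (w - z)).
  { intros z w Hz Hw. set (h := (w - z)%C).
    replace (64 / (R * R) * Cmod h) with (2 * (4 / R * Cmod h) / (R / 8)) by (field; lra).
    assert (Hi1 : forall x, cdisc z (R / 8) x -> cdisc a (R / 4) x).
    { intros x. apply cdisc_sub. unfold cdisc in Hz; lra. }
    assert (Hi2 : forall x, cdisc z (R / 8) x -> cdisc a (3 * R / 8) (x + h)%C).
    { intros x Hx. unfold cdisc in *. replace (x + h - a)%C with ((x - z) + (w - a))%C by (unfold h; ring).
      eapply Rle_lt_trans; [apply Cmod_triangle|]. lra. }
    assert (Hsub : forall x r, r <= R -> cdisc a r x -> cdisc a R x) by (unfold cdisc; intros; lra).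
    apply (cauchy_estimate_sup (fun x => u (x + h) - u x)%C z 0); [lra| | |].
    - intros x Hx. eexists. apply cder_minus.
      + apply (cder_comp u (fun x => x + h)%C); [apply Hdu|].
        * apply (Hsub _ (3 * R / 8)); [lra|auto].
        * apply cder_add_const.
      + apply Hdu. apply (Hsub _ (R / 4)); [lra|auto].
    - eapply cder_eq.
      + apply cder_minus.
        * apply (cder_comp u (fun x => x + h)%C); [apply Hdu|].
          -- apply (Hsub _ (3 * R / 8)); [lra|apply Hi2, cdisc_center; lra].
          -- apply cder_add_const.
        * apply Hdu. apply (Hsub _ (R / 8)); [lra|auto].
      + cbv beta. replace (z + h)%C with w by (unfold h; ring). ring.
    - intros x Hx. replace (u (x + h) - u x - 0)%C with (u (x + h) - u x)%C by ring.
      replace (Cmod h) with (Cmod ((x + h) - x)) by (f_equal; ring).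
      specialize (Hi1 x Hx). specialize (Hi2 x Hx). unfold cdisc in Hi1, Hi2.
      apply Hlip; unfold cdisc; lra. }
  set (L := 64 / (R * R)) in *.
  assert (HL : 0 < L) by (apply Rdiv_lt_0_compat; nra).
  assert (H3 : forall x h, cdisc a (R / 16) x -> Cmod h < R / 16 ->
    Cmod (u (x + h) - u x - du x * h)%C <= L * Cmod h * Cmod h).
  { intros x h Hx Hh. replace (du x * h)%C with (du x * (x + h - x))%C by ring.
    replace (L * Cmod h * Cmod h) with (L * Cmod h * Cmod (x + h - x)) by (do 2 f_equal; ring).
    assert (Hin : forall t, 0 <= t <= 1 -> cdisc a (R / 8) (seg x (x + h) t)).
    { intros t Ht. unfold cdisc, seg in *. replace (x + t * (x + h - x) - a)%C with ((x - a) + t * h)%C by ring.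
      eapply Rle_lt_trans; [apply Cmod_triangle|]. rewrite Cmod_mult, Cmod_R, Rabs_right by lra.
      pose proof (Cmod_ge_0 h). nra. }
    apply (cder_segment_bound u du).
    - intros t Ht. apply Hdu. specialize (Hin t Ht). unfold cdisc, seg in *. lra.
    - intros t Ht. rewrite Cmod_sub_comm.
      specialize (Hin t Ht). unfold seg in Hin.
      rewrite Cmod_sub_comm. eapply Rle_trans; [apply H2; unfold cdisc in *; lra|].
      apply Rmult_le_compat_l; [lra|]. replace (x + t * (x + h - x) - x)%C with (t * h)%C by ring.
      rewrite Cmod_mult, Cmod_R, Rabs_right by lra. pose proof (Cmod_ge_0 h). nra. }
  set (Q := fun h => ((du (a + h) - du a) / h)%C).
  assert (H4 : forall h k : C, h <> 0%C -> k <> 0%C -> Cmod h < R / 16 -> Cmod k < R / 16 ->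
    Cmod (Q h - Q k) <= 32 * L / R * (Cmod h + Cmod k)).
  { intros h k Hh0 Hk0 Hh Hk.
    replace (32 * L / R * (Cmod h + Cmod k)) with (2 * (L * (Cmod h + Cmod k)) / (R / 16)) by (field; lra).
    assert (Hsub : forall x g, cdisc a (R / 16) x -> Cmod g < R / 16 -> cdisc a R (x + g)%C).
    { intros x g Hx Hg. unfold cdisc in *. replace (x + g - a)%C with ((x - a) + g)%C by ring.
      eapply Rle_lt_trans; [apply Cmod_triangle|]. lra. }
    set (q := fun g x => ((u (x + g) - u x) * / g)%C).
    assert (Hq : forall g x, cdisc a (R / 16) x -> Cmod g < R / 16 ->
      cder (q g) x ((du (x + g) - du x) * / g)%C).
    { intros g x Hx Hg. unfold q. eapply cder_eq.
      - apply cder_mult; [|apply cder_const]. apply cder_minus.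
        + apply (cder_comp u (fun x => x + g)%C); [apply Hdu; auto|].
          apply cder_add_const.
        + apply Hdu. unfold cdisc in *; lra.
      - cbv beta. ring. }
    assert (Hqb : forall g x : C, g <> 0%C -> cdisc a (R / 16) x -> Cmod g < R / 16 ->
      Cmod (q g x - du x) <= L * Cmod g).
    { intros g x Hg0 Hx Hg. unfold q.
      replace ((u (x + g) - u x) * / g - du x)%C with ((u (x + g) - u x - du x * g) / g)%C by (field; auto).
      rewrite Cmod_div by auto. apply Cmod_gt_0 in Hg0.
      apply Rle_div_l; [lra|].
      apply H3; auto. }
    apply (cauchy_estimate_sup (fun x => q h x - q k x)%C a 0); [lra| | |].
    - intros x Hx. eexists. apply cder_minus; apply Hq; auto.
    - apply cder_minus; apply Hq; auto; apply cdisc_center; lra.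
    - intros x Hx. replace (q h x - q k x - 0)%C with ((q h x - du x) + - (q k x - du x))%C by ring.
      eapply Rle_trans; [apply Cmod_triangle|]. rewrite Cmod_opp.
      pose proof (Hqb h x Hh0 Hx Hh). pose proof (Hqb k x Hk0 Hx Hk). lra. }
  set (c := 32 * L / R) in *.
  assert (Hc : 0 < c) by (apply Rdiv_lt_0_compat; lra).
  (* The limit of [Q] is found along this one sequence of increments; [H4] then compares an
     arbitrary increment with its members. *)
  set (kn := fun n => RtoC (R / 32 * (1/2)^n)).
  assert (Hkn : forall n, Cmod (kn n) = R / 32 * (1/2)^n).
  { intros n. unfold kn. rewrite Cmod_R, Rabs_right; auto. apply Rle_ge, Rmult_le_pos; [lra|].
    apply pow_le; lra. }
  assert (Hpos : forall n, 0 < (1/2)^n <= 1).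
  { intros n. split; [apply pow_lt; lra|]. pose proof (pow_incr (1/2) 1 n ltac:(lra)) as Hp1.
    rewrite pow1 in Hp1. lra. }
  assert (Hkn0 : forall n, kn n <> 0%C).
  { intros n. apply Cmod_gt_0. rewrite Hkn. specialize (Hpos n). nra. }
  assert (Hknb : forall n, Cmod (kn n) < R / 16).
  { intros n. rewrite Hkn. specialize (Hpos n). nra. }
  destruct (geometric_limit (fun n => Q (kn n)) (c * (R / 16))) as [l Hl].
  { intros n. eapply Rle_trans; [apply H4; auto|]. rewrite !Hkn. simpl. specialize (Hpos n).
    assert (0 <= c * R * (1/2)^n) by (apply Rmult_le_pos; [apply Rmult_le_pos|]; lra).
    lra. }
  exists l. intros eps He.
  exists (Rmin (R / 16) (eps / (c + 1))). split; [apply Rmin_pos; [lra|apply Rdiv_lt_0_compat; lra]|].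
  intros w Hw.
  assert (Hw1 := lt_min_l _ _ _ Hw).
  assert (Hw2 := lt_min_r _ _ _ Hw).
  destruct (classic ((w - a)%C = 0%C)) as [E|N].
  { replace w with a.
    2: { replace w with (a + (w - a))%C by ring. rewrite E. ring. }
    change (Cmod (du a - du a - l * (a - a)) <= eps * Cmod (a - a)).
    replace (du a - du a - l * (a - a))%C with (RtoC 0) by ring.
    rewrite Cmod_0. apply Rmult_le_pos; [lra|apply Cmod_ge_0]. }
  set (h := (w - a)%C) in *.
  assert (HQ : Cmod (Q h - l) <= c * Cmod h).
  { assert (Cmod (Q h - l) - c * Cmod h <= 0); [|lra].
    apply (le_small _ (6 * c * (R / 16))); [nra|]. intros e He'.
    destruct (half_pow_small 1 e He') as [n Hn]. specialize (Hl n). cbv beta in Hl.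
    pose proof (Cmod_triangle3 (Q h) (Q (kn n)) l). specialize (H4 h (kn n) N (Hkn0 n) Hw1 (Hknb n)).
    rewrite Hkn in H4. specialize (Hpos n).
    assert (c * R * (1/2)^n <= c * R * e) by (apply Rmult_le_compat_l; [nra|lra]). nra. }
  change (Cmod (du w - du a - l * h) <= eps * Cmod h).
  replace (du w - du a - l * h)%C with ((Q h - l) * h)%C.
  2: { unfold Q. replace (a + h)%C with w by (unfold h; ring). field; auto. }
  rewrite Cmod_mult. apply Rmult_le_compat_r; [apply Cmod_ge_0|].
  eapply Rle_trans; [apply HQ|].
  pose proof (Cmod_ge_0 h). apply lt_div_succ in Hw2; lra.
Qed.

(** For a primitive [h] of [g' / g] the function [g * Cexp (- h)] is constant; a logarithm [e] of
    this constant corrects [h]. *)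
Lemma good_domain_log (D : C -> Prop) (g : C -> C) (c : C) : good_domain D -> D c -> hol D g ->
  (forall z, D z -> g z <> 0%C) ->
  exists h, (forall z, D z -> Cexp (h z) = g z /\ cder h z (C_derive g z / g z)%C).
Proof.
  intros HD Hc Hg Hnz.
  assert (Hg' := hol_derive D g (proj1 HD) Hg).
  destruct (good_domain_primitive D (fun z => C_derive g z / g z)%C c HD Hc) as [h Hh].
  { intros z Hz. destruct (Hg' z Hz) as [m Hm]. eexists. unfold Cdiv. apply cder_mult; [apply Hm|].
    apply cder_inv; auto. eapply hol_C_derive; eauto. }
  set (k := fun z => (g z * Cexp (- h z))%C).
  assert (Hk : forall z, D z -> cder k z 0).
  { intros z Hz. eapply cder_eq.
    - apply cder_mult; [eapply hol_C_derive; eauto|]. apply cder_Cexp_comp. apply cder_opp; auto.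
    - cbv beta. field. auto. }
  destruct (Cexp_surj (k c)) as [e He].
  { unfold k. apply Cmult_neq_0; auto. apply Cexp_neq_0. }
  exists (fun z => h z + e)%C. intros z Hz. split.
  - rewrite Cexp_plus, He.
    rewrite (zero_derivative_constant D k c z (good_domain_convex D HD) Hk Hc Hz).
    unfold k. rewrite Cexp_opp. pose proof (Cexp_neq_0 (h z)). field; auto.
  - eapply cder_eq; [apply cder_plus; [apply Hh; auto|apply cder_const]|ring].
Qed.

(** * Zeros of infinite order, surjectivity and inverses *)

Lemma cdisc_open (c : C) (r : R) : open_domain (cdisc c r).
Proof. apply good_disc. Qed.

Lemma sub_neq_0 (a b : C) : a <> b -> (a - b)%C <> 0%C.
Proof. intros H E. apply H. replace a with (a - b + b)%C by ring. rewrite E. ring. Qed.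

Lemma cder_pow_sub (p : C) (n : nat) (z : C) : exists l, cder (fun w => (w - p) ^ n)%C z l.
Proof.
  induction n as [|n [l IH]].
  - eexists. simpl. apply cder_const.
  - eexists. simpl. apply cder_mult; [|apply IH]. apply cder_sub_const.
Qed.

(** The singularity of [u z / (z - p)] is removable: the derivative at [p] is half the second
    derivative of [u], by the mean value inequality for the second-order Taylor remainder [k]. *)
Lemma hol_divide (p : C) (r : R) (u : C -> C) : 0 < r -> hol (cdisc p r) u -> u p = 0%C ->
  exists v, hol (cdisc p r) v /\ forall z, cdisc p r z -> u z = ((z - p) * v z)%C.
Proof.
  intros Hr Hu Hp. pose proof (cdisc_center p r Hr) as Hc.
  set (l := C_derive u p).
  assert (Hdu := fun z => hol_C_derive _ u z Hu).
  set (v := fun z => if excluded_middle_informative (z = p) then l else (u z / (z - p))%C).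
  assert (Hvp : v p = l) by (unfold v; destruct (excluded_middle_informative (p = p)); tauto).
  assert (Hvn : forall z, z <> p -> v z = (u z / (z - p))%C).
  { intros z Hz. unfold v. destruct (excluded_middle_informative (z = p)); tauto. }
  exists v. split.
  2: { intros z Hz. destruct (classic (z = p)) as [->|N].
    - rewrite Hp. ring.
    - rewrite Hvn by auto. pose proof (sub_neq_0 _ _ N). field; auto. }
  intros z Hz. destruct (classic (z = p)) as [->|N].
  - destruct (hol_derive _ u (cdisc_open p r) Hu p Hc) as [m Hm]. fold l in Hm.
    exists (m / 2)%C. intros eps He. destruct (Hm eps He) as [d [Hd K]].
    exists (Rmin d r). split; [apply Rmin_pos; auto|]. intros w Hw.
    assert (Hw1 := lt_min_l _ _ _ Hw).
    assert (Hw2 := lt_min_r _ _ _ Hw).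
    destruct (classic (w = p)) as [->|Nw].
    { replace (v p - v p - m / 2 * (p - p))%C with (RtoC 0) by ring. rewrite Cmod_0.
      apply Rmult_le_pos; [lra|apply Cmod_ge_0]. }
    rewrite Hvp, Hvn by auto. pose proof (sub_neq_0 _ _ Nw) as Nw0.
    set (k := fun x => (u x - l * (x - p) - m / 2 * ((x - p) * (x - p)))%C).
    set (dk := fun x => (C_derive u x - l - m * (x - p))%C).
    assert (Hk : Cmod (k w - k p - 0 * (w - p)) <= (eps * Cmod (w - p)) * Cmod (w - p)).
    { apply (cder_segment_bound k dk).
      - intros t Ht. unfold k, dk. eapply cder_eq.
        + apply cder_minus; [apply cder_minus|].
          * apply Hdu. exact (convex_disc p r p w t Hc Hw2 Ht).
          * apply cder_scal, cder_sub_const.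
          * apply cder_scal, cder_mult; apply cder_minus; (apply cder_id || apply cder_const).
        + cbv beta. field; apply two_neq_0.
      - intros t Ht. unfold dk. set (x := (p + t * (w - p))%C).
        assert (Hx : Cmod (x - p) <= Cmod (w - p)).
        { unfold x. replace (p + t * (w - p) - p)%C with (t * (w - p))%C by ring.
          rewrite Cmod_mult, Cmod_R, Rabs_right by lra. pose proof (Cmod_ge_0 (w - p)). nra. }
        replace (C_derive u x - l - m * (x - p) - 0)%C with (C_derive u x - l - m * (x - p))%C by ring.
        eapply Rle_trans; [apply K; lra|]. apply Rmult_le_compat_l; lra. }
    replace (u w / (w - p) - l - m / 2 * (w - p))%C with ((k w - k p - 0 * (w - p)) / (w - p))%C.
    2: { unfold k. rewrite Hp. field; repeat split; auto using two_neq_0. }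
    rewrite Cmod_div by auto. apply Cmod_gt_0 in Nw0.
    apply Rle_div_l; [lra|]. exact Hk.
  - destruct (Hu z Hz) as [m Hm]. eexists.
    pose proof (sub_neq_0 _ _ N) as N0. pose proof N0 as Np. apply Cmod_gt_0 in Np.
    apply cder_ext with (u := fun z => (u z * / (z - p))%C) (d := Cmod (z - p)); auto.
    + intros w Hw. symmetry. apply Hvn. intros ->. rewrite Cmod_sub_comm in Hw. lra.
    + apply cder_mult; [apply Hm|]. apply cder_inv; auto.
      apply cder_sub_const.
Qed.

(* The mean value bound is applied to [w] on a circle centred at [z], all of whose points
   are further away from [a] than [z] is. *)
Lemma infinite_order_zero (a : C) (d B : R) (u : C -> C) :
  (forall z, cdisc a d z -> Cmod (u z) <= B) ->
  (forall n, exists w, hol (cdisc a d) w /\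
     forall z, cdisc a d z -> u z = ((z - a) ^ n * w z)%C) ->
  forall z, Cmod (z - a) < d / 3 -> u z = 0%C.
Proof.
  intros HB H z Hz. pose proof (Cmod_ge_0 (z - a)) as Hx. set (x := Cmod (z - a)) in *.
  assert (Hd : 0 < d) by lra.
  (* For [x < d / 3] this radius satisfies both [r < d - x], which keeps the circle inside the disc,
     and [x < r - x], which makes the powers of the quotient decay. *)
  set (r := 2 * d / 3).
  assert (Hn : forall n, Cmod (u z) <= B * (x / (r - x)) ^ n).
  { intros n. destruct (H n) as [w [Hw E]].
    assert (Hza : cdisc a d z) by (unfold cdisc; fold x; lra).
    rewrite E, Cmod_mult, Cmod_pow by auto. fold x.
    assert (Cmod (w z) <= B / (r - x) ^ n).
    { apply (mean_value_bound w z (d - x) r); [unfold r; lra| |].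
      - eapply hol_sub; [|apply Hw]. intros v. apply cdisc_sub. fold x. lra.
      - intros v Hv. assert (Hva : cdisc a d v).
        { unfold cdisc. pose proof (Cmod_triangle3 v z a). fold x in H0. unfold r in Hv. lra. }
        assert (Hlow : r - x <= Cmod (v - a)).
        { pose proof (Cmod_triangle3 v a z). rewrite (Cmod_sub_comm a z) in H0. fold x in H0. lra. }
        assert (Hp : 0 < (r - x) ^ n) by (apply pow_lt; unfold r; lra).
        apply Rle_div_r; [exact Hp|].
        specialize (HB v Hva). rewrite E, Cmod_mult, Cmod_pow in HB by auto.
        eapply Rle_trans; [|apply HB]. rewrite Rmult_comm. apply Rmult_le_compat_r; [apply Cmod_ge_0|].
        apply pow_incr. unfold r in *; lra. }
    replace (B * (x / (r - x)) ^ n) with (x ^ n * (B / (r - x) ^ n)).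
    - apply Rmult_le_compat_l; auto. apply pow_le; auto.
    - unfold Rdiv. rewrite Rpow_mult_distr, pow_inv. ring. }
  assert (Hq : 0 <= x / (r - x) < 1).
  { assert (0 < r - x) by (unfold r; lra). split.
    - apply Rmult_le_pos; auto. left; apply Rinv_0_lt_compat; auto.
    - apply Rmult_lt_reg_r with (r - x); auto. unfold Rdiv.
      rewrite Rmult_assoc, Rinv_l by lra. unfold r; lra. }
  apply Cmod_eq_0. apply Rle_antisym; [|apply Cmod_ge_0].
  assert (HB0 : 0 <= B).
  { specialize (Hn 0%nat). simpl in Hn. pose proof (Cmod_ge_0 (u z)). lra. }
  apply (le_small _ B HB0). intros eps He.
  destruct (pow_lt_1_zero (x / (r - x))) with (y := eps) as [n Hn']; auto.
  { rewrite Rabs_right; lra. }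
  specialize (Hn' n (le_n n)). rewrite Rabs_right in Hn' by (apply Rle_ge, pow_le; lra).
  eapply Rle_trans; [apply (Hn n)|]. rewrite (Rmult_comm eps). apply Rmult_le_compat_l; lra.
Qed.

Lemma seg_near (a b : C) (t d : R) : 0 < d ->
  exists e, 0 < e /\ forall s, Rabs (s - t) < e -> Cmod (seg a b s - seg a b t) < d.
Proof.
  intros Hd. pose proof (Cmod_ge_0 (b - a)) as H.
  exists (d / (Cmod (b - a) + 1)). split; [apply Rdiv_lt_0_compat; lra|].
  intros s Hs. rewrite seg_sub, Cmod_mult, Cmod_R.
  pose proof (Rabs_pos (s - t)). apply lt_div_succ in Hs; lra.
Qed.

(** A function that vanishes near [q] is divisible by every power of [w - q], so
    [infinite_order_zero] applies in the disc of radius [9 * d / 10]. The resulting radius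
    [3 * d / 10] does not depend on [e], and this uniformity lets an identity spread along a
    segment. *)
Lemma zero_spreads (p q : C) (d e : R) (u : C -> C) : 0 < d ->
  hol (cdisc p d) u -> (forall z, cdisc p d z -> Cmod (u z - u p) <= 1) ->
  Cmod (q - p) < d / 10 -> 0 < e -> (forall z, cdisc q e z -> u z = 0%C) ->
  forall z, cdisc q (3 * d / 10) z -> u z = 0%C.
Proof.
  intros Hd Hu Hb Hq He Hz.
  assert (Hsub : forall z, cdisc q (9 * d / 10) z -> cdisc p d z).
  { intros z. apply cdisc_sub. lra. }
  intros z Hzq.
  apply (infinite_order_zero q (9 * d / 10) (Cmod (u p) + 1) u).
  - intros w Hw. replace (u w) with ((u w - u p) + u p)%C by ring.
    eapply Rle_trans; [apply Cmod_triangle|]. specialize (Hb w (Hsub w Hw)). lra.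
  - intros n. exists (fun w => (u w * / (w - q) ^ n)%C). split.
    + intros w Hw. destruct (classic (w = q)) as [->|N].
      * exists 0%C. apply cder_ext with (u := fun _ => 0%C) (d := e); auto; [|apply cder_const].
        intros w Hw'. rewrite Hz by auto. ring.
      * destruct (Hu w (Hsub w Hw)) as [m Hm]. destruct (cder_pow_sub q n w) as [l Hl].
        eexists. apply cder_mult; [apply Hm|]. apply cder_inv; [apply Hl|].
        apply Cpow_nz, sub_neq_0; auto.
    + intros w Hw. destruct (classic (w = q)) as [->|N].
      * rewrite Hz by (apply cdisc_center; auto). ring.
      * assert (((w - q) ^ n)%C <> 0%C) by (apply Cpow_nz, sub_neq_0; auto). field; auto.
  - unfold cdisc in Hzq. lra.
Qed.

(** Newton's iteration with fixed slope [l]: the hypothesis halves the residual at each step. As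
    [e < rho / 8], the iterates and their limit stay within [4 * e < rho / 2] of [c]. *)
Lemma approx_contraction_onto (u : C -> C) (c l w : C) (rho : R) : l <> 0%C ->
  (forall x y, cdisc c rho x -> cdisc c rho y ->
     Cmod (u x - u y - l * (x - y)) <= Cmod l / 2 * Cmod (x - y)) ->
  Cmod (w - u c) < Cmod l * rho / 8 ->
  exists x, cdisc c rho x /\ u x = w.
Proof.
  intros Hl0 H Hw. pose proof Hl0 as Hl. apply Cmod_gt_0 in Hl.
  set (e := Cmod (w - u c) / Cmod l).
  assert (He : 0 <= e).
  { apply Rmult_le_pos; [apply Cmod_ge_0|left; apply Rinv_0_lt_compat; auto]. }
  assert (Hle : Cmod l * e = Cmod (w - u c)) by (unfold e; field; lra).
  assert (Her : e < rho / 8).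
  { apply Rmult_lt_reg_l with (Cmod l); auto. lra. }
  set (x := fix x n := match n with O => c | S n => (x n + (w - u (x n)) / l)%C end).
  assert (Hpos : forall n, 0 < (1/2)^n) by (intros; apply pow_lt; lra).
  assert (HI : forall n, Cmod (x n - c) <= 2 * e * (1 - (1/2)^n) /\
     Cmod (w - u (x n)) <= Cmod l * e * (1/2)^n).
  { induction n as [|n [IH1 IH2]].
    - simpl. replace (c - c)%C with (RtoC 0) by ring. rewrite Cmod_0. lra.
    - assert (Hstep : Cmod (x (S n) - x n) <= e * (1/2)^n).
      { simpl. replace (x n + (w - u (x n)) / l - x n)%C with ((w - u (x n)) / l)%C by ring.
        rewrite Cmod_div by auto. apply Rle_div_l; [lra|]. lra. }
      assert (H1 : Cmod (x (S n) - c) <= 2 * e * (1 - (1/2)^(S n))).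
      { eapply Rle_trans; [apply (Cmod_triangle3 _ (x n))|]. simpl pow. lra. }
      split; auto.
      assert (D : forall m, Cmod (x m - c) <= 2 * e * (1 - (1/2)^m) -> cdisc c rho (x m)).
      { intros m Hm. unfold cdisc. specialize (Hpos m). nra. }
      specialize (H (x (S n)) (x n) (D _ H1) (D _ IH1)).
      replace (w - u (x (S n)))%C with (- (u (x (S n)) - u (x n) - l * (x (S n) - x n)))%C.
      + rewrite Cmod_opp. eapply Rle_trans; [apply H|]. simpl pow.
        replace (Cmod l * e * (1/2 * (1/2)^n)) with (Cmod l / 2 * (e * (1/2)^n)) by field.
        apply Rmult_le_compat_l; lra.
      + simpl. field; auto. }
  assert (D : forall n, cdisc c rho (x n)).
  { intros n. destruct (HI n) as [Hm _]. unfold cdisc. specialize (Hpos n). nra. }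
  destruct (geometric_limit x e) as [p Hp].
  { intros n. destruct (HI n) as [_ K]. simpl.
    replace (x n + (w - u (x n)) / l - x n)%C with ((w - u (x n)) / l)%C by ring.
    rewrite Cmod_div by auto. apply Rle_div_l; [lra|]. lra. }
  assert (Dp : cdisc c rho p).
  { specialize (Hp 0%nat). simpl in Hp. unfold cdisc. rewrite Cmod_sub_comm. lra. }
  exists p. split; auto. apply Cmod_sub_0. apply (le_small _ (7 * Cmod l * e)).
  { apply Rmult_le_pos; lra. }
  intros eps Heps. destruct (half_pow_small 1 eps Heps) as [n Hn].
  specialize (Hp n). destruct (HI n) as [_ K].
  pose proof (H (x n) p (D n) Dp) as Hx.
  replace (u p - w)%C with (- (u (x n) - u p - l * (x n - p)) + (- (l * (x n - p)) - (w - u (x n))))%C by ring.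
  eapply Rle_trans; [apply Cmod_triangle|]. rewrite Cmod_opp.
  assert (Cmod (- (l * (x n - p)) - (w - u (x n))) <= Cmod l * Cmod (x n - p) + Cmod (w - u (x n))).
  { unfold Cminus at 1. eapply Rle_trans; [apply Cmod_triangle|]. rewrite !Cmod_opp, Cmod_mult. lra. }
  assert (Cmod l * Cmod (x n - p) <= Cmod l * (4 * e * (1/2)^n)) by (apply Rmult_le_compat_l; lra).
  assert (Cmod l * e * (1/2)^n <= Cmod l * e * eps).
  { apply Rmult_le_compat_l; [apply Rmult_le_pos; lra|lra]. }
  lra.
Qed.

(** Continuity of the derivative, passed through the mean value inequality. The uniformity in both
    points is what the contraction asks for, and it also yields local Lipschitz bounds. *)
Lemma strictly_differentiable (D : C -> Prop) (u : C -> C) (a : C) :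
  open_domain D ->
  hol D u -> D a -> forall eps, 0 < eps -> exists rho, 0 < rho /\
    (forall x, cdisc a rho x -> D x) /\
    forall x y, cdisc a rho x -> cdisc a rho y ->
      Cmod (u x - u y - C_derive u a * (x - y)) <= eps * Cmod (x - y).
Proof.
  intros Hop Hu Ha eps He. destruct (Hop a Ha) as [r [Hr Hra]].
  destruct (hol_derive D u Hop Hu a Ha) as [m Hm].
  destruct (cder_ccont _ _ _ Hm eps He) as [d [Hd K]].
  exists (Rmin r d). split; [apply Rmin_pos; auto|].
  assert (HD : forall x, cdisc a (Rmin r d) x -> D x).
  { intros x Hx. apply Hra. eapply lt_min_l, Hx. }
  split; auto. intros x y Hx Hy.
  assert (Hs : forall t, 0 <= t <= 1 -> cdisc a (Rmin r d) (seg y x t)).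
  { intros t Ht. apply (convex_disc a _); auto. }
  apply (cder_segment_bound u (C_derive u)).
  - intros t Ht. apply (hol_C_derive D); [auto|apply HD, (Hs t Ht)].
  - intros t Ht. left. apply K. eapply lt_min_r, (Hs t Ht).
Qed.

Lemma locally_onto (D : C -> Prop) (u : C -> C) (a : C) :
  open_domain D ->
  hol D u -> D a -> C_derive u a <> 0%C ->
  forall eps, 0 < eps -> exists d, 0 < d /\
    forall w, Cmod (w - u a) < d -> exists x, D x /\ Cmod (x - a) < eps /\ u x = w.
Proof.
  intros Hop Hu Ha Hl eps He. pose proof Hl as Hl'. apply Cmod_gt_0 in Hl'.
  destruct (strictly_differentiable D u a Hop Hu Ha (Cmod (C_derive u a) / 2)) as [rho [Hrho [HD K]]]; [lra|].
  set (s := Rmin rho eps). assert (Hs : 0 < s) by (apply Rmin_pos; auto).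
  exists (Cmod (C_derive u a) * s / 8). split; [apply Rdiv_lt_0_compat; [apply Rmult_lt_0_compat|]; lra|].
  assert (Hsub : forall x, cdisc a s x -> cdisc a rho x).
  { intros x Hx. eapply lt_min_l, Hx. }
  intros w Hw. destruct (approx_contraction_onto u a (C_derive u a) w s Hl) as [x [Hx E]]; auto.
  exists x. repeat split; auto. eapply lt_min_r, Hx.
Qed.

(** Continuity of [k] is part of the conclusion: local surjectivity provides a preimage of [w] close
    to [z], and injectivity identifies it with [k w]. *)
Lemma inverse_cder (D E : C -> Prop) (u k : C -> C) :
  open_domain D ->
  open_domain E ->
  hol D u -> (forall z, D z -> C_derive u z <> 0%C) ->
  (forall x y, D x -> D y -> u x = u y -> x = y) ->
  (forall w, E w -> D (k w) /\ u (k w) = w) ->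
  forall w, E w -> cder k w (/ C_derive u (k w))%C.
Proof.
  intros HopD HopE Hu Hnz Hinj Hk w0 Hw0. destruct (Hk w0 Hw0) as [Hz Ez].
  set (z := k w0) in *. set (l := C_derive u z).
  assert (Hl0 : l <> 0%C) by (apply Hnz; auto).
  pose proof Hl0 as Hl. apply Cmod_gt_0 in Hl.
  intros eps He.
  set (e := Rmin (Cmod l / 2) (eps * (Cmod l * Cmod l) / 2)).
  assert (Hep : 0 < e).
  { apply Rmin_pos; [lra|]. apply Rdiv_lt_0_compat; [|lra]. repeat apply Rmult_lt_0_compat; auto. }
  assert (He1 : e <= Cmod l / 2) by le_min.
  assert (He2 : e <= eps * (Cmod l * Cmod l) / 2) by le_min.
  destruct (hol_C_derive D u z Hu Hz e Hep) as [d1 [Hd1 K1]]. fold l in K1.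
  destruct (locally_onto D u z HopD Hu Hz Hl0 d1 Hd1) as [d2 [Hd2 K2]].
  destruct (HopE w0 Hw0) as [d3 [Hd3 K3]].
  exists (Rmin d2 d3). split; [apply Rmin_pos; auto|]. intros w Hw.
  assert (Hw2 := lt_min_l _ _ _ Hw).
  assert (Hw3 := lt_min_r _ _ _ Hw).
  destruct (Hk w (K3 w Hw3)) as [Hkw Ekw].
  rewrite Ez in K2. destruct (K2 w Hw2) as [x [Hx [Hxz Ex]]].
  assert (x = k w) by (apply Hinj; auto; congruence). subst x.
  specialize (K1 _ Hxz). rewrite Ekw, Ez in K1. set (x := k w) in *. fold z l.
  set (X := Cmod (x - z)) in *. set (W := Cmod (w - w0)) in *.
  assert (HXW : X <= 2 * W / Cmod l).
  { assert (Cmod l * X <= W + e * X).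
    { unfold X at 1. rewrite <- Cmod_mult.
      replace (l * (x - z))%C with ((w - w0) + - (w - w0 - l * (x - z)))%C by ring.
      eapply Rle_trans; [apply Cmod_triangle|]. rewrite Cmod_opp. fold W. lra. }
    assert (0 <= X) by apply Cmod_ge_0.
    apply Rle_div_r; [lra|]. nra. }
  replace (x - z - / l * (w - w0))%C with (- (w - w0 - l * (x - z)) / l)%C by (field; auto).
  rewrite Cmod_div, Cmod_opp by auto.
  apply Rle_div_l; [lra|].
  eapply Rle_trans; [apply K1|].
  assert (0 <= W) by apply Cmod_ge_0.
  apply Rle_trans with (e * (2 * W / Cmod l)); [apply Rmult_le_compat_l; lra|].
  apply Rle_trans with (eps * (Cmod l * Cmod l) / 2 * (2 * W / Cmod l)).
  - apply Rmult_le_compat_r; auto. apply Rmult_le_pos; [lra|left; apply Rinv_0_lt_compat; auto].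
  - right. field. lra.
Qed.

(** * Univalent functions on a disc *)

Definition inj_on (D : C -> Prop) (u : C -> C) : Prop :=
  forall x y, D x -> D y -> u x = u y -> x = y.

Definition covers (D : C -> Prop) (g : C -> C) (w0 : C) (rho : R) : Prop :=
  forall w, cdisc w0 rho w -> exists x, D x /\ g x = w.

Lemma covers_inverse (D : C -> Prop) (g : C -> C) (w0 : C) (rho : R) :
  open_domain D ->
  hol D g -> inj_on D g -> (forall z, D z -> C_derive g z <> 0%C) ->
  covers D g w0 rho ->
  exists k, forall w, cdisc w0 rho w ->
    D (k w) /\ g (k w) = w /\ cder k w (/ C_derive g (k w))%C.
Proof.
  intros HD Hg Hinj Hnz Hcov.
  set (k := fun w => epsilon (inhabits (RtoC 0)) (fun x => D x /\ g x = w)).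
  assert (Hk : forall w, cdisc w0 rho w -> D (k w) /\ g (k w) = w).
  { intros w Hw. apply (epsilon_spec (inhabits (RtoC 0)) (fun x => D x /\ g x = w)). auto. }
  exists k. intros w Hw. destruct (Hk w Hw) as [H1 H2]. repeat split; auto.
  apply (inverse_cder D (cdisc w0 rho) g k); auto. apply cdisc_open.
Qed.

(** Cauchy estimate for the inverse of [g], which maps a disc of radius [rho] into one of radius
    [r]. *)
Lemma covers_radius (g : C -> C) (c : C) (r rho : R) : 0 < r -> 0 < rho ->
  hol (cdisc c r) g -> inj_on (cdisc c r) g ->
  (forall z, cdisc c r z -> C_derive g z <> 0%C) ->
  covers (cdisc c r) g (g c) rho -> rho <= 2 * r * Cmod (C_derive g c).
Proof.
  intros Hr Hrho Hg Hinj Hnz Hcov.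
  destruct (covers_inverse _ g (g c) rho (cdisc_open c r) Hg Hinj Hnz Hcov) as [k Hk].
  assert (Hc : cdisc c r c) by (apply cdisc_center; auto).
  assert (Hw : cdisc (g c) rho (g c)) by (apply cdisc_center; auto).
  destruct (Hk _ Hw) as [K1 [K2 K3]].
  assert (E : k (g c) = c) by (apply Hinj; auto). rewrite E in K3.
  assert (HN := Hnz c Hc). pose proof HN as HN'. apply Cmod_gt_0 in HN'.
  assert (B : Cmod (/ C_derive g c) <= 2 * r / rho).
  { apply (cauchy_estimate_sup k (g c) c); auto.
    - intros w Hw'. destruct (Hk w Hw') as [_ [_ K]]. eexists; apply K.
    - intros w Hw'. destruct (Hk w Hw') as [K _]. left; exact K. }
  rewrite Cmod_inv in B by auto.
  apply Rmult_le_compat_r with (r := rho * Cmod (C_derive g c)) in B.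
  2: { left; apply Rmult_lt_0_compat; auto. }
  replace (/ Cmod (C_derive g c) * (rho * Cmod (C_derive g c))) with rho in B by (field; lra).
  replace (2 * r / rho * (rho * Cmod (C_derive g c))) with (2 * r * Cmod (C_derive g c)) in B by (field; lra).
  exact B.
Qed.

(* The largest covered disc, up to a factor 2. *)
Lemma omitted_near (g : C -> C) (c : C) (r : R) : 0 < r ->
  hol (cdisc c r) g -> inj_on (cdisc c r) g ->
  (forall z, cdisc c r z -> C_derive g z <> 0%C) ->
  exists rho a, 0 < rho /\ covers (cdisc c r) g (g c) rho /\
    Cmod (a - g c) < 2 * rho /\ forall x, cdisc c r x -> g x <> a.
Proof.
  intros Hr Hg Hinj Hnz. assert (Hc : cdisc c r c) by (apply cdisc_center; auto).
  destruct (locally_onto _ g c (cdisc_open c r) Hg Hc (Hnz c Hc) 1 Rlt_0_1) as [d [Hd K]].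
  assert (H0 : covers (cdisc c r) g (g c) d).
  { intros w Hw. destruct (K w Hw) as [x [Hx [_ E]]]. eauto. }
  apply NNPP. intros N.
  (* If no such pair existed, every covered radius could be doubled, against the bound of
     [covers_radius]. *)
  assert (Hstep : forall rho, 0 < rho -> covers (cdisc c r) g (g c) rho ->
    covers (cdisc c r) g (g c) (2 * rho)).
  { intros rho Hrho Hcov a Ha. apply NNPP. intros Na. apply N.
    exists rho, a. repeat split; auto. intros x Hx E. apply Na. eauto. }
  assert (Hall : forall n, 0 < d * 2 ^ n /\ covers (cdisc c r) g (g c) (d * 2 ^ n)).
  { induction n as [|n [IH1 IH2]].
    - simpl. rewrite Rmult_1_r. auto.
    - simpl. replace (d * (2 * 2 ^ n)) with (2 * (d * 2 ^ n)) by ring. split; [lra|auto]. }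
  set (M := 2 * r * Cmod (C_derive g c)).
  destruct (half_pow_small (M + 1) d Hd) as [n Hn].
  destruct (Hall n) as [P1 P2].
  pose proof (covers_radius g c r _ Hr P1 Hg Hinj Hnz P2) as B. fold M in B.
  assert (E : (1/2)^n * 2^n = 1).
  { rewrite <- Rpow_mult_distr. replace (1/2*2) with 1 by field. apply pow1. }
  assert (0 < 2 ^ n) by (apply pow_lt; lra). nra.
Qed.

(* If [ps] came close to [-1] then its square would be attained near [1] as well. *)
Lemma square_root_avoids (D : C -> Prop) (G ps : C -> C) (c x : C) :
  open_domain D ->
  hol D G -> inj_on D G -> (forall z, D z -> C_derive G z <> 0%C) ->
  hol D ps -> (forall z, D z -> (ps z * ps z = 1 - G z)%C) ->
  D c -> G c = 0%C -> ps c = 1%C -> covers D G 0 (1 / 2) ->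
  D x -> 1 / 8 <= Cmod (ps x + 1).
Proof.
  intros HD HG Hinj Hnz Hps Hsq Hc HGc Hpc Hcov Hx.
  apply Rnot_lt_le. intros Hlt.
  assert (HGx : Cmod (G x) < 1 / 2).
  { set (e := (ps x + 1)%C) in *.
    replace (G x) with (e * (2 - e))%C.
    - rewrite Cmod_mult. pose proof (Cmod_triangle 2 (- e)) as T.
      rewrite Cmod_opp, Cmod_R, Rabs_right in T by lra. pose proof (Cmod_ge_0 e).
      fold (2 - e)%C in T. nra.
    - specialize (Hsq x Hx). replace (G x) with (1 - (1 - G x))%C by ring.
      rewrite <- Hsq. unfold e. ring. }
  destruct (covers_inverse D G 0 (1/2) HD HG Hinj Hnz Hcov) as [k Hk].
  assert (Hin : forall t, 0 <= t <= 1 -> cdisc 0 (1/2) (seg 0 (G x) t)).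
  { intros t Ht. unfold cdisc, seg. replace (0 + t * (G x - 0) - 0)%C with (t * G x)%C by ring.
    rewrite Cmod_mult, Cmod_R, Rabs_right by lra. pose proof (Cmod_ge_0 (G x)). nra. }
  set (y := fun w => ps (k w)).
  (* The square [1 - w] of [y w] has positive real part, so [y w] is never purely imaginary. As [y]
     is 1 at 0, its real part stays positive along the segment to [G x], where [y] is [ps x]; this
     contradicts [ps x] being close to [-1]. *)
  assert (Hre : forall w, cdisc 0 (1/2) w -> Re (y w) <> 0).
  { intros w Hw E. destruct (Hk w Hw) as [K1 [K2 _]]. specialize (Hsq _ K1). rewrite K2 in Hsq.
    fold (y w) in Hsq. assert (E' : Re (y w * y w) = Re (1 - w)) by (rewrite Hsq; auto).
    rewrite re_mult, E in E'. replace (Re (1 - w)) with (1 - Re w) in E' by reflexivity.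
    unfold cdisc in Hw. replace (w - 0)%C with w in Hw by ring.
    pose proof (re_le_Cmod w) as R1. apply Rabs_le_between in R1. nra. }
  assert (Hpos : 0 < Re (y (seg 0 (G x) 1))).
  { apply (unit_interval_constant (fun t => 0 < Re (y (seg 0 (G x) t)))); [| |lra].
    - intros t Ht. set (p := seg 0 (G x) t). specialize (Hin t Ht). fold p in Hin.
      destruct (Hk p Hin) as [K1 [_ K3]]. destruct (Hps _ K1) as [m Hm].
      assert (Hy : cder y p (/ C_derive G (k p) * m)%C) by (apply (cder_comp ps k); auto).
      assert (Ha : 0 < Rabs (Re (y p))) by (apply Rabs_pos_lt, Hre; auto).
      destruct (cder_ccont _ _ _ Hy _ Ha) as [d [Hd Kd]].
      destruct (seg_near 0 (G x) t d Hd) as [e [He Ke]].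
      exists e. split; auto. intros s s' _ _ Hs Hs'.
      assert (Hsgn : forall s, Rabs (s - t) < e -> Rabs (Re (y (seg 0 (G x) s)) - Re (y p)) < Rabs (Re (y p))).
      { intros q Hq. eapply Rle_lt_trans; [|apply (Kd _ (Ke q Hq))].
        apply (re_le_Cmod (y (seg 0 (G x) q) - y p)). }
      pose proof (Hsgn s Hs) as S1. pose proof (Hsgn s' Hs') as S2.
      intros Hp0. destruct (Rle_or_lt 0 (Re (y p))) as [L|L].
      + rewrite (Rabs_right (Re (y p))) in S2 by lra. apply Rabs_lt_between in S2. lra.
      + rewrite (Rabs_left (Re (y p))) in S1 by lra. apply Rabs_lt_between in S1. lra.
    - rewrite seg_0. destruct (Hk 0%C) as [K1 [K2 _]]; [apply cdisc_center; lra|].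
      unfold y. replace (k 0%C) with c by (apply Hinj; auto; congruence). rewrite Hpc. simpl. lra. }
  rewrite seg_1 in Hpos.
  destruct (Hk (G x)) as [K1 [K2 _]].
  { unfold cdisc. replace (G x - 0)%C with (G x) by ring. auto. }
  unfold y in Hpos. replace (k (G x)) with x in Hpos by (apply Hinj; auto).
  pose proof (re_le_Cmod (ps x + 1)) as R1. apply Rabs_le_between in R1.
  change (Re (ps x + 1)) with (Re (ps x) + 1) in R1. lra.
Qed.

(** The function [B = 1 / (1 + ps)] is bounded by 8, so its derivative is at most [32 / r] on the
    half-size disc and [B] moves by at most [1 / 4] from [B c = 1 / 2] within distance [r / 128].
    There [|1 + ps| <= 4] and hence [|G| <= 24]. The constant 96 is [24 * 2 * 2]: the omitted value
    is closer than [2 * rho] to [g c], and [covers_radius] bounds [rho] by [2 * r * |g' c|]. *)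
Lemma univalent_growth (g : C -> C) (c : C) (r : R) : 0 < r ->
  hol (cdisc c r) g -> inj_on (cdisc c r) g ->
  (forall z, cdisc c r z -> C_derive g z <> 0%C) ->
  forall x, cdisc c (r / 128) x -> Cmod (g x - g c) <= 96 * r * Cmod (C_derive g c).
Proof.
  intros Hr Hg Hinj Hnz. set (D := cdisc c r) in *.
  assert (Hc : D c) by (apply cdisc_center; auto).
  destruct (omitted_near g c r Hr Hg Hinj Hnz) as [rho [a [Hrho [Hcov [Ha Hom]]]]].
  fold D in Hcov, Hom.
  set (b := (a - g c)%C) in *.
  assert (Hb0 : b <> 0%C) by (apply sub_neq_0; intros E; apply (Hom c Hc); auto).
  assert (Hb : rho <= Cmod b).
  { apply Rnot_lt_le. intros L. destruct (Hcov a L) as [x [Hx E]]. exact (Hom x Hx E). }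
  set (G := fun x => ((g x - g c) * / b)%C).
  assert (HGd : forall z, D z -> cder G z (C_derive g z * / b)%C).
  { intros z Hz. unfold G. eapply cder_eq.
    - apply cder_mult; [|apply cder_const]. apply cder_minus; [|apply cder_const].
      apply (hol_C_derive D); auto.
    - cbv beta. ring. }
  assert (HG : hol D G) by (intros z Hz; eexists; apply HGd; auto).
  set (g1 := fun x => (1 - G x)%C).
  assert (Hg1 : hol D g1).
  { intros z Hz. eexists. apply cder_minus; [apply cder_const|apply HGd; auto]. }
  assert (Hg1n : forall z, D z -> g1 z <> 0%C).
  { intros z Hz. unfold g1, G. replace (1 - (g z - g c) * / b)%C with ((a - g z) / b)%C.
    - unfold Cdiv. apply Cmult_neq_0.
      + apply sub_neq_0. intros E; apply (Hom z Hz); auto.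
      + intros E. apply (Cmult_neq_0 b (/ b)); auto. 2: rewrite E; ring.
        intros E2. assert (E3 : (b * / b)%C = RtoC 1) by (field; auto).
        rewrite E2 in E3. replace (b * 0)%C with (RtoC 0) in E3 by ring.
        apply RtoC_inj in E3. lra.
    - unfold b. field. auto. }
  destruct (good_domain_log D g1 c (good_disc c r) Hc Hg1 Hg1n) as [h Hh].
  assert (HGc : G c = 0%C) by (unfold G; ring).
  set (ps := fun z => Cexp (/ 2 * (h z - h c))%C).
  assert (Hsq : forall z, D z -> (ps z * ps z = 1 - G z)%C).
  { intros z Hz. unfold ps. rewrite <- Cexp_plus.
    replace (/ 2 * (h z - h c) + / 2 * (h z - h c))%C with (h z + - h c)%C by (field; apply two_neq_0).
    rewrite Cexp_plus, Cexp_opp. rewrite (proj1 (Hh z Hz)), (proj1 (Hh c Hc)).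
    unfold g1. rewrite HGc. field. }
  assert (Hpsh : hol D ps).
  { intros z Hz. eexists. apply cder_Cexp_comp. apply cder_scal, cder_minus; [|apply cder_const].
    apply (Hh z Hz). }
  assert (Hpsc : ps c = 1%C).
  { unfold ps. replace (/ 2 * (h c - h c))%C with (RtoC 0) by ring. apply Cexp_0. }
  assert (Hbpos : 0 < Cmod b) by lra.
  assert (Hinv0 : (/ b)%C <> 0%C).
  { apply Cmod_gt_0. rewrite Cmod_inv by auto. apply Rinv_0_lt_compat; auto. }
  assert (Havoid : forall x, D x -> 1 / 8 <= Cmod (ps x + 1)).
  { intros x Hx. apply (square_root_avoids D G ps c x); auto.
    - apply cdisc_open.
    - intros y z Hy Hz E. apply Hinj; auto.
      assert (E' : (G y * b = G z * b)%C) by (rewrite E; auto). unfold G in E'.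
      replace (g y) with ((g y - g c) * / b * b + g c)%C by (field; auto). rewrite E'. field; auto.
    - intros z Hz. rewrite (C_derive_eq _ _ _ (HGd z Hz)). apply Cmult_neq_0; auto.
    - intros w Hw. destruct (Hcov (g c + b * w)%C) as [y [Hy E]].
      + unfold cdisc in *. replace (g c + b * w - g c)%C with (b * w)%C by ring.
        replace (w - 0)%C with w in Hw by ring. rewrite Cmod_mult.
        pose proof (Cmod_ge_0 w). nra.
      + exists y. split; auto. unfold G. rewrite E. field; auto. }
  assert (Hps0 : forall x, D x -> (ps x + 1)%C <> 0%C).
  { intros x Hx. apply Cmod_gt_0. specialize (Havoid x Hx). lra. }
  set (B := fun x => (/ (ps x + 1))%C).
  assert (HB : hol D B).
  { intros z Hz. destruct (Hpsh z Hz) as [m Hm]. eexists. apply cder_inv; auto.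
    apply cder_plus; [apply Hm|apply cder_const]. }
  assert (HB8 : forall x, D x -> Cmod (B x) <= 8).
  { intros x Hx. unfold B. rewrite Cmod_inv by auto. specialize (Havoid x Hx).
    replace 8 with (/ (1/8)) by field. apply Rinv_le_contravar; lra. }
  assert (HdB : forall x, cdisc c (r / 2) x -> Cmod (C_derive B x) <= 32 / r).
  { intros x Hx.
    assert (Hsub : forall w, cdisc x (r / 2) w -> D w).
    { intros w. apply cdisc_sub. unfold cdisc in Hx. lra. }
    replace (32 / r) with (2 * 8 / (r / 2)) by (field; lra).
    apply (cauchy_estimate_sup B x 0); [lra| | |].
    - eapply hol_sub; [apply Hsub|auto].
    - apply (hol_C_derive D); auto. apply Hsub, cdisc_center; lra.
    - intros w Hw. replace (B w - 0)%C with (B w) by ring. auto. }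
  intros x Hx.
  assert (Hxs : forall t, 0 <= t <= 1 -> cdisc c (r / 2) (seg c x t)).
  { intros t Ht. pose proof (convex_disc c (r / 128) c x t) as K.
    assert (Hcc : cdisc c (r / 128) c) by (apply cdisc_center; lra).
    specialize (K Hcc Hx Ht). unfold cdisc in *. lra. }
  assert (HDx : D x) by (unfold D; unfold cdisc in *; lra).
  assert (HBx : Cmod (B x - B c) <= 1 / 4).
  { replace (B x - B c)%C with (B x - B c - 0 * (x - c))%C by ring.
    eapply Rle_trans.
    - apply (cder_segment_bound B (C_derive B) c x 0 (32 / r)).
      + intros t Ht. apply (hol_C_derive D); auto. specialize (Hxs t Ht). unfold D, seg in *.
        unfold cdisc in *. lra.
      + intros t Ht. replace (C_derive B (c + t * (x - c)) - 0)%C with (C_derive B (seg c x t))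
          by (unfold seg; ring). auto.
    - unfold cdisc in Hx. apply Rle_trans with (32 / r * (r / 128)).
      + apply Rmult_le_compat_l; [left; apply Rdiv_lt_0_compat|]; lra.
      + right. field. lra. }
  assert (HBc : B c = RtoC (1 / 2)).
  { unfold B. rewrite Hpsc, <- RtoC_plus, <- RtoC_inv by lra. f_equal. field. }
  assert (HBlow : 1 / 4 <= Cmod (B x)).
  { rewrite HBc in HBx. rewrite Cmod_sub_comm in HBx. pose proof (Cmod_sub_ge (1/2)%R (B x)) as K.
    rewrite Cmod_R, Rabs_right in K by lra. lra. }
  assert (Hps4 : Cmod (ps x + 1) <= 4).
  { unfold B in HBlow. rewrite Cmod_inv in HBlow by auto.
    assert (P : 0 < Cmod (ps x + 1)) by (apply Cmod_gt_0; auto).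
    apply Rmult_le_compat_r with (r := Cmod (ps x + 1)) in HBlow; [|lra].
    rewrite Rinv_l in HBlow by lra. lra. }
  assert (HG24 : Cmod (G x) <= 24).
  { replace (G x) with ((ps x + 1) * (2 - (ps x + 1)))%C.
    - rewrite Cmod_mult. pose proof (Cmod_triangle 2 (- (ps x + 1))) as T.
      rewrite Cmod_opp, Cmod_R, Rabs_right in T by lra. fold (2 - (ps x + 1))%C in T.
      pose proof (Cmod_ge_0 (ps x + 1)). pose proof (Cmod_ge_0 (2 - (ps x + 1))%C). nra.
    - replace (G x) with (1 - (1 - G x))%C by ring. rewrite <- Hsq by auto. ring. }
  pose proof (covers_radius g c r rho Hr Hrho Hg Hinj Hnz Hcov) as Hrad.
  replace (g x - g c)%C with (G x * b)%C by (unfold G; field; auto).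
  rewrite Cmod_mult. pose proof (Cmod_ge_0 (G x)). nra.
Qed.

(* This is [2 * 49152 * 256]; the sharp constant is 4. *)
Definition koebe_const : R := 25165824.

(** Two Cauchy estimates of radius [r / 256] inside the disc of radius [r / 128] on which the growth
    bound holds; [49152 = 2 * 96 * 256]. *)
Lemma univalent_second_derivative (g : C -> C) (c : C) (r : R) : 0 < r ->
  hol (cdisc c r) g -> inj_on (cdisc c r) g ->
  (forall z, cdisc c r z -> C_derive g z <> 0%C) ->
  Cmod (C_derive (C_derive g) c) <= koebe_const / r * Cmod (C_derive g c).
Proof.
  intros Hr Hg Hinj Hnz.
  pose proof (univalent_growth g c r Hr Hg Hinj Hnz) as Hgr.
  set (m := Cmod (C_derive g c)) in *.
  assert (H1 : forall x, cdisc c (r / 256) x -> Cmod (C_derive g x) <= 49152 * m).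
  { intros x Hx.
    assert (Hsub : forall w, cdisc x (r / 256) w -> cdisc c (r / 128) w).
    { intros w. apply cdisc_sub. unfold cdisc in Hx. lra. }
    replace (49152 * m) with (2 * (96 * r * m) / (r / 256)) by (field; lra).
    apply (cauchy_estimate_sup g x (g c)); [lra| | |].
    - eapply hol_sub; [|apply Hg]. intros w Hw. specialize (Hsub w Hw). unfold cdisc in *; lra.
    - apply (hol_C_derive (cdisc c r)); auto. unfold cdisc in *; lra.
    - intros w Hw. auto. }
  replace (koebe_const / r * m) with (2 * (49152 * m) / (r / 256)) by (unfold koebe_const; field; lra).
  pose proof (hol_derive _ g (cdisc_open c r) Hg) as Hg'.
  apply (cauchy_estimate_sup (C_derive g) c 0); [lra| | |].
  - eapply hol_sub; [|apply Hg']. intros w Hw. unfold cdisc in *; lra.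
  - apply (hol_C_derive (cdisc c r)); auto. apply cdisc_center; auto.
  - intros w Hw. replace (C_derive g w - 0)%C with (C_derive g w) by ring. auto.
Qed.

Lemma cder_C_derive_ext (D : C -> Prop) (u v : C -> C) (z l : C) :
  open_domain D -> D z ->
  (forall w, D w -> cder u w (v w)) -> cder v z l -> C_derive (C_derive u) z = l.
Proof.
  intros HD Hz Hu Hv. apply C_derive_eq. destruct (HD z Hz) as [r [Hr K]].
  apply cder_ext with (u := v) (d := r); auto.
  intros w Hw. symmetry. apply C_derive_eq. auto.
Qed.

(* Compare the second derivatives of [g] and of [1 / (g - p)]. *)
Lemma univalent_omitted_value (g : C -> C) (c p : C) (r : R) : 0 < r ->
  hol (cdisc c r) g -> inj_on (cdisc c r) g ->
  (forall z, cdisc c r z -> C_derive g z <> 0%C) ->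
  (forall z, cdisc c r z -> g z <> p) ->
  Cmod (C_derive g c) <= koebe_const / r * Cmod (g c - p).
Proof.
  intros Hr Hg Hinj Hnz Hp. set (D := cdisc c r) in *.
  assert (Hc : D c) by (apply cdisc_center; auto).
  pose proof (univalent_second_derivative g c r Hr Hg Hinj Hnz) as H1.
  set (k := fun z => (/ (g z - p))%C).
  assert (Hgp : forall z, D z -> (g z - p)%C <> 0%C) by (intros z Hz; apply sub_neq_0; auto).
  assert (Hg' : forall z, D z -> cder g z (C_derive g z)) by (intros; apply (hol_C_derive D); auto).
  set (dk := fun z => (- C_derive g z * / ((g z - p) * (g z - p)))%C).
  assert (Hk : forall z, D z -> cder k z (dk z)).
  { intros z Hz. unfold k. eapply cder_eq.
    - apply cder_inv; auto. apply cder_minus; [apply Hg'; auto|apply cder_const].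
    - unfold dk. field. auto. }
  assert (Hdk : forall z, D z -> C_derive k z = dk z) by (intros; apply C_derive_eq; auto).
  pose proof (hol_derive _ g (cdisc_open c r) Hg) as Hgg.
  set (g2 := C_derive (C_derive g) c) in *. set (g1 := C_derive g c) in *. set (g0 := (g c - p)%C) in *.
  assert (Hg0 : g0 <> 0%C) by (apply Hgp; auto).
  assert (Hk2 : C_derive (C_derive k) c = (- g2 / (g0 * g0) + 2 * g1 * g1 / (g0 * g0 * g0))%C).
  { apply (cder_C_derive_ext D k dk); auto; [apply cdisc_open|]. unfold dk. eapply cder_eq.
    - apply cder_mult.
      + apply cder_opp. apply (hol_C_derive D); auto.
      + apply cder_inv; [|apply Cmult_neq_0; auto].
        apply cder_mult; apply cder_minus; (apply Hg'; auto) || apply cder_const.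
    - cbv beta. fold g0 g1 g2. field. auto. }
  assert (H2 : Cmod (C_derive (C_derive k) c) <= koebe_const / r * Cmod (C_derive k c)).
  { apply univalent_second_derivative; auto.
    - intros z Hz. eexists; apply Hk; auto.
    - intros x y Hx Hy E. apply Hinj; auto. unfold k in E.
      replace (g x) with ((g x - p) * / (g y - p) * (g y - p) + p)%C by (field; auto).
      rewrite <- E. field. auto.
    - intros z Hz. rewrite Hdk by auto. unfold dk.
      assert (Cmult_ok : (C_derive g z) <> 0%C) by (apply Hnz; auto).
      intros E. apply Cmult_ok.
      replace (C_derive g z) with (- (- C_derive g z * / ((g z - p) * (g z - p))) * ((g z - p) * (g z - p)))%C.
      + rewrite E. ring.
      + field. auto. }
  rewrite Hk2, Hdk in H2 by auto. unfold dk in H2. fold g0 g1 in H2.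
  assert (Hgn : g1 <> 0%C) by (apply Hnz; auto).
  set (K := koebe_const / r) in *.
  pose proof Hg0 as Pg0. apply Cmod_gt_0 in Pg0. pose proof Hgn as Pg1. apply Cmod_gt_0 in Pg1.
  assert (H3 : Cmod (- g2 * g0 + 2 * g1 * g1) <= K * Cmod g1 * Cmod g0).
  { replace (- g2 / (g0 * g0) + 2 * g1 * g1 / (g0 * g0 * g0))%C
      with ((- g2 * g0 + 2 * g1 * g1) / (g0 * g0 * g0))%C in H2 by (field; auto).
    rewrite Cmod_div in H2 by (repeat apply Cmult_neq_0; auto).
    rewrite (Cmod_mult (- g1)), Cmod_opp, Cmod_inv, !Cmod_mult in H2 by (repeat apply Cmult_neq_0; auto).
    apply Rmult_le_compat_r with (r := Cmod g0 * Cmod g0 * Cmod g0) in H2.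
    2: { left; repeat apply Rmult_lt_0_compat; auto. }
    unfold Rdiv in H2. rewrite Rmult_assoc, Rinv_l, Rmult_1_r in H2.
    2: { apply Rgt_not_eq; repeat apply Rmult_lt_0_compat; auto. }
    replace (K * Cmod g1 * Cmod g0) with
      (K * (Cmod g1 * / (Cmod g0 * Cmod g0)) * (Cmod g0 * Cmod g0 * Cmod g0)) by (field; lra).
    exact H2. }
  (* The term in [g2] is absorbed by the bound [H1] for [g] itself; dividing by [2 * Cmod g1] leaves
     the claim. *)
  assert (H4 : Cmod (2 * g1 * g1) <= 2 * (K * Cmod g1 * Cmod g0)).
  { replace (2 * g1 * g1)%C with ((- g2 * g0 + 2 * g1 * g1) + g2 * g0)%C by ring.
    eapply Rle_trans; [apply Cmod_triangle|]. rewrite Cmod_mult. nra. }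
  rewrite !Cmod_mult, Cmod_R, Rabs_right in H4 by lra. nra.
Qed.

(** * Continuation and behaviour at infinity of the inverse branch *)

Lemma Cmod_sqr (z : C) : Cmod z * Cmod z = Re z * Re z + Im z * Im z.
Proof. pose proof (Cmod2_alt z). simpl in H. lra. Qed.

Lemma exp_nondecreasing (x y : R) : x <= y -> exp x <= exp y.
Proof.
  intros [H| ->]; [left; apply exp_increasing; auto|right; auto].
Qed.

(** The squared modulus [q] is differentiable even at zeros of [g], and [|q'| <= 2 c q] makes
    [q e^(-2ct)] decrease and [q e^(2ct)] increase. The second inequality limits how fast the
    modulus can shrink and gives uniqueness of solutions backwards in time. *)
Lemma gronwall (g dg : R -> C) (c a b : R) : a <= b ->
  (forall t, a <= t <= b -> rder g t (dg t)) ->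
  (forall t, a <= t <= b -> Cmod (dg t) <= c * Cmod (g t)) ->
  Cmod (g b) <= Cmod (g a) * exp (c * (b - a)) /\
  Cmod (g a) <= Cmod (g b) * exp (c * (b - a)).
Proof.
  intros Hab Hd Hc.
  set (q := fun t => Re (1 * g t) * Re (1 * g t) + Re (- Ci * g t) * Re (- Ci * g t)).
  set (dq := fun t => 2 * (Re (1 * dg t) * Re (1 * g t) + Re (- Ci * dg t) * Re (- Ci * g t))).
  assert (Hq : forall t, q t = Cmod (g t) * Cmod (g t)).
  { intros t. rewrite Cmod_sqr. unfold q, Re, Im; simpl. ring. }
  assert (Hqd : forall t, a <= t <= b -> is_derive q t (dq t)).
  { intros t Ht. unfold q, dq. specialize (Hd t Ht).
    pose proof (rder_re g t (dg t) 1 Hd) as R1. pose proof (rder_re g t (dg t) (- Ci) Hd) as R2.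
    evar_last.
    - apply @is_derive_plus.
      + apply (is_derive_mult (K := R_AbsRing) (fun t => Re (1 * g t)) (fun t => Re (1 * g t)));
          [exact R1|exact R1|exact Rmult_comm].
      + apply (is_derive_mult (K := R_AbsRing) (fun t => Re (- Ci * g t)) (fun t => Re (- Ci * g t)));
          [exact R2|exact R2|exact Rmult_comm].
    - unfold plus, mult; simpl. unfold Re, Im; simpl. ring. }
  assert (Hqb : forall t, a <= t <= b -> Rabs (dq t) <= 2 * c * q t).
  { intros t Ht. replace (dq t) with (2 * Re (Cconj (g t) * dg t)) by (unfold dq, Re, Im; simpl; ring).
    rewrite Rabs_mult, (Rabs_right 2) by lra.
    pose proof (re_le_Cmod (Cconj (g t) * dg t)) as K. rewrite Cmod_mult, Cmod_conj in K.
    rewrite Hq. specialize (Hc t Ht). pose proof (Cmod_ge_0 (g t)). nra. }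
  assert (Hsq : forall x y e, 0 <= x -> 0 <= y -> 0 < e -> x * x <= y * y * (e * e) -> x <= y * e).
  { intros x y e Hx Hy He H. apply Rnot_lt_le. intros L.
    assert (0 <= y * e) by (apply Rmult_le_pos; lra). nra. }
  assert (Hexp : exp (2 * c * (b - a)) = exp (c * (b - a)) * exp (c * (b - a))).
  { rewrite <- exp_plus. f_equal. ring. }
  assert (HE : forall k t, is_derive (fun t => exp (k * t)) t (k * exp (k * t))).
  { intros k t. auto_derive; auto. ring. }
  split; (apply Hsq; [apply Cmod_ge_0|apply Cmod_ge_0|apply exp_pos|]); rewrite <- !Hq, <- Hexp.
  - assert (K : - (q a * exp (- (2 * c) * a)) <= - (q b * exp (- (2 * c) * b))).
    { apply (is_derive_nonneg_le (fun t => - (q t * exp (- (2 * c) * t)))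
        (fun t => - (dq t * exp (- (2 * c) * t) + q t * (- (2 * c) * exp (- (2 * c) * t))))); auto.
      - intros t Ht. apply (is_derive_opp (V := R_NormedModule) (fun t => q t * exp (- (2 * c) * t))).
        apply (is_derive_mult (K := R_AbsRing) q (fun t => exp (- (2 * c) * t)));
          [apply Hqd; auto|apply HE|exact Rmult_comm].
      - intros t Ht. specialize (Hqb t Ht). apply Rabs_le_between in Hqb.
        pose proof (exp_pos (- (2 * c) * t)). nra. }
    replace (exp (2 * c * (b - a))) with (exp (- (2 * c) * a) * / exp (- (2 * c) * b)).
    + pose proof (exp_pos (- (2 * c) * b)) as P.
      apply Rmult_le_reg_r with (exp (- (2 * c) * b)); auto.
      rewrite <- Rmult_assoc, (Rmult_assoc _ (/ _)), Rinv_l by lra. lra.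
    + rewrite <- exp_Ropp, <- exp_plus. f_equal. ring.
  - assert (K : q a * exp (2 * c * a) <= q b * exp (2 * c * b)).
    { apply (is_derive_nonneg_le (fun t => q t * exp (2 * c * t))
        (fun t => dq t * exp (2 * c * t) + q t * (2 * c * exp (2 * c * t)))); auto.
      - intros t Ht.
        apply (is_derive_mult (K := R_AbsRing) q (fun t => exp (2 * c * t)));
          [apply Hqd; auto|apply HE|exact Rmult_comm].
      - intros t Ht. specialize (Hqb t Ht). apply Rabs_le_between in Hqb.
        pose proof (exp_pos (2 * c * t)). nra. }
    replace (exp (2 * c * (b - a))) with (exp (2 * c * b) * / exp (2 * c * a)).
    + pose proof (exp_pos (2 * c * a)) as P.
      apply Rmult_le_reg_r with (exp (2 * c * a)); auto.
      rewrite <- Rmult_assoc, (Rmult_assoc _ (/ _)), Rinv_l by lra. lra.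
    + rewrite <- exp_Ropp, <- exp_plus. f_equal. ring.
Qed.

(** The balls of the uniform structure on [C] are products of intervals; a disc fits inside. *)
Lemma locally_Cmod (P : C -> Prop) (z : C) : locally z P ->
  exists d, 0 < d /\ forall w, Cmod (w - z) < d -> P w.
Proof.
  intros [d H]. exists d. split; [apply cond_pos|]. intros w Hw. apply H.
  split.
  - eapply Rle_lt_trans; [apply (re_le_Cmod (w - z))|exact Hw].
  - eapply Rle_lt_trans; [apply (im_le_Cmod (w - z))|exact Hw].
Qed.

Lemma meromorphic_at_finite (f : C -> Chat) (z0 w0 : C) : meromorphic f -> f z0 = Some w0 ->
  exists d, 0 < d /\ (forall z, cdisc z0 d z -> f z <> None) /\ hol (cdisc z0 d) (finite_part f).
Proof.
  intros Hf E. pose proof (Hf z0) as H. rewrite E in H. destruct H as [H _].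
  destruct (locally_Cmod _ _ H) as [d [Hd K]]. exists d. repeat split; auto.
  intros z Hz. pose proof (Hf z) as Hz'. specialize (K z Hz). destruct (f z); [|tauto].
  destruct Hz' as [_ [l Hl]]. exists l. apply cder_is_derive. exact Hl.
Qed.

Lemma meromorphic_at_pole (f : C -> Chat) (p : C) (B : R) : meromorphic f -> f p = None ->
  exists d, 0 < d /\ forall z, cdisc p d z -> z <> p -> f z <> None /\ B < Cmod (finite_part f z).
Proof.
  intros Hf E. pose proof (Hf p) as H. rewrite E in H. destruct H as [H1 H2].
  destruct (locally_Cmod _ _ H1) as [d1 [Hd1 K1]].
  assert (H3 : locally' p (fun z => B < Cmod (finite_part f z))).
  { apply H2. exists B. auto. }
  destruct (locally_Cmod _ _ H3) as [d2 [Hd2 K2]].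
  exists (Rmin d1 d2). split; [apply Rmin_pos; auto|]. intros z Hz Hzp. split.
  - apply K1; auto. eapply lt_min_l, Hz.
  - apply K2; auto. eapply lt_min_r, Hz.
Qed.

Lemma finite_part_Some (f : C -> Chat) (z w : C) : f z = Some w -> finite_part f z = w.
Proof. unfold finite_part. intros ->. auto. Qed.

Lemma finite_part_finite (f : C -> Chat) (z : C) : f z <> None -> f z = Some (finite_part f z).
Proof. unfold finite_part. destruct (f z); tauto. Qed.

(* Analytic continuation of the identity [f (phi v) = e^v]; [phi] cannot run into a pole
   because [e^v] stays bounded near every point. *)
Lemma exp_identity (f : C -> Chat) (D : C -> Prop) (phi : C -> C) (v0 : C) (e : R) :
  meromorphic f -> good_domain D -> hol D phi -> inj_on D phi -> D v0 -> 0 < e ->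
  (forall v, cdisc v0 e v -> f (phi v) = Some (Cexp v)) ->
  forall v, D v -> f (phi v) = Some (Cexp v).
Proof.
  intros Hf HD Hphi Hinj Hv0 He Hloc v Hv. pose proof (good_domain_convex D HD) as Hconv.
  set (P := fun t => exists e, 0 < e /\ forall x, cdisc (seg v0 v t) e x -> f (phi x) = Some (Cexp x)).
  assert (HP : P 1).
  2: { destruct HP as [e1 [He1 K]]. apply K. rewrite seg_1. apply cdisc_center; auto. }
  apply (unit_interval_constant P); [| |lra].
  2: { exists e. rewrite seg_0. auto. }
  intros t Ht. set (p := seg v0 v t). assert (Hp : D p) by (apply Hconv; auto).
  destruct (proj1 HD p Hp) as [r [Hr HrD]].
  destruct (Hphi p Hp) as [l Hl]. pose proof (cder_ccont _ _ _ Hl) as Hcont.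
  destruct (f (phi p)) as [w|] eqn:Efp.
  - destruct (meromorphic_at_finite f (phi p) w Hf Efp) as [d [Hd [Hd1 Hd2]]].
    destruct (Hcont d Hd) as [d' [Hd' Hcd]].
    set (r1 := Rmin r d'). assert (Hr1 : 0 < r1) by (apply Rmin_pos; auto).
    assert (HDr : forall x, cdisc p r1 x -> D x).
    { intros x Hx. apply HrD. eapply lt_min_l, Hx. }
    assert (Hfr : forall x, cdisc p r1 x -> cdisc (phi p) d (phi x)).
    { intros x Hx. apply Hcd. eapply lt_min_r, Hx. }
    set (u := fun x => (finite_part f (phi x) - Cexp x)%C).
    assert (Hu : hol (cdisc p r1) u).
    { intros x Hx. destruct (Hphi x (HDr x Hx)) as [m Hm].
      destruct (Hd2 _ (Hfr x Hx)) as [m' Hm']. eexists. apply cder_minus; [|apply cder_Cexp].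
      apply (cder_comp (finite_part f) phi); [apply Hm'|apply Hm]. }
    destruct (Hu p (cdisc_center p r1 Hr1)) as [lu Hlu].
    destruct (cder_ccont _ _ _ Hlu 1 Rlt_0_1) as [d2 [Hd2p Hc2]].
    set (r2 := Rmin r1 d2). assert (Hr2 : 0 < r2) by (apply Rmin_pos; auto).
    assert (Hs21 : forall x, cdisc p r2 x -> cdisc p r1 x).
    { intros x Hx. eapply lt_min_l, Hx. }
    (* Three steps shorter than [r2 / 10], from [x] over the points at [s'] and [t] to the one at
       [s], stay within the radius [3 * r2 / 10] of [zero_spreads]. *)
    destruct (seg_near v0 v t (r2 / 10)) as [ee [Hee Hnear]]; [lra|].
    exists ee. split; auto. intros s s' _ _ Hs Hs' [e1 [He1 K1]].
    pose proof (Hnear s Hs) as N1. pose proof (Hnear s' Hs') as N2. fold p in N1, N2.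
    exists (r2 / 10). split; [lra|]. intros x Hx.
    assert (Hxp : cdisc p r2 x).
    { apply (cdisc_sub p (seg v0 v s') r2 (r2 / 10)); auto. lra. }
    assert (Hx0 : u x = 0%C).
    { apply (zero_spreads p (seg v0 v s) r2 e1 u); auto.
      - eapply hol_sub; [apply Hs21|auto].
      - intros z Hz. left. apply Hc2. eapply lt_min_r, Hz.
      - intros z Hz. unfold u. rewrite (finite_part_Some _ _ _ (K1 z Hz)). ring.
      - unfold cdisc in *. pose proof (Cmod_triangle3 x (seg v0 v s') (seg v0 v s)).
        pose proof (Cmod_triangle3 (seg v0 v s') p (seg v0 v s)).
        rewrite (Cmod_sub_comm p) in H0. lra. }
    rewrite finite_part_finite by (apply Hd1, Hfr; auto). f_equal.
    unfold u in Hx0. replace (finite_part f (phi x)) with (finite_part f (phi x) - Cexp x + Cexp x)%C by ring.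
    rewrite Hx0. ring.
  - destruct (meromorphic_at_pole f (phi p) (exp (Re p + 1)) Hf Efp) as [d [Hd K]].
    destruct (Hcont d Hd) as [d' [Hd' Hcd]].
    set (r1 := Rmin r (Rmin d' 1)). assert (Hr1 : 0 < r1) by (repeat apply Rmin_pos; auto; lra).
    assert (R1 : r1 <= r) by le_min.
    assert (R2 : r1 <= d') by le_min.
    assert (R3 : r1 <= 1) by le_min.
    destruct (seg_near v0 v t (r1 / 2)) as [ee [Hee Hnear]]; [lra|].
    exists ee. split; auto. intros s s' _ _ Hs _ [e1 [He1 K1]]. exfalso.
    pose proof (Hnear s Hs) as N1. fold p in N1. set (q := seg v0 v s) in *.
    (* The lower bound for [f] holds only off the pole, so a point other than [p] is taken, which
       [phi] does not send to the pole by injectivity. There [|f (phi x)| = exp (Re x)] would exceed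
       [exp (Re p + 1)]. *)
    assert (Hx : exists x, cdisc q e1 x /\ Cmod (x - p) < r1 /\ x <> p).
    { destruct (classic (q = p)) as [E|N].
      - set (h := Rmin (e1 / 2) (r1 / 2)).
        assert (Hh : 0 < h) by (apply Rmin_pos; lra).
        assert (h <= e1 / 2) by le_min. assert (h <= r1 / 2) by le_min.
        assert (Em : Cmod (p + h - p) = h).
        { replace (p + h - p)%C with (RtoC h) by ring. rewrite Cmod_R, Rabs_right; lra. }
        exists (p + h)%C. repeat split.
        + unfold cdisc. rewrite E, Em. lra.
        + rewrite Em. lra.
        + intros F. rewrite F in Em. replace (p - p)%C with (RtoC 0) in Em by ring.
          rewrite Cmod_0 in Em. lra.
      - exists q. repeat split; auto. apply cdisc_center; auto. lra. }
    destruct Hx as [x [Hx1 [Hx2 Hx3]]]. specialize (K1 x Hx1).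
    assert (Hxd : cdisc (phi p) d (phi x)) by (apply Hcd; lra).
    destruct (K _ Hxd) as [_ K2].
    { intros E. apply Hx3. apply Hinj; auto. apply HrD; lra. }
    rewrite (finite_part_Some _ _ _ K1), Cmod_Cexp in K2. apply exp_lt_inv in K2.
    pose proof (re_le_Cmod (x - p)) as B. apply Rabs_le_between in B.
    change (Re (x - p)) with (Re x - Re p) in B. lra.
Qed.

(** By the chain rule a critical point of [phi] would be one of [f (phi v) = e^v], and the
    exponential has none. *)
Lemma exp_identity_derive (f : C -> Chat) (D : C -> Prop) (phi : C -> C) :
  meromorphic f -> open_domain D ->
  hol D phi -> (forall v, D v -> f (phi v) = Some (Cexp v)) ->
  forall v, D v -> C_derive phi v <> 0%C.
Proof.
  intros Hf HD Hphi He v Hv E.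
  pose proof (hol_C_derive D phi v Hphi Hv) as H. rewrite E in H.
  destruct (meromorphic_at_finite f (phi v) _ Hf (He v Hv)) as [d [Hd [_ Hh]]].
  destruct (Hh (phi v)) as [l Hl]; [apply cdisc_center; auto|].
  pose proof (cder_comp (finite_part f) phi v l 0 Hl H) as H1.
  destruct (HD v Hv) as [r [Hr HrD]].
  assert (H2 : cder Cexp v (0 * l)%C).
  { apply cder_ext with (u := fun w => finite_part f (phi w)) (d := r); auto.
    intros w Hw. apply finite_part_Some. apply He. apply HrD; auto. }
  pose proof (cder_unique _ _ _ _ H2 (cder_Cexp v)) as H3.
  apply (Cexp_neq_0 v). rewrite <- H3. ring.
Qed.

(** A finite subcover in disguise: the gauge at a point is kept below [/ (Rabs X + 1)] for its local
    bound [X], so the positive lower bound [d] that compactness gives for the gauges bounds these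
    [X] by [/ d]. *)
Lemma compact_bound (Q : C -> R -> Prop) (rad : R) :
  (forall z X Y, X <= Y -> Q z X -> Q z Y) ->
  (forall p, exists d X, 0 < d /\ forall z, Cmod (z - p) < d -> Q z X) ->
  exists X, forall z, Cmod z <= rad -> Q z X.
Proof.
  intros Hmono Hloc.
  assert (Hd : forall x y : R, exists d : posreal, exists X,
    (forall z, Cmod (z - (x, y)) < 2 * d -> Q z X) /\ d <= / (Rabs X + 1)).
  { intros x y. destruct (Hloc (x, y)) as [d [X [Hd K]]].
    assert (P : 0 < Rmin (d / 2) (/ (Rabs X + 1))).
    { apply Rmin_pos; [lra|]. apply Rinv_0_lt_compat. pose proof (Rabs_pos X); lra. }
    exists (mkposreal _ P), X. simpl. split; [|apply Rmin_r].
    intros z Hz. apply K. pose proof (Rmin_l (d / 2) (/ (Rabs X + 1))). lra. }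
  set (del := fun x y => proj1_sig (constructive_indefinite_description _ (Hd x y))).
  assert (Hdel : forall x y, exists X, (forall z, Cmod (z - (x, y)) < 2 * del x y -> Q z X) /\
     del x y <= / (Rabs X + 1)).
  { intros x y. unfold del. apply proj2_sig. }
  destruct (compactness_value_2d (- rad) rad (- rad) rad del) as [d Hcomp].
  exists (/ d). intros z Hz.
  pose proof (re_le_Cmod z) as R1. pose proof (im_le_Cmod z) as R2.
  assert (B1 : - rad <= Re z <= rad) by (apply Rabs_le_between; lra).
  assert (B2 : - rad <= Im z <= rad) by (apply Rabs_le_between; lra).
  apply NNPP. intros N. apply (Hcomp (Re z) (Im z) B1 B2). intros [x [y [_ [_ [Hx [Hy Hdd]]]]]].
  apply N. destruct (Hdel x y) as [X [K1 K2]]. apply Hmono with X.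
  - pose proof (Rle_abs X). pose proof (Rabs_pos X). pose proof (cond_pos d).
    assert (d <= / (Rabs X + 1)) by lra.
    apply Rinv_le_contravar in H2; auto. rewrite Rinv_inv in H2. lra.
  - apply K1. eapply Rle_lt_trans; [apply Cmod_le_re_im|].
    change (Rabs (Re z - x) + Rabs (Im z - y) < 2 * del x y). lra.
Qed.

Lemma continuous_bounded_on_circle (u : C -> C) (p : C) (r : R) :
  (forall z, Cmod (z - p) = r -> ccont u z) ->
  exists B, forall z, Cmod (z - p) = r -> Cmod (u z) <= B.
Proof.
  intros Hu.
  destruct (compact_bound (fun z X => Cmod (z - p) = r -> Cmod (u z) <= X) (r + Cmod p)) as [X HX].
  - intros z X Y HXY H E. specialize (H E). lra.
  - intros q. destruct (Req_dec (Cmod (q - p)) r) as [E|N].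
    + destruct (Hu q E 1 Rlt_0_1) as [d [Hd K]]. exists d, (Cmod (u q) + 1). split; auto.
      intros z Hz _. specialize (K z Hz). pose proof (Cmod_sub_ge (u z) (u q)). lra.
    + exists (Rabs (Cmod (q - p) - r)), 0. split; [apply Rabs_pos_lt; lra|].
      intros z Hz E. exfalso. pose proof (Cmod_triangle3 z q p). pose proof (Cmod_triangle3 q z p).
      rewrite (Cmod_sub_comm q z) in H0. unfold Rabs in Hz. destruct (Rcase_abs _) in Hz; lra.
  - exists X. intros z Hz. apply HX; auto.
    replace z with ((z - p) + p)%C by ring. eapply Rle_trans; [apply Cmod_triangle|]. lra.
Qed.

Lemma stays_in_disc (phi : C -> C) (p a b : C) (r : R) :
  (forall t, 0 <= t <= 1 -> ccont phi (seg a b t)) ->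
  (forall t, 0 <= t <= 1 -> Cmod (phi (seg a b t) - p) <> r) ->
  Cmod (phi a - p) < r -> Cmod (phi b - p) < r.
Proof.
  intros Hc Hne Ha.
  assert (K : Cmod (phi (seg a b 1) - p) < r).
  { apply (unit_interval_constant (fun t => Cmod (phi (seg a b t) - p) < r)); [| |lra].
    - intros t Ht. specialize (Hne t Ht).
      assert (Hpos : 0 < Rabs (Cmod (phi (seg a b t) - p) - r)) by (apply Rabs_pos_lt; lra).
      destruct (Hc t Ht _ Hpos) as [d [Hd Kd]].
      destruct (seg_near a b t d Hd) as [e [He Ke]].
      exists e. split; auto. intros s s' _ _ Hs Hs' H1.
      pose proof (Kd _ (Ke s Hs)) as D1. pose proof (Kd _ (Ke s' Hs')) as D2.
      set (y := phi (seg a b t)) in *. set (y1 := phi (seg a b s)) in *. set (y2 := phi (seg a b s')) in *.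
      pose proof (Cmod_triangle3 y y1 p). rewrite (Cmod_sub_comm y y1) in H.
      pose proof (Cmod_triangle3 y2 y p).
      unfold Rabs in D1, D2. destruct (Rcase_abs (Cmod (y - p) - r)) in D1, D2; lra.
    - rewrite seg_0. auto. }
  rewrite seg_1 in K. exact K.
Qed.

(* A cluster value at a pole [p] would trap [phi] near [p]. Being univalent, [phi] approaches
   [p] slower than any exponential, while [1 / f (phi v) = e^-v]: so [1 / f] would
   have a zero of infinite order at [p]. *)
Lemma no_pole_cluster (f : C -> Chat) (m : R) (phi : C -> C) (p : C) :
  meromorphic f -> hol (rhalf m) phi -> inj_on (rhalf m) phi ->
  (forall v, rhalf m v -> f (phi v) = Some (Cexp v)) -> f p = None ->
  (forall r X, 0 < r -> exists v, rhalf m v /\ X < Re v /\ Cmod (phi v - p) < r) -> False.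
Proof.
  intros Hf Hphi Hinj He Hp Hcl.
  assert (Hop := proj1 (good_rhalf m)).
  assert (Hnz := exp_identity_derive f _ phi Hf Hop Hphi He).
  assert (Hnp : forall v, rhalf m v -> phi v <> p).
  { intros v Hv E. specialize (He v Hv). rewrite E, Hp in He. discriminate. }
  set (F := finite_part f).
  assert (HFphi : forall v, rhalf m v -> F (phi v) = Cexp v).
  { intros v Hv. apply finite_part_Some; auto. }
  destruct (meromorphic_at_pole f p 1 Hf Hp) as [d [Hd Hpole]].
  assert (HF0 : forall z, cdisc p d z -> z <> p -> F z <> 0%C).
  { intros z Hz N. destruct (Hpole z Hz N) as [_ B]. apply Cmod_gt_0. fold F in B. lra. }
  assert (HFhol : forall z, cdisc p d z -> z <> p -> exists l, cder F z l).
  { intros z Hz N. destruct (Hpole z Hz N) as [B _].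
    destruct (meromorphic_at_finite f z _ Hf (finite_part_finite f z B)) as [d' [Hd' [_ K]]].
    apply K, cdisc_center; auto. }
  (* On the circle of radius [r] the function [F] is bounded, so [phi v], where [|F| = exp (Re v)],
     cannot meet it once [Re v] is large. The cluster hypothesis puts one such value inside, and
     connectedness of the half-plane keeps all of them there. *)
  assert (Htrap : forall r, 0 < r < d -> exists X, m <= X /\ forall v, X < Re v -> Cmod (phi v - p) < r).
  { intros r Hr. destruct (continuous_bounded_on_circle F p r) as [B HB].
    { intros z Hz. destruct (HFhol z) as [l Hl].
      - unfold cdisc; lra.
      - intros ->. replace (p - p)%C with (RtoC 0) in Hz by ring. rewrite Cmod_0 in Hz. lra.
      - eapply cder_ccont; eauto. }
    set (X := Rmax m (ln (Rmax 1 B))). exists X. split; [apply Rmax_l|]. intros v Hv.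
    assert (Hne : forall w, X < Re w -> rhalf m w /\ Cmod (phi w - p) <> r).
    { intros w Hw. assert (Hmw : rhalf m w) by (eapply Rle_lt_trans; [apply Rmax_l|apply Hw]).
      split; auto. intros E. specialize (HB _ E). rewrite HFphi, Cmod_Cexp in HB by auto.
      assert (L : ln (Rmax 1 B) < Re w) by (eapply Rle_lt_trans; [apply Rmax_r|apply Hw]).
      apply exp_increasing in L. rewrite exp_ln in L.
      - pose proof (Rmax_r 1 B). lra.
      - eapply Rlt_le_trans; [apply Rlt_0_1|apply Rmax_l]. }
    destruct (Hcl r X) as [v1 [_ [Hv1X Hv1]]]; [lra|].
    assert (Hs : forall t, 0 <= t <= 1 -> X < Re (seg v1 v t)).
    { intros t Ht. apply (convex_rhalf X v1 v t); auto. }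
    apply (stays_in_disc phi p v1 v r); auto.
    - intros t Ht. destruct (Hphi (seg v1 v t)) as [l Hl]; [apply Hne, Hs; auto|].
      eapply cder_ccont; eauto.
    - intros t Ht. apply Hne, Hs; auto. }
  (* The extra factor [z - p] makes differentiability at the pole immediate: [1 / F] tends to 0, so
     the derivative there is 0. *)
  set (k := fun z => ((z - p) * / F z)%C).
  assert (Hkp : k p = 0%C) by (unfold k; ring).
  assert (Hkb : forall z, cdisc p d z -> Cmod (k z) <= d).
  { intros z Hz. destruct (classic (z = p)) as [->|N].
    - rewrite Hkp, Cmod_0. lra.
    - unfold k. rewrite Cmod_mult, Cmod_inv by auto.
      destruct (Hpole z Hz N) as [_ B]. fold F in B.
      assert (/ Cmod (F z) <= 1) by (rewrite <- Rinv_1; apply Rinv_le_contravar; lra).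
      unfold cdisc in Hz. pose proof (Cmod_ge_0 (z - p)). nra. }
  assert (Hk : hol (cdisc p d) k).
  { intros z Hz. destruct (classic (z = p)) as [->|N].
    - exists 0%C. intros eps Heps.
      destruct (meromorphic_at_pole f p (/ eps) Hf Hp) as [d1 [Hd1 K1]].
      exists d1. split; auto. intros w Hw. rewrite Hkp.
      replace (k w - 0 - 0 * (w - p))%C with (k w) by ring.
      destruct (classic (w = p)) as [->|Nw].
      + rewrite Hkp, Cmod_0. apply Rmult_le_pos; [lra|apply Cmod_ge_0].
      + destruct (K1 w Hw Nw) as [_ B]. fold F in B. pose proof (Rinv_0_lt_compat _ Heps).
        unfold k. rewrite Cmod_mult, Cmod_inv by (apply Cmod_gt_0; lra).
        rewrite Rmult_comm. apply Rmult_le_compat_r; [apply Cmod_ge_0|].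
        rewrite <- (Rinv_inv eps). apply Rinv_le_contravar; lra.
    - destruct (HFhol z Hz N) as [l Hl]. eexists. apply cder_mult.
      + apply cder_sub_const.
      + apply cder_inv; [apply Hl|auto]. }
  assert (Hpc := cdisc_center p d Hd).
  assert (Hord : forall n, exists w, hol (cdisc p d) w /\
     forall z, cdisc p d z -> k z = ((z - p) ^ n * w z)%C).
  { induction n as [|n [w [Hw Hkw]]].
    - exists k. split; auto. intros z Hz. simpl. ring.
    - assert (Hw0 : w p = 0%C).
      2: { destruct (hol_divide p d w Hd Hw Hw0) as [w1 [Hw1 E1]]. exists w1. split; auto.
           intros z Hz. rewrite Hkw, E1 by auto. simpl. ring. }
      apply NNPP. intros N. destruct (Hw p Hpc) as [l Hl].
      destruct (ccont_nonzero w p (cder_ccont _ _ _ Hl) N) as [d1 [Hd1 K1]].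
      apply Cmod_gt_0 in N. set (mu := Cmod (w p) / 2) in *.
      set (r := Rmin (Rmin (d / 2) d1) 1).
      assert (Hr : 0 < r) by (repeat apply Rmin_pos; lra).
      assert (r <= d / 2) by le_min.
      assert (r <= d1) by le_min.
      assert (r <= 1) by le_min.
      destruct (Htrap r) as [X [HmX HX]]; [lra|].
      (* If [w p] were nonzero, [|k|] would be at least [mu * |z - p|^n] near [p]. With this rate
         the distance [y s] is at least [y 0 * e^(- e s)], so its [n]-th power decays no faster than
         [e^(- s / 2)], whereas [|k (phi v)| <= e^(- x1 - s)]; a large [s] gives the
         contradiction. *)
      set (e := / (2 * (INR n + 1))).
      assert (Hn0 : 0 <= INR n) by apply pos_INR.
      assert (He0 : 0 < e) by (apply Rinv_0_lt_compat; lra).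
      assert (Hen : e * INR n <= 1 / 2).
      { unfold e. apply Rmult_le_reg_l with (2 * (INR n + 1)); [lra|].
        rewrite <- Rmult_assoc, Rinv_r; lra. }
      assert (HK : 0 < koebe_const) by (unfold koebe_const; lra).
      (* From here on [phi] is trapped near [p], and [univalent_omitted_value] bounds [|phi'|] by
         [e * |phi - p|]. *)
      set (x1 := Rmax (X + 1) (m + koebe_const / e)).
      assert (Hx1 : X + 1 <= x1) by apply Rmax_l.
      assert (Hx2 : m + koebe_const / e <= x1) by apply Rmax_r.
      assert (HKe : 0 < koebe_const / e) by (apply Rdiv_lt_0_compat; auto).
      set (y := fun s => Cmod (phi (RtoC (x1 + s)) - p)).
      assert (Hin : forall s, 0 <= s -> rhalf m (RtoC (x1 + s))) by (intros s Hs; unfold rhalf; simpl; lra).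
      assert (Hy0 : forall s, 0 <= s -> 0 < y s).
      { intros s Hs. apply Cmod_gt_0, sub_neq_0, Hnp. auto. }
      assert (Hyr : forall s, 0 <= s -> y s < r).
      { intros s Hs. apply HX. simpl. lra. }
      assert (Hgr : forall s, 0 <= s -> y 0 <= y s * exp (e * s)).
      { intros s Hs. replace (e * s) with (e * (s - 0)) by ring. unfold y.
        apply (gronwall (fun s => phi (RtoC (x1 + s)) - p)%C (fun s => C_derive phi (RtoC (x1 + s))) e 0 s Hs).
        - intros t Ht. assert (G : rder (fun s => RtoC (x1 + s)) t 1).
          { intros eps Heps. exists 1. split; [lra|]. intros q _.
            replace (RtoC (x1 + q) - RtoC (x1 + t) - 1 * (q - t)%R)%C with (RtoC 0).
            - rewrite Cmod_0. apply Rmult_le_pos; [lra|apply Rabs_pos].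
            - rewrite !RtoC_plus, RtoC_minus. ring. }
          replace (C_derive phi (RtoC (x1 + t))) with (C_derive phi (RtoC (x1 + t)) * 1)%C by ring.
          apply (cder_rder_comp (fun z => phi z - p)%C (fun s => RtoC (x1 + s))); auto.
          eapply cder_eq; [apply cder_minus; [|apply cder_const]|].
          + apply (hol_C_derive (rhalf m)); auto. apply Hin; lra.
          + ring.
        - intros t Ht. set (v := RtoC (x1 + t)).
          assert (Hv : rhalf m v) by (apply Hin; lra).
          assert (Hsub : forall z, cdisc v (Re v - m) z -> rhalf m z) by apply rhalf_disc.
          assert (Hdist : koebe_const / e <= Re v - m) by (unfold v; simpl; lra).
          eapply Rle_trans.
          + apply (univalent_omitted_value phi v p (Re v - m)); auto; try lra.
            * eapply hol_sub; eauto.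
            * intros a b Ha Hb. apply Hinj; auto.
          + apply Rmult_le_compat_r; [apply Cmod_ge_0|].
            apply Rle_div_l; [lra|].
            apply Rmult_le_compat_l with (r := e) in Hdist; [|lra].
            replace (e * (koebe_const / e)) with koebe_const in Hdist by (field; lra). lra. }
      assert (Hmain : forall s, 0 <= s -> y 0 ^ n * mu <= exp (- x1) * exp (- (s / 2))).
      { intros s Hs. assert (Hv := Hin s Hs). set (v := RtoC (x1 + s)) in *.
        assert (Hvd : cdisc p d (phi v)) by (specialize (Hyr s Hs); unfold cdisc; unfold y in Hyr; fold v in Hyr; lra).
        assert (E1 : Cmod (k (phi v)) = y s * exp (- (x1 + s))).
        { unfold k. rewrite HFphi, <- Cexp_opp, Cmod_mult, Cmod_Cexp by auto. unfold y. fold v.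
          f_equal. }
        rewrite (Hkw _ Hvd), Cmod_mult, Cmod_pow in E1. change (Cmod (phi v - p)) with (y s) in E1.
        assert (Hmu : mu < Cmod (w (phi v))).
        { apply K1. specialize (Hyr s Hs). unfold y in Hyr. fold v in Hyr. lra. }
        pose proof (Hy0 s Hs) as P. specialize (Hyr s Hs).
        assert (Hpow : 0 < y s ^ n) by (apply pow_lt; auto).
        assert (E2 : y s ^ n * mu <= exp (- (x1 + s))).
        { pose proof (exp_pos (- (x1 + s))). nra. }
        assert (E3 : y 0 ^ n <= y s ^ n * exp (s / 2)).
        { eapply Rle_trans; [apply pow_incr; split; [|apply (Hgr s Hs)]|].
          - left. apply Hy0. lra.
          - rewrite Rpow_mult_distr. apply Rmult_le_compat_l; [lra|].
            replace (exp (e * s) ^ n) with (exp (e * INR n * s)).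
            + apply exp_nondecreasing. nra.
            + rewrite <- Rpower_pow by apply exp_pos. unfold Rpower. rewrite ln_exp. f_equal. ring. }
        apply Rle_trans with (y s ^ n * exp (s / 2) * mu).
        - apply Rmult_le_compat_r; [unfold mu; lra|auto].
        - replace (exp (- x1) * exp (- (s / 2))) with (exp (- (x1 + s)) * exp (s / 2)).
          + pose proof (exp_pos (s / 2)). nra.
          + rewrite <- !exp_plus. f_equal. field. }
      assert (Hpos : 0 < y 0 ^ n * mu).
      { apply Rmult_lt_0_compat; [apply pow_lt, Hy0; lra|unfold mu; lra]. }
      set (q := y 0 ^ n * mu) in *.
      set (s := 2 * Rmax 0 (- x1 - ln q + 1)).
      assert (0 <= s) by (unfold s; pose proof (Rmax_l 0 (- x1 - ln q + 1)); lra).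
      specialize (Hmain s H2). rewrite <- exp_plus in Hmain.
      assert (- x1 + - (s / 2) < ln q) by (unfold s; pose proof (Rmax_r 0 (- x1 - ln q + 1)); lra).
      apply exp_increasing in H3. rewrite exp_ln in H3 by auto. lra. }
  destruct (Hcl (d / 3) 0) as [v [Hv [_ Hvp]]]; [lra|].
  pose proof (infinite_order_zero p d d k Hkb Hord (phi v) Hvp) as Z.
  unfold k in Z. rewrite HFphi, <- Cexp_opp in Z by auto.
  revert Z. apply Cmult_neq_0; [apply sub_neq_0, Hnp; auto|apply Cexp_neq_0].
Qed.

(** Every point has a neighbourhood that [phi v] avoids for large [Re v]: near a non-pole [f] is
    bounded whereas [f (phi v) = e^v], and at a pole [no_pole_cluster] applies. Compactness of the
    closed disc makes the bound on [Re v] uniform. *)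
Lemma phi_escapes (f : C -> Chat) (m : R) (phi : C -> C) (rad : R) :
  meromorphic f -> hol (rhalf m) phi -> inj_on (rhalf m) phi ->
  (forall v, rhalf m v -> f (phi v) = Some (Cexp v)) ->
  exists X, forall v, rhalf m v -> X < Re v -> rad < Cmod (phi v).
Proof.
  intros Hf Hphi Hinj He.
  destruct (compact_bound (fun z X => forall v, rhalf m v -> X < Re v -> phi v <> z) rad) as [X HX].
  - intros z X Y HXY H v Hv Hr. apply H; auto. lra.
  - intros p.
    assert (H : exists d X, 0 < d /\ forall v, rhalf m v -> X < Re v -> d <= Cmod (phi v - p)).
    { destruct (f p) as [w|] eqn:Ep.
      - destruct (meromorphic_at_finite f p w Hf Ep) as [d [Hd [_ Hh]]].
        destruct (Hh p (cdisc_center p d Hd)) as [l Hl].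
        destruct (cder_ccont _ _ _ Hl 1 Rlt_0_1) as [d1 [Hd1 K]].
        rewrite (finite_part_Some _ _ _ Ep) in K.
        exists d1, (ln (Cmod w + 1)). split; auto. intros v Hv Hr. apply Rnot_lt_le. intros L.
        specialize (K _ L). rewrite (finite_part_Some _ _ _ (He v Hv)) in K.
        pose proof (Cmod_sub_ge (Cexp v) w) as T. rewrite Cmod_Cexp in T.
        apply exp_increasing in Hr. rewrite exp_ln in Hr by (pose proof (Cmod_ge_0 w); lra). lra.
      - apply NNPP. intros N. apply (no_pole_cluster f m phi p); auto.
        intros r X Hr. apply NNPP. intros N2. apply N. exists r, X. split; auto.
        intros v Hv HXv. apply Rnot_lt_le. intros L. apply N2. exists v. auto. }
    destruct H as [d [X [Hd K]]]. exists d, X. split; auto. intros z Hz v Hv Hr E.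
    specialize (K v Hv Hr). rewrite E in K. lra.
  - exists X. intros v Hv Hr. apply Rnot_le_lt. intros L. apply (HX _ L v Hv Hr). auto.
Qed.

(** * The far coordinate and escaping solutions *)

Lemma rder_translate (v : C) (t : R) : rder (fun s => v + RtoC s)%C t 1.
Proof.
  intros eps He. exists 1. split; [lra|]. intros s _.
  replace (v + s - (v + t) - 1 * (s - t)%R)%C with (RtoC 0) by (rewrite RtoC_minus; ring).
  rewrite Cmod_0. apply Rmult_le_pos; [lra|apply Rabs_pos].
Qed.

Lemma cder_rder_translate (u : C -> C) (v : C) (t : R) (l : C) :
  cder u (v + t)%C l -> rder (fun s => u (v + RtoC s)%C) t l.
Proof.
  intros H. replace l with (l * 1)%C by ring.
  apply (cder_rder_comp u (fun s => v + RtoC s)%C); auto. apply rder_translate.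
Qed.

Lemma exp_neg_nat (n : nat) : exp (- INR n) <= (1 / 2) ^ n.
Proof.
  induction n as [|n IH].
  - simpl. rewrite Ropp_0, exp_0. lra.
  - rewrite S_INR. replace (- (INR n + 1)) with (-1 + - INR n) by ring. rewrite exp_plus. simpl.
    assert (exp (-1) <= 1 / 2).
    { replace (-1) with (- (1)) by ring. rewrite exp_Ropp. replace (1/2) with (/2) by field. apply Rinv_le_contravar; [lra|].
      pose proof (exp_ineq1 1). lra. }
    apply Rmult_le_compat; auto; left; apply exp_pos.
Qed.

(* [A = phi' e^-v] is nearly an exponential: [A' = - A] up to a factor [eps]. So it has a
   primitive [F] close to [- A], and [L] is [- log (- F)]. *)
Lemma far_coordinate (m : R) (phi : C -> C) :
  hol (rhalf m) phi -> inj_on (rhalf m) phi ->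
  (forall v, rhalf m v -> C_derive phi v <> 0%C) ->
  exists m0 L, m <= m0 /\ hol (rhalf m0) L /\
    forall v, rhalf m0 v -> Cmod (C_derive L v - 1) <= 1 / 32 /\
      (C_derive L v * Cexp (- L v) = C_derive phi v * Cexp (- v))%C.
Proof.
  intros Hphi Hinj Hnz.
  (* In the end [L' - 1] is bounded by [2 * eps * |A| / |F|] with [|F| >= 63 / 64 * |A|], that is,
     by [1 / 63], within the required [1 / 32]. The abscissa [m0] is where the Koebe quotient falls
     to [eps]. *)
  set (eps := 1 / 128).
  assert (HK : 0 < koebe_const) by (unfold koebe_const; lra).
  set (m0 := m + koebe_const / eps).
  assert (Hm0 : m <= m0).
  { unfold m0. assert (0 < koebe_const / eps); [|lra]. apply Rdiv_lt_0_compat; unfold eps; lra. }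
  assert (Hsub : forall v, rhalf m0 v -> rhalf m v) by (unfold rhalf; intros; lra).
  assert (Hop := proj1 (good_rhalf m)).
  assert (Hconv := convex_rhalf m0).
  pose proof (hol_derive _ phi Hop Hphi) as Hphi'.
  assert (Hsec : forall v, rhalf m0 v -> Cmod (C_derive (C_derive phi) v) <= eps * Cmod (C_derive phi v)).
  { intros v Hv. assert (Hd : koebe_const / eps < Re v - m) by (unfold rhalf, m0 in Hv; lra).
    assert (P : 0 < koebe_const / eps) by (apply Rdiv_lt_0_compat; unfold eps; lra).
    pose proof (rhalf_disc m v) as Hs.
    eapply Rle_trans.
    - apply (univalent_second_derivative phi v (Re v - m)); [lra| | |]; auto.
      + eapply hol_sub; eauto.
      + intros x y Hx Hy. apply Hinj; auto.
    - apply Rmult_le_compat_r; [apply Cmod_ge_0|].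
      apply Rle_div_l; [lra|].
      apply Rmult_lt_compat_l with (r := eps) in Hd; [|unfold eps; lra].
      replace (eps * (koebe_const / eps)) with koebe_const in Hd by (unfold eps; field). lra. }
  set (A := fun v => (C_derive phi v * Cexp (- v))%C).
  set (dA := fun v => (C_derive (C_derive phi) v * Cexp (- v) - A v)%C).
  assert (HdA : forall v, rhalf m0 v -> cder A v (dA v)).
  { intros v Hv. unfold A. eapply cder_eq.
    - apply cder_mult; [apply (hol_C_derive (rhalf m)); auto|].
      apply cder_Cexp_comp, cder_opp, cder_id.
    - cbv beta. unfold dA, A. ring. }
  assert (HA0 : forall v, rhalf m0 v -> 0 < Cmod (A v)).
  { intros v Hv. apply Cmod_gt_0. apply Cmult_neq_0; [auto|apply Cexp_neq_0]. }
  assert (HAA : forall v, rhalf m0 v -> Cmod (dA v + A v) <= eps * Cmod (A v)).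
  { intros v Hv. unfold dA. replace (C_derive (C_derive phi) v * Cexp (- v) - A v + A v)%C
      with (C_derive (C_derive phi) v * Cexp (- v))%C by ring.
    unfold A. rewrite !Cmod_mult, <- Rmult_assoc. apply Rmult_le_compat_r; [apply Cmod_ge_0|auto]. }
  assert (Htr : forall v s, rhalf m0 v -> 0 <= s -> rhalf m0 (v + RtoC s)%C).
  { unfold rhalf, Re. simpl. intros v s Hv Hs. lra. }
  (* Gronwall for [A e^s], whose logarithmic derivative is at most [eps] in modulus; of the rate
     [1 - eps] only [1 / 2] is kept. *)
  assert (Hdec : forall v s, rhalf m0 v -> 0 <= s -> Cmod (A (v + RtoC s)%C) <= Cmod (A v) * exp (- (s / 2))).
  { intros v s Hv Hs.
    destruct (gronwall (fun s => A (v + RtoC s) * Cexp (RtoC s))%C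
      (fun s => (dA (v + RtoC s) + A (v + RtoC s)) * Cexp (RtoC s))%C eps 0 s Hs) as [G _].
    - intros t Ht.
      assert (E : forall s, (A (v + RtoC s) * Cexp (RtoC s))%C = ((fun z => A z * Cexp (z - v)) (v + RtoC s))%C).
      { intros q. cbv beta. f_equal. f_equal. ring. }
      assert (K : rder (fun s => ((fun z => A z * Cexp (z - v)) (v + RtoC s))%C) t
        ((dA (v + RtoC t) + A (v + RtoC t)) * Cexp (RtoC t))%C).
      { apply (cder_rder_translate (fun z => A z * Cexp (z - v))%C). eapply cder_eq.
        - apply cder_mult; [apply HdA, Htr; auto; lra|]. apply cder_Cexp_comp, cder_sub_const.
        - cbv beta. replace (v + t - v)%C with (RtoC t) by ring. ring. }
      intros e He. destruct (K e He) as [d [Hd K1]]. exists d. split; auto.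
      intros q Hq. rewrite !E. auto.
    - intros t Ht. rewrite !Cmod_mult, <- Rmult_assoc. apply Rmult_le_compat_r; [apply Cmod_ge_0|].
      apply HAA, Htr; auto; lra.
    - rewrite !Cmod_mult, !Cmod_Cexp in G. simpl Re in G. rewrite exp_0, Rmult_1_r, Rminus_0_r in G.
      replace (v + 0)%C with v in G by ring.
      apply Rmult_le_reg_r with (exp s); [apply exp_pos|].
      eapply Rle_trans; [apply G|]. rewrite Rmult_assoc, <- exp_plus.
      apply Rmult_le_compat_l; [apply Cmod_ge_0|]. apply exp_nondecreasing. unfold eps. lra. }
  set (vs := RtoC (m0 + 1)).
  assert (Hvs : rhalf m0 vs) by (unfold rhalf, vs; simpl; lra).
  destruct (good_domain_primitive (rhalf m0) A vs (good_rhalf m0) Hvs) as [P HP].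
  { intros v Hv. eexists; apply HdA; auto. }
  (* The decay of [A] is integrated along a horizontal ray; the factor 2 is the integral of
     [e^(- s / 2)]. *)
  assert (Hhor : forall (E dE : C -> C) (c : R) v s, 0 <= c -> rhalf m0 v -> 0 <= s ->
    (forall z, rhalf m0 z -> cder E z (dE z)) -> (forall z, rhalf m0 z -> Cmod (dE z) <= c * Cmod (A z)) ->
    Cmod (E (v + RtoC s)%C - E v) <= 2 * c * Cmod (A v)).
  { intros E dE c v s Hc Hv Hs HE Hb.
    pose proof (rder_bound (fun s => E (v + RtoC s)%C) (fun s => dE (v + RtoC s)%C)
      (fun s => - (2 * c * Cmod (A v) * exp (- (s / 2)))) (fun s => c * (Cmod (A v) * exp (- (s / 2)))) 0 s Hs) as K.
    cbv beta in K. replace (v + 0)%C with v in K by ring.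
    replace (- (0 / 2)) with 0 in K by field. rewrite exp_0 in K.
    eapply Rle_trans; [apply K|].
    - intros t Ht. apply cder_rder_translate. apply HE, Htr; auto; lra.
    - intros t Ht. auto_derive; auto. unfold Rdiv. field.
    - intros t Ht. eapply Rle_trans; [apply Hb, Htr; auto; lra|].
      apply Rmult_le_compat_l; auto. apply Hdec; auto; lra.
    - pose proof (exp_pos (- (s / 2))). pose proof (Cmod_ge_0 (A v)).
      assert (0 <= c * Cmod (A v)) by (apply Rmult_le_pos; auto). nra. }
  assert (HPh : forall v s, rhalf m0 v -> 0 <= s -> Cmod (P (v + RtoC s)%C - P v) <= 2 * Cmod (A v)).
  { intros v s Hv Hs. replace (2 * Cmod (A v)) with (2 * 1 * Cmod (A v)) by ring.
    apply (Hhor P A); auto; [lra|]. intros z _. lra. }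
  assert (HEh : forall v s, rhalf m0 v -> 0 <= s ->
    Cmod ((P (v + RtoC s) + A (v + RtoC s)) - (P v + A v))%C <= 2 * eps * Cmod (A v)).
  { intros v s Hv Hs. apply (Hhor (fun z => P z + A z)%C (fun z => A z + dA z)%C); auto.
    - unfold eps; lra.
    - intros z Hz. apply cder_plus; auto.
    - intros z Hz. replace (A z + dA z)%C with (dA z + A z)%C by ring. auto. }
  (* Steps of length 2 gain a factor [e^-1 <= 1 / 2], the form that [geometric_limit] takes. *)
  assert (Hdecn : forall v n, rhalf m0 v -> Cmod (A (v + RtoC (2 * INR n))%C) <= Cmod (A v) * (1/2)^n).
  { intros v n Hv. pose proof (pos_INR n). eapply Rle_trans; [apply Hdec; auto; lra|].
    apply Rmult_le_compat_l; [apply Cmod_ge_0|]. replace (2 * INR n / 2) with (INR n) by field.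
    apply exp_neg_nat. }
  destruct (geometric_limit (fun n => P (vs + RtoC (2 * INR n))%C) (2 * Cmod (A vs))) as [l Hl].
  { intros n. rewrite S_INR. pose proof (pos_INR n).
    replace (vs + RtoC (2 * (INR n + 1)))%C with ((vs + RtoC (2 * INR n)) + RtoC 2)%C.
    2: { rewrite !RtoC_mult, RtoC_plus. ring. }
    eapply Rle_trans; [apply HPh; [apply Htr; auto; lra|lra]|].
    rewrite Rmult_assoc. apply Rmult_le_compat_l; [lra|]. auto. }
  (* The limit [l] of the primitive is the same on all horizontal rays: its increment over the
     segment from [vs + s] to [v + s] is controlled by [A] there, which tends to 0. *)
  assert (Hlim : forall v, rhalf m0 v -> exists c, 0 <= c /\ forall n,
    Cmod (P (v + RtoC (2 * INR n))%C - l) <= c * (1/2)^n).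
  { intros v Hv. set (d := Cmod (v - vs)).
    assert (Hd : 0 <= d) by apply Cmod_ge_0.
    set (Bv := Cmod (A vs) * exp (2 * d)).
    assert (HB0 : 0 <= Bv) by (apply Rmult_le_pos; [apply Cmod_ge_0|left; apply exp_pos]).
    assert (HAb : forall t, 0 <= t <= 1 -> Cmod (A (seg vs v t)) <= Bv).
    { intros t Ht. destruct (gronwall (fun t => A (seg vs v t)) (fun t => dA (seg vs v t) * (v - vs))%C (2 * d) 0 t) as [G _].
      - lra.
      - intros q Hq. apply (cder_rder_comp A (seg vs v)); [|apply rder_segment].
        apply HdA, Hconv; auto; lra.
      - intros q Hq. rewrite Cmod_mult. fold d.
        assert (Hq' : rhalf m0 (seg vs v q)) by (apply Hconv; auto; lra).
        pose proof (HAA _ Hq') as K. set (z := seg vs v q) in *.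
        assert (Cmod (dA z) <= 2 * Cmod (A z)).
        { replace (dA z) with ((dA z + A z) + - A z)%C by ring.
          eapply Rle_trans; [apply Cmod_triangle|]. rewrite Cmod_opp. unfold eps in K.
          pose proof (Cmod_ge_0 (A z)). lra. }
        nra.
      - rewrite seg_0 in G. eapply Rle_trans; [apply G|]. unfold Bv.
        apply Rmult_le_compat_l; [apply Cmod_ge_0|]. apply exp_nondecreasing. nra. }
    exists (Bv * d + 4 * (2 * Cmod (A vs))). split.
    { pose proof (Cmod_ge_0 (A vs)). assert (0 <= Bv * d) by (apply Rmult_le_pos; auto). lra. }
    intros n. pose proof (pos_INR n) as Hn. set (s := RtoC (2 * INR n)).
    eapply Rle_trans; [apply (Cmod_triangle3 _ (P (vs + s)%C))|].
    rewrite Rmult_plus_distr_r. apply Rplus_le_compat; [|apply Hl].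
    replace (P (v + s) - P (vs + s))%C with (P (v + s) - P (vs + s) - 0 * (v + s - (vs + s)))%C by ring.
    replace (Bv * d * (1/2)^n) with (Bv * (1/2)^n * Cmod (v + s - (vs + s))).
    2: { replace (v + s - (vs + s))%C with (v - vs)%C by ring. fold d. ring. }
    assert (Eseg : forall t, (vs + s + RtoC t * (v + s - (vs + s)))%C = (seg vs v t + s)%C)
      by (intros; unfold seg; ring).
    apply (cder_segment_bound P A).
    - intros t Ht. rewrite Eseg. apply HP. apply Htr; [apply Hconv; auto|lra].
    - intros t Ht. rewrite Eseg. replace (A (seg vs v t + s) - 0)%C with (A (seg vs v t + s)%C) by ring.
      eapply Rle_trans; [apply Hdecn; apply Hconv; auto|].
      apply Rmult_le_compat_r; [apply pow_le; lra|auto]. }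
  set (F := fun v => (P v - l)%C).
  assert (HF : forall v, rhalf m0 v -> cder F v (A v)).
  { intros v Hv. unfold F. eapply cder_eq; [apply cder_minus; [auto|apply cder_const]|ring]. }
  (* [F + A] tends to 0 along the ray from [v], and its derivative [A + dA] is at most [eps * |A|],
     so [HEh] bounds its whole variation. *)
  assert (HFA : forall v, rhalf m0 v -> Cmod (F v + A v) <= 2 * eps * Cmod (A v)).
  { intros v Hv. destruct (Hlim v Hv) as [c [Hc0 Hc]].
    assert (Cmod (F v + A v) - 2 * eps * Cmod (A v) <= 0); [|lra].
    apply (le_small _ (c + Cmod (A v))); [pose proof (Cmod_ge_0 (A v)); lra|].
    intros e He. destruct (half_pow_small 1 e He) as [n Hn].
    pose proof (pos_INR n) as Hn0. specialize (Hc n). specialize (Hdecn v n Hv).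
    specialize (HEh v (2 * INR n) Hv ltac:(lra)). set (w := (v + RtoC (2 * INR n))%C) in *.
    unfold F. replace (P v - l + A v)%C with (- ((P w + A w) - (P v + A v)) + ((P w - l) + A w))%C by ring.
    assert (T := Cmod_triangle (- ((P w + A w) - (P v + A v))) ((P w - l) + A w)).
    rewrite Cmod_opp in T. pose proof (Cmod_triangle (P w - l) (A w)).
    assert (Hp : 0 < (1/2)^n) by (apply pow_lt; lra).
    assert (c * (1/2)^n <= c * e) by (apply Rmult_le_compat_l; lra).
    assert (Cmod (A v) * (1/2)^n <= Cmod (A v) * e) by (apply Rmult_le_compat_l; [apply Cmod_ge_0|lra]).
    lra. }
  assert (HFlow : forall v, rhalf m0 v -> 63 / 64 * Cmod (A v) <= Cmod (F v)).
  { intros v Hv. specialize (HFA v Hv). pose proof (Cmod_triangle (F v + A v) (- F v)) as T.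
    replace (F v + A v + - F v)%C with (A v) in T by ring. rewrite Cmod_opp in T. unfold eps in HFA. lra. }
  assert (HF0 : forall v, rhalf m0 v -> F v <> 0%C).
  { intros v Hv. apply Cmod_gt_0. specialize (HFlow v Hv). specialize (HA0 v Hv). lra. }
  set (g := fun v => (- F v)%C).
  assert (Hg : forall v, rhalf m0 v -> cder g v (- A v)%C) by (intros; apply cder_opp; auto).
  destruct (good_domain_log (rhalf m0) g vs (good_rhalf m0) Hvs) as [h Hh].
  { intros v Hv. eexists; apply Hg; auto. }
  { intros v Hv E. apply (HF0 v Hv). replace (F v) with (- g v)%C by (unfold g; ring). rewrite E. ring. }
  exists m0, (fun v => - h v)%C. split; auto.
  assert (HL : forall v, rhalf m0 v -> cder (fun v => - h v)%C v (- (A v / F v))%C).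
  { intros v Hv. destruct (Hh v Hv) as [_ K]. rewrite (C_derive_eq _ _ _ (Hg v Hv)) in K.
    eapply cder_eq; [apply cder_opp, K|]. unfold g. pose proof (HF0 v Hv). field. auto. }
  split.
  { intros v Hv. eexists; apply HL; auto. }
  intros v Hv. rewrite (C_derive_eq _ _ _ (HL v Hv)). pose proof (HF0 v Hv) as N. split.
  - replace (- (A v / F v) - 1)%C with (- (F v + A v) / F v)%C by (field; auto).
    rewrite Cmod_div, Cmod_opp by auto. specialize (HFlow v Hv). specialize (HFA v Hv). specialize (HA0 v Hv).
    assert (Pf : 0 < Cmod (F v)) by lra.
    apply Rle_div_l; [lra|]. unfold eps in HFA. lra.
  - replace (- - h v)%C with (h v) by ring. destruct (Hh v Hv) as [-> _]. unfold g.
    change (C_derive phi v * Cexp (- v))%C with (A v). field. auto.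
Qed.

Lemma near_translation (m0 : R) (L : C -> C) :
  hol (rhalf m0) L -> (forall v, rhalf m0 v -> Cmod (C_derive L v - 1) <= 1 / 32) ->
  forall x y, rhalf m0 x -> rhalf m0 y -> Cmod (L x - L y - 1 * (x - y)) <= 1 / 32 * Cmod (x - y).
Proof.
  intros HL Hd x y Hx Hy.
  assert (Hs : forall t, 0 <= t <= 1 -> rhalf m0 (seg y x t)).
  { intros t Ht. apply (convex_rhalf m0); auto. }
  apply (cder_segment_bound L (C_derive L)).
  - intros t Ht. apply (hol_C_derive (rhalf m0)); auto. apply (Hs t Ht).
  - intros t Ht. apply Hd. apply (Hs t Ht).
Qed.

(** The equation [L x = w] is solved by contraction in the disc of centre [w] and radius [Re w / 2].
    This tolerates a defect [|w - L w|] up to [Re w / 16], while the defect grows only like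
    [Re w / 32] plus a constant that depends on the strip; [s0] absorbs the constant. The strip
    about [Im w = b] is open so that the inverse can be differentiated. *)
Lemma near_translation_inverse (m0 : R) (L : C -> C) (b : R) :
  hol (rhalf m0) L -> (forall v, rhalf m0 v -> Cmod (C_derive L v - 1) <= 1 / 32) ->
  exists s0 k, forall w, s0 < Re w -> Rabs (Im w - b) < 1 ->
    rhalf m0 (k w) /\ L (k w) = w /\ Re w / 2 < Re (k w) /\ cder k w (/ C_derive L (k w))%C.
Proof.
  intros HL Hd. pose proof (near_translation m0 L HL Hd) as Hnear.
  set (p := RtoC (Rabs m0 + 1)).
  assert (Hp : rhalf m0 p) by (unfold rhalf, p; simpl; pose proof (Rle_abs m0); lra).
  set (c1 := Cmod (L p - p)). assert (Hc1 : 0 <= c1) by apply Cmod_ge_0.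
  set (c2 := Rabs b + 1 + Cmod p).
  assert (Hc2 : 0 <= c2) by (unfold c2; pose proof (Rabs_pos b); pose proof (Cmod_ge_0 p); lra).
  set (s0 := 2 * Rabs m0 + 32 * (c1 + c2) + 1).
  assert (Hs0 : 0 < s0) by (unfold s0; pose proof (Rabs_pos m0); lra).
  set (Q := fun w x => rhalf m0 x /\ L x = w /\ Re w / 2 < Re x).
  set (k := fun w => epsilon (inhabits (RtoC 0)) (Q w)).
  set (E := fun w => s0 < Re w /\ Rabs (Im w - b) < 1).
  assert (Hk : forall w, E w -> Q w (k w)).
  { intros w [Hw1 Hw2]. apply epsilon_spec.
    assert (Hin : forall x, cdisc w (Re w / 2) x -> rhalf m0 x /\ Re w / 2 < Re x).
    { intros x Hx. unfold cdisc in Hx. pose proof (re_le_Cmod (x - w)) as K. apply Rabs_le_between in K.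
      change (Re (x - w)) with (Re x - Re w) in K. unfold rhalf. pose proof (Rle_abs m0).
      unfold s0 in Hw1. lra. }
    assert (Hww : rhalf m0 w) by (apply Hin, cdisc_center; lra).
    destruct (approx_contraction_onto L w 1 w (Re w / 2)) as [x [Hx Ex]].
    - intros F. apply RtoC_inj in F. lra.
    - intros x y Hx Hy. rewrite Cmod_1. eapply Rle_trans; [apply Hnear; apply Hin; auto|].
      pose proof (Cmod_ge_0 (x - y)). lra.
    - rewrite Cmod_1. specialize (Hnear w p Hww Hp).
      replace (w - L w)%C with (- (L w - L p - 1 * (w - p)) + - (L p - p))%C by ring.
      eapply Rle_lt_trans; [apply Cmod_triangle|]. rewrite !Cmod_opp. fold c1.
      assert (Cmod (w - p) <= Re w + c2).
      { unfold Cminus. eapply Rle_trans; [apply Cmod_triangle|]. rewrite Cmod_opp.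
        pose proof (Cmod_le_re_im w) as T. rewrite (Rabs_right (Re w)) in T by lra.
        pose proof (Rabs_triang (Im w - b) b). replace (Im w - b + b) with (Im w) in H by ring.
        unfold c2. lra. }
      unfold s0 in Hw1. pose proof (Rabs_pos m0). lra.
    - exists x. unfold Q. destruct (Hin x Hx). auto. }
  exists s0, k. intros w Hw1 Hw2. destruct (Hk w (conj Hw1 Hw2)) as [K1 [K2 K3]].
  repeat split; auto.
  apply (inverse_cder (rhalf m0) E L k); auto.
  - apply (proj1 (good_rhalf m0)).
  - intros z [Hz1 Hz2]. exists (Rmin (Re z - s0) (1 - Rabs (Im z - b))).
    split; [apply Rmin_pos; lra|]. intros y Hy.
    pose proof (lt_min_l _ _ _ Hy) as Y1.
    pose proof (lt_min_r _ _ _ Hy) as Y2.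
    pose proof (re_le_Cmod (y - z)) as R1. pose proof (im_le_Cmod (y - z)) as R2.
    change (Im (y - z)) with (Im y - Im z) in R2. change (Re (y - z)) with (Re y - Re z) in R1. split.
    + apply Rabs_le_between in R1. lra.
    + pose proof (Rabs_triang (Im y - Im z) (Im z - b)).
      replace (Im y - Im z + (Im z - b)) with (Im y - b) in H by ring. lra.
  - intros z Hz F. specialize (Hd z Hz). rewrite F in Hd. replace (0 - 1)%C with (- (1))%C in Hd by ring.
    rewrite Cmod_m1 in Hd. lra.
  - intros x y Hx Hy F. specialize (Hnear x y Hx Hy). rewrite F in Hnear.
    replace (L y - L y - 1 * (x - y))%C with (- (x - y))%C in Hnear by ring. rewrite Cmod_opp in Hnear.
    apply Cmod_sub_0. pose proof (Cmod_ge_0 (x - y)). lra.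
  - intros z Hz. destruct (Hk z Hz) as [Q1 [Q2 _]]. auto.
  - split; auto.
Qed.

Lemma rder_real_affine (g : R -> R) (b t l : R) : is_derive g t l ->
  rder (fun s => (g s, b)) t (RtoC l).
Proof.
  intros H eps He. apply is_derive_Reals in H. destruct (H eps He) as [d K].
  exists d. split; [apply cond_pos|]. intros s Hs.
  replace ((g s, b) - (g t, b) - RtoC l * RtoC (s - t))%C with (RtoC (g s - g t - l * (s - t))).
  2: { apply injective_projections; simpl; ring. }
  rewrite Cmod_R. destruct (Req_dec s t) as [->|N].
  - replace (g t - g t - l * (t - t)) with 0 by ring. rewrite Rabs_R0.
    apply Rmult_le_pos; [lra|apply Rabs_pos].
  - specialize (K (s - t) ltac:(lra) Hs). replace (t + (s - t)) with s in K by ring.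
    replace (g s - g t - l * (s - t)) with (((g s - g t) / (s - t) - l) * (s - t)) by (field; lra).
    rewrite Rabs_mult. apply Rmult_le_compat_r; [apply Rabs_pos|lra].
Qed.

(* With time chosen as [t = F (V t) = - e^(- L (V t))], the curve on which [Im L = b] solves the flow. *)
Lemma escaping_solution (m0 : R) (L phi : C -> C) (b : R) :
  hol (rhalf m0) L -> hol (rhalf m0) phi ->
  (forall v, rhalf m0 v -> C_derive phi v <> 0%C) ->
  (forall v, rhalf m0 v -> Cmod (C_derive L v - 1) <= 1 / 32 /\
      (C_derive L v * Cexp (- L v) = C_derive phi v * Cexp (- v))%C) ->
  cos b = 1 -> sin b = 0 ->
  exists tau V, tau < 0 /\ forall t, tau < t < 0 ->
    rhalf m0 (V t) /\ L (V t) = (- ln (- t), b) /\ - ln (- t) / 2 < Re (V t) /\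
    rder (fun s => phi (V s)) t (Cexp (V t)).
Proof.
  intros HL Hphi Hnz Hd Hcos Hsin.
  destruct (near_translation_inverse m0 L b HL (fun v Hv => proj1 (Hd v Hv))) as [s0 [k Hk]].
  (* For [t < 0], being above this starting time means [- ln (- t) > s0], so that the inverse [k] is
     available. *)
  exists (- exp (- s0)), (fun t => k (- ln (- t), b)).
  split; [pose proof (exp_pos (- s0)); lra|].
  intros t Ht. set (w := (- ln (- t), b)).
  assert (Hw1 : s0 < Re w).
  { unfold w; simpl. assert (ln (- t) < - s0); [|lra]. rewrite <- (ln_exp (- s0)).
    apply ln_increasing; lra. }
  assert (Hw2 : Rabs (Im w - b) < 1).
  { unfold w; simpl. replace (b - b) with 0 by ring. rewrite Rabs_R0. lra. }
  destruct (Hk w Hw1 Hw2) as [K1 [K2 [K3 K4]]]. repeat split; auto.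
  destruct (Hd _ K1) as [Hd1 Hd2]. rewrite K2 in Hd2. specialize (Hnz _ K1).
  assert (EL : Cexp (- w) = RtoC (- t)).
  { unfold Cexp, w, Re, Im; simpl. rewrite Ropp_involutive, exp_ln, cos_neg, sin_neg, Hcos, Hsin by lra.
    apply injective_projections; simpl; ring. }
  rewrite EL in Hd2.
  assert (Ht0 : RtoC (- t) <> 0%C) by (intros F; apply RtoC_inj in F; lra).
  assert (HL0 : C_derive L (k w) <> 0%C).
  { intros F. rewrite F in Hd1. replace (0 - 1)%C with (- (1))%C in Hd1 by ring.
    rewrite Cmod_m1 in Hd1. lra. }
  replace (Cexp (k w)) with (C_derive phi (k w) * (/ C_derive L (k w) * RtoC (/ - t)))%C.
  - apply (cder_rder_comp phi (fun s => k (- ln (- s), b))).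
    + apply (hol_C_derive (rhalf m0)); auto.
    + apply (cder_rder_comp k (fun s => (- ln (- s), b))); auto.
      apply rder_real_affine. auto_derive; [lra|field; lra].
  - rewrite RtoC_inv by lra. pose proof (Cexp_neq_0 (k w)) as Ne.
    assert (E : C_derive L (k w) = (C_derive phi (k w) / (Cexp (k w) * RtoC (- t)))%C).
    { rewrite Cexp_opp in Hd2. replace (C_derive L (k w)) with (C_derive L (k w) * RtoC (- t) / RtoC (- t))%C by (field; auto).
      rewrite Hd2. field. auto. }
    rewrite E. field. repeat split; auto.
Qed.

(** * Trajectories *)

Definition solves_at (f : C -> Chat) (y : R -> C) (t : R) : Prop :=
  f (y t) <> None /\ rder y t (finite_part f (y t)).

Lemma solves_flow_at (f : C -> Chat) (alpha beta : Rbar) (z : R -> C) :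
  solves_flow f alpha beta z <-> (forall t, in_interval alpha beta t -> solves_at f z t).
Proof.
  split; intros H t Ht; specialize (H t Ht).
  - destruct H as [w [E Hd]]. split; [congruence|]. rewrite (finite_part_Some _ _ _ E).
    apply rder_is_derive. exact Hd.
  - destruct H as [H1 H2]. exists (finite_part f (z t)). split; [apply finite_part_finite; auto|].
    apply rder_is_derive. exact H2.
Qed.

Lemma rder_continuous (y : R -> C) (t : R) (l : C) : rder y t l ->
  forall eps, 0 < eps -> exists d, 0 < d /\ forall s, Rabs (s - t) < d -> Cmod (y s - y t) < eps.
Proof.
  intros H eps He. destruct (H 1 Rlt_0_1) as [d [Hd K]]. pose proof (Cmod_ge_0 l) as Hl.
  exists (Rmin d (eps / (Cmod l + 1))). split; [apply Rmin_pos; auto; apply Rdiv_lt_0_compat; lra|].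
  intros s Hs. pose proof (lt_min_l _ _ _ Hs) as S1.
  pose proof (lt_min_r _ _ _ Hs) as S2.
  specialize (K s S1). replace (y s - y t)%C with ((y s - y t - l * (s - t)%R) + l * (s - t)%R)%C by ring.
  eapply Rle_lt_trans; [apply Cmod_triangle|]. rewrite Cmod_mult, Cmod_R.
  pose proof (Rabs_pos (s - t)). apply lt_div_succ in S2; lra.
Qed.

Lemma rder_local (y x : R -> C) (t d : R) (l : C) : 0 < d ->
  (forall s, Rabs (s - t) < d -> y s = x s) -> rder y t l -> rder x t l.
Proof.
  intros Hd E H eps He. destruct (H eps He) as [d1 [Hd1 K]].
  exists (Rmin d d1). split; [apply Rmin_pos; auto|]. intros s Hs.
  rewrite <- (E s), <- (E t).
  - apply K. eapply lt_min_r, Hs.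
  - replace (t - t) with 0 by ring. rewrite Rabs_R0. auto.
  - eapply lt_min_l, Hs.
Qed.

Lemma rder_shift (y : R -> C) (c t : R) (l : C) : rder y (t + c) l -> rder (fun s => y (s + c)) t l.
Proof.
  intros H eps He. destruct (H eps He) as [d [Hd K]]. exists d. split; auto. intros s Hs.
  replace (s - t) with ((s + c) - (t + c)) in * by ring. auto.
Qed.

Lemma rder_minus (y x : R -> C) (t : R) (l k : C) :
  rder y t l -> rder x t k -> rder (fun s => y s - x s)%C t (l - k)%C.
Proof.
  rewrite !rder_is_derive. intros H1 H2. exact (is_derive_minus y x t l k H1 H2).
Qed.

Definition between (s t q : R) : Prop := Rmin s t <= q <= Rmax s t.

(** Agreement is an open condition on time, by Gronwall and the local Lipschitz bound for
    [finite_part f], and so is disagreement, by continuity. Time is reparametrised over the unit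
    interval so that [t1] may also precede [t0]. *)
Lemma flow_unique (f : C -> Chat) (y x : R -> C) (t0 t1 : R) : meromorphic f ->
  (forall t, between t0 t1 t -> solves_at f y t /\ solves_at f x t) ->
  y t0 = x t0 -> y t1 = x t1.
Proof.
  intros Hf Hs E.
  set (tt := fun u => t0 + u * (t1 - t0)).
  assert (Htt : forall u u' s, 0 <= u <= 1 -> 0 <= u' <= 1 -> between (tt u) (tt u') s -> between t0 t1 s).
  { unfold between, tt. intros u u' s Hu Hu'. destruct (Rle_or_lt t0 t1) as [L|L].
    - rewrite (Rmin_left t0), (Rmax_right t0) by lra.
      assert (t0 <= t0 + u * (t1 - t0) <= t1) by nra. assert (t0 <= t0 + u' * (t1 - t0) <= t1) by nra.
      unfold Rmin, Rmax. destruct (Rle_dec _ _); lra.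
    - rewrite (Rmin_right t0), (Rmax_left t0) by lra.
      assert (t1 <= t0 + u * (t1 - t0) <= t0) by nra. assert (t1 <= t0 + u' * (t1 - t0) <= t0) by nra.
      unfold Rmin, Rmax. destruct (Rle_dec _ _); lra. }
  assert (Hb : forall u, 0 <= u <= 1 -> between t0 t1 (tt u)).
  { intros u Hu. apply (Htt u u); auto. unfold between. rewrite Rmin_left, Rmax_left; lra. }
  assert (K : y (tt 1) = x (tt 1)).
  2: { unfold tt in K. replace (t0 + 1 * (t1 - t0)) with t1 in K by ring. auto. }
  assert (Hnear : forall u d, 0 < d -> exists e, 0 < e /\ forall u', Rabs (u' - u) < e -> Rabs (tt u' - tt u) < d).
  { intros u d Hd. pose proof (Rabs_pos (t1 - t0)) as Hp.
    exists (d / (Rabs (t1 - t0) + 1)). split; [apply Rdiv_lt_0_compat; lra|]. intros u' Hu.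
    replace (tt u' - tt u) with ((u' - u) * (t1 - t0)) by (unfold tt; ring). rewrite Rabs_mult.
    pose proof (Rabs_pos (u' - u)). apply lt_div_succ in Hu; lra. }
  apply (unit_interval_constant (fun u => y (tt u) = x (tt u))); [| |lra].
  2: { unfold tt. replace (t0 + 0 * (t1 - t0)) with t0 by ring. auto. }
  intros u Hu. destruct (Hs _ (Hb u Hu)) as [[Y1 Y2] [X1 X2]].
  destruct (classic (y (tt u) = x (tt u))) as [Eu|Nu].
  - set (p := y (tt u)) in *.
    destruct (meromorphic_at_finite f p _ Hf (finite_part_finite f p Y1)) as [d [Hd [_ Hh]]].
    destruct (strictly_differentiable _ (finite_part f) p (cdisc_open p d) Hh (cdisc_center p d Hd) 1 Rlt_0_1)
      as [rho [Hrho [_ Hlip]]].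
    set (c := Cmod (C_derive (finite_part f) p) + 1).
    assert (HL : forall a b, cdisc p rho a -> cdisc p rho b ->
      Cmod (finite_part f a - finite_part f b) <= c * Cmod (a - b)).
    { intros a b Ha Hb'. specialize (Hlip a b Ha Hb').
      set (l := C_derive (finite_part f) p) in *.
      replace (finite_part f a - finite_part f b)%C with
        ((finite_part f a - finite_part f b - l * (a - b)) + l * (a - b))%C by ring.
      eapply Rle_trans; [apply Cmod_triangle|]. rewrite Cmod_mult. unfold c. lra. }
    destruct (rder_continuous y _ _ Y2 rho Hrho) as [d1 [Hd1 C1]].
    destruct (rder_continuous x _ _ X2 rho Hrho) as [d2 [Hd2 C2]].
    fold p in C1. rewrite <- Eu in C2.
    destruct (Hnear u (Rmin d1 d2)) as [e [He Ke]]; [apply Rmin_pos; auto|].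
    exists e. split; auto. intros s s' _ Hs' _ Hse _.
    specialize (Ke s' Hse).
    assert (Hd12 : forall q, between (tt u) (tt s') q -> Rabs (q - tt u) <= Rabs (tt s' - tt u)).
    { unfold between, Rmin, Rmax. intros q Hq. destruct (Rle_dec (tt u) (tt s')).
      - rewrite !Rabs_right; lra.
      - rewrite !Rabs_left1; lra. }
    assert (Hcy : forall q, between (tt u) (tt s') q -> cdisc p rho (y q) /\ cdisc p rho (x q)).
    { intros q Hq. specialize (Hd12 q Hq). split.
      - apply C1. pose proof (Rmin_l d1 d2). lra.
      - apply C2. pose proof (Rmin_r d1 d2). lra. }
    set (g := fun q => (y q - x q)%C).
    set (dg := fun q => (finite_part f (y q) - finite_part f (x q))%C).
    assert (Hg : forall q, between (tt u) (tt s') q -> rder g q (dg q) /\ Cmod (dg q) <= c * Cmod (g q)).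
    { intros q Hq. destruct (Hs q (Htt u s' q Hu Hs' Hq)) as [[_ A1] [_ A2]]. split.
      - apply rder_minus; auto.
      - apply HL; apply Hcy; auto. }
    assert (Hgu : g (tt u) = 0%C) by (unfold g; fold p; rewrite <- Eu; ring).
    assert (Hz : Cmod (g (tt s')) <= 0).
    { destruct (Rle_or_lt (tt u) (tt s')) as [L|L].
      - destruct (gronwall g dg c (tt u) (tt s') L) as [G _].
        + intros q Hq. apply Hg. unfold between. rewrite Rmin_left, Rmax_right; lra.
        + intros q Hq. apply Hg. unfold between. rewrite Rmin_left, Rmax_right; lra.
        + rewrite Hgu, Cmod_0, Rmult_0_l in G. exact G.
      - destruct (gronwall g dg c (tt s') (tt u)) as [_ G]; [lra| | |].
        + intros q Hq. apply Hg. unfold between. rewrite Rmin_right, Rmax_left; lra.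
        + intros q Hq. apply Hg. unfold between. rewrite Rmin_right, Rmax_left; lra.
        + rewrite Hgu, Cmod_0, Rmult_0_l in G. exact G. }
    apply Cmod_sub_0. exact Hz.
  - assert (Hpos : 0 < Cmod (y (tt u) - x (tt u)) / 2).
    { apply sub_neq_0, Cmod_gt_0 in Nu. lra. }
    destruct (rder_continuous y _ _ Y2 _ Hpos) as [d1 [Hd1 C1]].
    destruct (rder_continuous x _ _ X2 _ Hpos) as [d2 [Hd2 C2]].
    destruct (Hnear u (Rmin d1 d2)) as [e [He Ke]]; [apply Rmin_pos; auto|].
    exists e. split; auto. intros s s' _ _ Hse _ Es. exfalso. specialize (Ke s Hse).
    specialize (C1 (tt s) (lt_min_l _ _ _ Ke)).
    specialize (C2 (tt s) (lt_min_r _ _ _ Ke)).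
    rewrite Es in C1. rewrite Cmod_sub_comm in C1.
    pose proof (Cmod_triangle3 (y (tt u)) (x (tt s)) (x (tt u))). lra.
Qed.

Definition escapes_at (z : R -> C) (beta : R) : Prop :=
  forall B, exists d, 0 < d /\ forall t, beta - d < t < beta -> B < Cmod (z t).

Lemma escapes_at_not_continuous (z x : R -> C) (beta d : R) (l : C) : 0 < d ->
  escapes_at z beta -> (forall t, beta - d < t < beta -> x t = z t) -> rder x beta l -> False.
Proof.
  intros Hd He Hx Hr. destruct (rder_continuous _ _ _ Hr 1 Rlt_0_1) as [d1 [Hd1 K]].
  destruct (He (Cmod (x beta) + 1)) as [d2 [Hd2 K2]].
  set (h := Rmin d (Rmin d1 d2)). assert (Hh : 0 < h) by (repeat apply Rmin_pos; auto).
  assert (h <= d) by le_min.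
  assert (h <= d1) by le_min.
  assert (h <= d2) by le_min.
  specialize (K (beta - h / 2)). specialize (K2 (beta - h / 2) ltac:(lra)).
  rewrite <- Hx in K2 by lra.
  assert (Cmod (x (beta - h / 2) - x beta) < 1).
  { apply K. rewrite Rabs_left; lra. }
  pose proof (Cmod_sub_ge (x (beta - h / 2)) (x beta)). lra.
Qed.

(** Only the left end can move, since escape forbids continuation past [beta]. The leftward
    extensions of [y] agree with each other by uniqueness, hence glue to a solution down to the
    infimum [alpha] of their left ends. *)
Lemma maximal_extension (f : C -> Chat) (y : R -> C) (tau beta : R) : meromorphic f -> tau < beta ->
  (forall t, tau < t < beta -> solves_at f y t) -> escapes_at y beta ->
  exists (alpha : Rbar) (z : R -> C), trajectory f alpha (Finite beta) z /\
    Rbar_le alpha tau /\ forall t, tau < t < beta -> z t = y t.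
Proof.
  intros Hf Htau Hy Hesc.
  set (ext := fun (a : R) (x : R -> C) => a < beta /\ (forall t, a < t < beta -> solves_at f x t) /\
    (forall t, Rmax a tau < t < beta -> x t = y t)).
  set (S := fun a => exists x, ext a x).
  assert (Hext0 : ext tau y).
  { repeat split; auto; intros; apply Hy; auto. }
  set (alpha := Glb_Rbar S).
  destruct (Glb_Rbar_correct S) as [Hlb Hglb]. fold alpha in Hlb, Hglb.
  assert (Hle : Rbar_le alpha tau) by (apply Hlb; exists y; auto).
  set (X := fun t => epsilon (inhabits (0, y)) (fun q : R * (R -> C) => fst q < t /\ ext (fst q) (snd q))).
  assert (HX : forall t, in_interval alpha beta t -> fst (X t) < t /\ ext (fst (X t)) (snd (X t))).
  { intros t [Ht1 Ht2]. apply (epsilon_spec (inhabits (0, y)) (fun q => fst q < t /\ ext (fst q) (snd q))).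
    apply NNPP. intros N. apply (Rbar_lt_not_le _ _ Ht1). apply Hglb.
    intros a [x Hx]. apply Rnot_lt_le. intros L. apply N. exists (a, x). auto. }
  set (z := fun t => snd (X t) t).
  assert (Hagree : forall a x b x' t, ext a x -> ext b x' -> Rmax a b < t < beta -> x t = x' t).
  { intros a x b x' t [Ha1 [Ha2 Ha3]] [Hb1 [Hb2 Hb3]] Ht.
    pose proof (Rmax_l a b). pose proof (Rmax_r a b).
    (* At this later time both extensions equal [y]; uniqueness leads back from it to [t]. *)
    set (t0 := (Rmax t tau + beta) / 2).
    pose proof (Rmax_l t tau). pose proof (Rmax_r t tau).
    assert (Rmax t tau < beta) by (apply Rmax_lub_lt; lra).
    assert (Ht0 : Rmax t tau < t0 < beta) by (unfold t0; lra).
    apply (flow_unique f x x' t0 t Hf).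
    - intros s Hs. unfold between in Hs. rewrite Rmin_right, Rmax_left in Hs by lra.
      split; [apply Ha2|apply Hb2]; lra.
    - rewrite Ha3, Hb3; auto; (split; [apply Rmax_lub_lt|]); lra. }
  assert (Hz : forall a x t, ext a x -> a < t < beta -> z t = x t).
  { intros a x t Hx Ht.
    assert (Hin : in_interval alpha beta t).
    { split; simpl; [|lra]. apply Rbar_le_lt_trans with (Finite a); [|simpl; lra].
      apply Hlb. exists x; auto. }
    destruct (HX t Hin) as [X1 X2]. unfold z.
    apply (Hagree (fst (X t)) (snd (X t)) a x t X2 Hx). split; [apply Rmax_lub_lt|]; lra. }
  assert (Hsol : forall t, in_interval alpha beta t -> solves_at f z t).
  { intros t Ht. destruct (HX t Ht) as [X1 X2]. destruct Ht as [_ Ht2]. simpl in Ht2.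
    set (a := fst (X t)) in *. set (x := snd (X t)) in *.
    destruct (proj1 (proj2 X2) t ltac:(lra)) as [S1 S2].
    assert (E : z t = x t) by (apply (Hz a x); auto). split; rewrite E; auto.
    apply (rder_local x z t (Rmin (t - a) (beta - t))); auto; [apply Rmin_pos; lra|].
    intros s Hs. symmetry. apply (Hz a x); auto.
    pose proof (lt_min_l _ _ _ Hs) as B1.
    pose proof (lt_min_r _ _ _ Hs) as B2.
    apply Rabs_lt_between in B1. apply Rabs_lt_between in B2. lra. }
  assert (Hzy : forall t, tau < t < beta -> z t = y t) by (intros; apply (Hz tau y); auto).
  exists alpha, z. split; [|split; auto]. split; [|split].
  - apply Rbar_le_lt_trans with (Finite tau); auto.
  - apply solves_flow_at. auto.
  - intros alpha' beta' x Hal Hbe Hx Hxz. rewrite solves_flow_at in Hx.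
    assert (Hab : Rbar_lt alpha' beta).
    { apply Rbar_le_lt_trans with (Finite tau); auto. apply Rbar_le_trans with alpha; auto. }
    assert (Hxy : forall t, tau < t < beta -> x t = y t).
    { intros t Ht. rewrite Hxz; auto. split; [|simpl; lra].
      apply Rbar_le_lt_trans with (Finite tau); auto. simpl; lra. }
    split.
    + destruct (Rbar_le_lt_or_eq_dec _ _ Hal) as [L|E]; auto. exfalso.
      (* The set [S] consists of real left ends, so an extension beyond [alpha], possibly to minus
         infinity, is cut at a real [a]. *)
      assert (Hmid : exists a : R, Rbar_lt alpha' a /\ Rbar_lt a alpha).
      { destruct alpha as [r| |].
        - destruct alpha' as [r'| |]; simpl in *; try tauto.
          + exists ((r + r') / 2). lra.
          + exists (r - 1). split; auto; lra.
        - simpl in Hle. tauto.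
        - destruct alpha'; simpl in L; tauto. }
      destruct Hmid as [a [Ha1 Ha2]].
      assert (Hat : a < tau) by (apply (Rbar_lt_le_trans (Finite a) alpha (Finite tau)); auto).
      apply (Rbar_lt_not_le _ _ Ha2). apply Hlb. exists x. split; [lra|]. split.
      * intros t Ht. apply Hx. split.
        -- apply Rbar_lt_trans with (Finite a); auto. simpl; lra.
        -- apply Rbar_lt_le_trans with (Finite beta); auto. simpl; lra.
      * intros t Ht. apply Hxy. pose proof (Rmax_r a tau). lra.
    + destruct (Rbar_le_lt_or_eq_dec _ _ Hbe) as [L|E]; auto. exfalso.
      destruct (Hx beta (conj Hab L)) as [_ K].
      eapply (escapes_at_not_continuous y x beta (beta - tau)); [lra|exact Hesc| |exact K].
      intros t Ht. apply Hxy. lra.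
Qed.

(* Shifting time, an intersection would make the orbits coincide, hence escape simultaneously. *)
Lemma escape_not_delayed (f : C -> Chat) (y x : R -> C) (a a' : Rbar) (t1 t2 : R) : meromorphic f ->
  (forall t, in_interval a 0 t -> solves_at f y t) ->
  (forall t, in_interval a' 0 t -> solves_at f x t) ->
  escapes_at x 0 -> in_interval a 0 t1 -> in_interval a' 0 t2 -> y t1 = x t2 -> t2 <= t1.
Proof.
  intros Hf Hy Hx He [A1 A2] [B1 B2] E. simpl in A2, B2. apply Rnot_lt_le. intros L.
  (* By uniqueness [y t = x (t + c)] from [t1] on, so [y] would escape already at the time
     [- c < 0], at which it is still differentiable. *)
  set (c := t2 - t1). assert (Hc : 0 < c) by (unfold c; lra).
  destruct (Hy (- c)) as [_ K].
  { split; simpl; [|lra]. apply Rbar_lt_trans with (Finite t1); auto. simpl. unfold c; lra. }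
  apply (escapes_at_not_continuous (fun t => x (t + c)) y (- c) (- c - t1) (finite_part f (y (- c)))).
  - unfold c; lra.
  - intros B. destruct (He B) as [d [Hd Kd]]. exists d. split; auto. intros t Ht. apply Kd. lra.
  - intros t Ht. apply (flow_unique f y (fun t => x (t + c)) t1 t Hf).
    + intros s Hs. unfold between in Hs. rewrite Rmin_left, Rmax_right in Hs by lra. split.
      * apply Hy. split; simpl; [|lra]. apply Rbar_lt_le_trans with (Finite t1); auto. simpl; lra.
      * destruct (Hx (s + c)) as [K1 K2].
        { split; simpl; [|lra]. apply Rbar_lt_le_trans with (Finite t2); auto. simpl; unfold c; lra. }
        split; auto. apply rder_shift. auto.
    + unfold c. replace (t1 + (t2 - t1)) with t2 by ring. auto.
  - exact K.
Qed.

(** [U] and the image of [D] share the point [phi v0], so their union is connected, by following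
    images of segments from [v0]; maximality of the component then absorbs the image. *)
Lemma component_absorbs_image (U S D : C -> Prop) (phi : C -> C) (v0 : C) :
  component U S -> convex D -> hol D phi -> D v0 -> U (phi v0) ->
  (forall v, D v -> S (phi v)) -> forall v, D v -> U (phi v).
Proof.
  intros [_ [HUS [HUc Hmax]]] HD Hphi Hv0 HU HS.
  set (A := fun z => U z \/ exists v, D v /\ phi v = z).
  assert (Hstep : forall V W : C -> Prop, open V -> open W ->
    (forall z, A z -> V z \/ W z) -> (forall z, A z -> ~ (V z /\ W z)) ->
    V (phi v0) -> forall v, D v -> V (phi v)).
  { intros V W HV HW Hcov Hdis H0 v Hv.
    assert (HA : forall t, 0 <= t <= 1 -> A (phi (seg v0 v t))).
    { intros t Ht. right. exists (seg v0 v t). split; auto. }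
    assert (Hnb : forall (N : C -> Prop) t, open N -> 0 <= t <= 1 -> N (phi (seg v0 v t)) ->
      exists e, 0 < e /\ forall s, Rabs (s - t) < e -> N (phi (seg v0 v s))).
    { intros N t HN Ht H. destruct (locally_Cmod _ _ (HN _ H)) as [d [Hd K]].
      destruct (Hphi (seg v0 v t)) as [l Hl]; [apply HD; auto|].
      destruct (cder_ccont _ _ _ Hl d Hd) as [d1 [Hd1 K1]].
      destruct (seg_near v0 v t d1 Hd1) as [e [He Ke]]. exists e. split; auto. }
    assert (K : V (phi (seg v0 v 1))).
    { apply (unit_interval_constant (fun t => V (phi (seg v0 v t)))); [| |lra].
      - intros t Ht. destruct (Hcov _ (HA t Ht)) as [H|H].
        + destruct (Hnb V t HV Ht H) as [e [He Ke]]. exists e. split; auto.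
        + destruct (Hnb W t HW Ht H) as [e [He Ke]]. exists e. split; auto.
          intros s s' Hs _ Hse _ Hs1. exfalso. apply (Hdis _ (HA s Hs)). auto.
      - rewrite seg_0. auto. }
    rewrite seg_1 in K. exact K. }
  intros v Hv. apply (Hmax A).
  - intros V W HV HW Hcov Hdis. destruct (HUc V W HV HW) as [H|H].
    + intros z Hz. apply Hcov. left; auto.
    + intros z Hz. apply Hdis. left; auto.
    + left. intros z [Hz|[x [Hx <-]]]; auto. apply (Hstep V W); auto.
    + right. intros z [Hz|[x [Hx <-]]]; auto. apply (Hstep W V); auto.
      * intros q Hq. destruct (Hcov q Hq); auto.
      * intros q Hq [F1 F2]. apply (Hdis q Hq). auto.
  - intros z Hz. left; auto.
  - intros z [Hz|[x [Hx <-]]]; auto.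
  - right. exists v; auto.
Qed.

Lemma escapes_at_filterlim (z : R -> C) (beta : R) : escapes_at z beta ->
  filterlim (fun t => Cmod (z t)) (at_left beta) (Rbar_locally p_infty).
Proof.
  intros H P [B HB]. destruct (H B) as [d [Hd K]].
  exists (mkposreal d Hd). intros t Ht Hlt. apply HB, K.
  change (Rabs (t - beta) < d) in Ht. apply Rabs_lt_between in Ht. lra.
Qed.

Theorem theorem1p2 (f : C -> Chat) (U : C -> Prop) :
  transcendental_meromorphic f ->
  log_singularity_neighbourhood f U ->
  exists (alpha : nat -> Rbar) (beta : nat -> R) (z : nat -> R -> C),
    (forall n : nat,
       trajectory f (alpha n) (Finite (beta n)) (z n) /\
       filterlim (fun t => Cmod (z n t)) (at_left (beta n))
         (Rbar_locally p_infty) /\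
       at_left (beta n) (fun t => U (z n t))) /\
    (forall m n : nat, m <> n ->
       disjoint (orbit (alpha m) (Finite (beta m)) (z m))
                (orbit (alpha n) (Finite (beta n)) (z n))).
Proof.
  intros [Hf _] [M [HM [Hcomp [z0 [w0 [g [HU0 [Hf0 [Hg [_ [v0 [phi [Hv0 [Hphig [Han Hinj]]]]]]]]]]]]]]].
  set (m := ln M) in *.
  assert (Hphi : hol (rhalf m) phi).
  { intros v Hv. destruct (Han v Hv) as [l Hl]. exists l. apply cder_is_derive. exact Hl. }
  change (inj_on (rhalf m) phi) in Hinj.
  assert (HmR : forall v, rhalf m v -> M < exp (Re v)).
  { intros v Hv. rewrite <- (exp_ln M) by auto. apply exp_increasing. exact Hv. }
  assert (Hv0m : rhalf m v0).
  { pose proof (proj1 (proj2 Hcomp) z0 HU0) as K. unfold modulus_gt in K. rewrite Hf0 in K.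
    rewrite <- Hv0, Cmod_Cexp in K. unfold rhalf, m. rewrite <- (ln_exp (Re v0)). apply ln_increasing; auto. }
  assert (Hphi0 : phi v0 = z0).
  { apply locally_singleton in Hphig. rewrite Hphig, Hv0. apply Hg. }
  assert (Hexp : forall v, rhalf m v -> f (phi v) = Some (Cexp v)).
  { destruct Hg as [_ [r [Hr [_ Hgr]]]].
    destruct (locally_Cmod _ _ Hphig) as [d1 [Hd1 K1]].
    destruct (cder_ccont _ _ _ (cder_Cexp v0) r Hr) as [d2 [Hd2 K2]].
    (* Near [v0] the identity holds because [phi] is [g] composed with [Cexp] and [g] is an inverse
       branch of [f]. *)
    apply (exp_identity f (rhalf m) phi v0 (Rmin d1 d2)); auto.
    - apply good_rhalf.
    - apply Rmin_pos; auto.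
    - intros v Hv. rewrite K1.
      + apply Hgr. unfold Defs.disc. rewrite <- Hv0. apply K2.
        eapply lt_min_r, Hv.
      + eapply lt_min_l, Hv. }
  assert (HUphi : forall v, rhalf m v -> U (phi v)).
  { apply (component_absorbs_image U _ _ phi v0 Hcomp); auto.
    - apply convex_rhalf.
    - rewrite Hphi0; auto.
    - intros v Hv. unfold modulus_gt. rewrite Hexp, Cmod_Cexp by auto. auto. }
  assert (Hnz := exp_identity_derive f _ phi Hf (proj1 (good_rhalf m)) Hphi Hexp).
  destruct (far_coordinate m phi Hphi Hinj Hnz) as [m0 [L [Hm0 [HL HLd]]]].
  assert (Hsub : forall v, rhalf m0 v -> rhalf m v) by (unfold rhalf; intros; lra).
  assert (Hloc : forall n : nat, exists (alpha : Rbar) (z : R -> C) (tau : R) (V : R -> C),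
    trajectory f alpha (Finite 0) z /\ tau < 0 /\ Rbar_le alpha tau /\ escapes_at z 0 /\
    forall t, tau < t < 0 -> rhalf m0 (V t) /\ L (V t) = (- ln (- t), 2 * INR n * PI) /\ z t = phi (V t)).
  { intros n.
    destruct (escaping_solution m0 L phi (2 * INR n * PI) HL) as [tau [V [Htau HV]]]; auto.
    - eapply hol_sub; eauto.
    - replace (2 * INR n * PI) with (0 + 2 * INR n * PI) by ring. rewrite cos_period. apply cos_0.
    - replace (2 * INR n * PI) with (0 + 2 * INR n * PI) by ring. rewrite sin_period. apply sin_0.
    - assert (Hesc : escapes_at (fun t => phi (V t)) 0).
      { intros B. destruct (phi_escapes f m phi B Hf Hphi Hinj Hexp) as [X HX].
        exists (Rmin (- tau) (exp (- (2 * X)))). split; [apply Rmin_pos; [lra|apply exp_pos]|].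
        intros t Ht. pose proof (Rmin_l (- tau) (exp (- (2 * X)))). pose proof (Rmin_r (- tau) (exp (- (2 * X)))).
        destruct (HV t ltac:(lra)) as [V1 [_ [V3 _]]]. apply HX; auto.
        assert (ln (- t) < - (2 * X)); [|lra]. rewrite <- (ln_exp (- (2 * X))). apply ln_increasing; lra. }
      destruct (maximal_extension f (fun t => phi (V t)) tau 0 Hf Htau) as [alpha [z [Ht [Hle Hz]]]]; auto.
      + intros t Ht. destruct (HV t Ht) as [V1 [_ [_ V4]]].
        assert (E : f (phi (V t)) = Some (Cexp (V t))) by auto.
        split; [congruence|]. rewrite (finite_part_Some _ _ _ E). auto.
      + exists alpha, z, tau, V. split; [exact Ht|]. repeat split; auto.
        * intros B. destruct (Hesc B) as [d [Hd K]]. exists (Rmin d (- tau)).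
          split; [apply Rmin_pos; lra|]. intros t Ht'.
          pose proof (Rmin_l d (- tau)). pose proof (Rmin_r d (- tau)).
          rewrite Hz by lra. apply K. lra.
        * apply HV; auto.
        * apply HV; auto. }
  destruct (choice (A := nat) (B := (Rbar * (R -> C))%type)
    (fun n q => exists tau V, trajectory f (fst q) (Finite 0) (snd q) /\ tau < 0 /\ Rbar_le (fst q) tau /\ escapes_at (snd q) 0 /\
    forall t, tau < t < 0 -> rhalf m0 (V t) /\ L (V t) = (- ln (- t), 2 * INR n * PI) /\ snd q t = phi (V t)))
    as [q Hq].
  { intros n. destruct (Hloc n) as [alpha [z K]]. exists (alpha, z). exact K. }
  exists (fun n => fst (q n)), (fun _ => 0), (fun n => snd (q n)). split.
  - intros n. destruct (Hq n) as [tau [V [H1 [H2 [H3 [H4 H5]]]]]]. split; [exact H1|]. split.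
    + apply escapes_at_filterlim; auto.
    + assert (P : 0 < - tau) by lra. exists (mkposreal _ P). intros t Ht Hlt.
      change (Rabs (t - 0) < - tau) in Ht. apply Rabs_lt_between in Ht.
      destruct (H5 t ltac:(lra)) as [V1 [_ ->]]. auto.
  - intros n n' Hne p [[t1 [Ht1 E1]] [t2 [Ht2 E2]]].
    destruct (Hq n) as [tau [V [[_ [S1 _]] [H2 [H3 [H4 H5]]]]]].
    destruct (Hq n') as [tau' [V' [[_ [S1' _]] [H2' [H3' [H4' H5']]]]]].
    rewrite solves_flow_at in S1, S1'.
    assert (E : snd (q n) t1 = snd (q n') t2) by congruence.
    (* Both trajectories escape at time 0, so neither can be at the common point earlier than the
       other. *)
    pose proof (escape_not_delayed f _ _ _ _ t1 t2 Hf S1 S1' H4' Ht1 Ht2 E) as L1.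
    pose proof (escape_not_delayed f _ _ _ _ t2 t1 Hf S1' S1 H4 Ht2 Ht1 (eq_sym E)) as L2.
    assert (Et : t2 = t1) by lra. subst t2.
    destruct Ht1 as [A1 A2]. destruct Ht2 as [A1' _]. simpl in A2.
    (* Half of a negative maximum is later than all three times and still negative, so both
       trajectories are given there by their curves [V] and [V']. *)
    set (t := Rmax t1 (Rmax tau tau') / 2).
    assert (B1 : t1 <= Rmax t1 (Rmax tau tau')) by apply Rmax_l.
    assert (B2 : tau <= Rmax t1 (Rmax tau tau')) by (eapply Rle_trans; [apply Rmax_l|apply Rmax_r]).
    assert (B3 : tau' <= Rmax t1 (Rmax tau tau')) by (eapply Rle_trans; [apply Rmax_r|apply Rmax_r]).
    assert (B4 : Rmax t1 (Rmax tau tau') < 0) by (repeat apply Rmax_lub_lt; auto).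
    assert (Ez : snd (q n) t = snd (q n') t).
    { apply (flow_unique f _ _ t1 t Hf); auto. intros s Hs. unfold between in Hs.
      unfold t in Hs. rewrite Rmin_left, Rmax_right in Hs by lra.
      split; [apply S1|apply S1']; (split; [|simpl; lra]).
      - apply Rbar_lt_le_trans with (Finite t1); auto. simpl; lra.
      - apply Rbar_lt_le_trans with (Finite t1); auto. simpl; lra. }
    destruct (H5 t) as [V1 [V2 V3]]; [unfold t; lra|].
    destruct (H5' t) as [V1' [V2' V3']]; [unfold t; lra|].
    (* Injectivity of [phi] identifies the two points in the coordinate [v], where the imaginary
       part of [L] reads off the index. *)
    rewrite V3, V3' in Ez. apply Hinj in Ez; [|apply Hsub; auto|apply Hsub; auto].
    rewrite Ez, V2' in V2. injection V2 as V2.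
    apply Hne. apply INR_eq. pose proof PI_RGT_0. nra.
Qed.
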